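(* Let $q,\tilde q\in L^1(0,T)$ be complex-valued, and let the linear form $U_1$ be fixed (the same for $q$ and $\tilde q$), with $H_1\ne0$. Let $\{\lambda_{n1}\}_{n\ge1}$ and $\{\lambda^1_{n1}\}_{n\ge1}$ be the eigenvalues of the boundary value problems $L_1$ and $L_{11}$ with potential $q$, and let $\{\tilde\lambda_{n1}\}_{n\ge1}$, $\{\tilde\lambda^1_{n1}\}_{n\ge1}$ be the eigenvalues of the corresponding problems with potential $\tilde q$ (eigenvalues are counted with multiplicity as zeros of the characteristic functions). If $\lambda_{n1}=\tilde\lambda_{n1}$ and $\lambda^1_{n1}=\tilde\lambda^1_{n1}$ for all $n\ge1$, then $q(x)=\tilde q(x)$ for almost every $x\in(0,T)$.
   Context: Let $T>0$. For a complex-valued $q\in L^1(0,T)$ consider the equation $$-y''+q(x)y=\lambda y,\quad x\in(0,T),\qquad (\ast)$$ with complex spectral parameter $\lambda$. Let $\sigma_1$ be a complex-valued function of bounded variation on $[0,T]$, continuous from the right for $t>0$, and set $$U_1(y)=\int_0^T y(t)\,d\sigma_1(t),\qquad H_1:=\sigma_1(+0)-\sigma_1(0).$$ Equivalently, $U_1(y)=H_1y(0)+\int_0^T y(t)\,d\sigma_{10}(t)$, where $\sigma_{10}$ is of bounded variation and continuous from the right for all $t\ge 0$ (so $d\sigma_{10}$ has no mass at $0$). It is assumed that $H_1\neq 0$. The function $\sigma_1$ is known a priori and does not depend on the potential. Put $V_1(y)=y(T)$, $V_2(y)=y'(T)$. Let $X_1(x,\lambda),X_2(x,\lambda)$ be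 the solutions of $(\ast)$ with $X_1(0,\lambda)=X_2'(0,\lambda)=1$, $X_1'(0,\lambda)=X_2(0,\lambda)=0$. $L_1$ is the boundary value problem for $(\ast)$ with conditions $U_1(y)=V_1(y)=0$; its eigenvalues $\{\lambda_{n1}\}_{n\ge1}$ are the zeros of the entire characteristic function $\Delta_1(\lambda)=U_1(X_1)V_1(X_2)-U_1(X_2)V_1(X_1)$. $L_{11}$ is the boundary value problem for $(\ast)$ with conditions $U_1(y)=V_2(y)=0$; its eigenvalues $\{\lambda^1_{n1}\}_{n\ge1}$ are the zeros of the entire characteristic function $\Delta_{11}(\lambda)=U_1(X_1)V_2(X_2)-U_1(X_2)V_2(X_1)$. A tilde denotes the analogous object with $q$ replaced by $\tilde q$ (and the same $\sigma_1$). *)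

(* Defs.v *)
(* MathComp-Analysis, with R[i] of mathcomp-real-closed as complex field. *)
From HB Require Import structures.
From mathcomp Require Import all_boot all_order all_algebra.
From mathcomp Require Import all_classical all_reals all_analysis.
From mathcomp Require Import complex.

Set Implicit Arguments.
Unset Strict Implicit.
Unset Printing Implicit Defensive.

Import Order.TTheory GRing.Theory Num.Theory.
Import numFieldNormedType.Exports.

Local Open Scope classical_set_scope.
Local Open Scope complex_scope.
Local Open Scope ring_scope.

(* R[i]^o is R[i] as a normed module over itself; this alias carries the
   usual topology of the complex plane. *)
Notation Cx R := (R[i])^o.

Section SturmLiouville.
Variable R : realType.
Implicit Types (T : R) (f y q sigma : R -> Cx R) (z lam : Cx R).

Definition L1_potential T q : Prop :=
  (@lebesgue_measure R).-integrable `]0, T[ (EFin \o (fun x => complex.Re (q x))) /\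
  (@lebesgue_measure R).-integrable `]0, T[ (EFin \o (fun x => complex.Im (q x))).

(* Derivatives of complex-valued functions on [0, T]; they are one-sided at
   the two endpoints. *)
Definition quotient_at f (x t : R) : Cx R := ((t - x)^-1)%:C * (f t - f x).

Definition derivable_in T f (x : R) : Prop :=
  cvg (quotient_at f x t @[t --> within `[0, T] x^']).

Definition deriv_in T f (x : R) : Cx R :=
  lim (quotient_at f x t @[t --> within `[0, T] x^']).

(* A finite family of non-overlapping intervals [I.1, I.2] is listed from left
   to right. *)
Definition abs_continuous T f : Prop :=
  forall e : R, 0 < e -> exists2 d : R, 0 < d &
    forall s : seq (R * R),
      all (fun I => [&& 0 <= I.1, I.1 <= I.2 & I.2 <= T]) s ->
      pairwise (fun I J => I.2 <= J.1) s ->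
      \sum_(I <- s) (I.2 - I.1) < d ->
      \sum_(I <- s) `|f I.2 - f I.1| < e%:C.

(* Caratheodory solutions of - y'' + q y = lam y on (0, T). *)
Definition is_solution T q lam y : Prop :=
  [/\ forall x, x \in `[0, T] -> derivable_in T y x,
      abs_continuous T (deriv_in T y) &
      {ae @lebesgue_measure R, forall x, x \in `]0, T[ ->
        derivable_in T (deriv_in T y) x /\
        - deriv_in T (deriv_in T y) x + q x * y x = lam * y x}].

Definition fundamental_solutions T q (X1 X2 : R -> Cx R -> Cx R) : Prop :=
  forall lam,
    [/\ is_solution T q lam (X1 ^~ lam),
        X1 0 lam = 1 & deriv_in T (X1 ^~ lam) 0 = 0] /\
    [/\ is_solution T q lam (X2 ^~ lam),
        X2 0 lam = 0 & deriv_in T (X2 ^~ lam) 0 = 1].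

(* A complex function has bounded variation iff its two components do. *)
Definition complex_BV T sigma : Prop :=
  bounded_variation 0 T (fun t => complex.Re (sigma t)) /\
  bounded_variation 0 T (fun t => complex.Im (sigma t)).

Definition right_continuous_in T sigma : Prop :=
  forall t, t \in `]0, T[ -> sigma x @[x --> t^'+] --> sigma t.

Definition jump0 sigma : Cx R := lim (sigma x @[x --> 0^'+]) - sigma 0.

(* Riemann-Stieltjes integral over the closed interval [0, T], as a limit of
   sums over tagged partitions 0 < s_0 < ... < s_(n-1) = T whose mesh tends
   to 0; a jump of sigma at 0 contributes (sigma(+0) - sigma(0)) y(0). *)
Definition RS_sum y sigma (s : seq R) (xi : nat -> R) : Cx R :=
  \sum_(i < size s)
    y (xi i) * (sigma (nth 0 s i) - sigma (nth 0 (0 :: s) i)).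

Definition is_RS_integral T y sigma (I : Cx R) : Prop :=
  forall e : R, 0 < e -> exists2 d : R, 0 < d &
    forall (s : seq R) (xi : nat -> R),
      itv_partition 0 T s ->
      (forall i, (i < size s)%N ->
         nth 0 s i - nth 0 (0 :: s) i < d /\
         nth 0 (0 :: s) i <= xi i <= nth 0 s i) ->
      `|RS_sum y sigma s xi - I| < e%:C.

Definition RS_integral T y sigma : Cx R :=
  xget 0 [set I | is_RS_integral T y sigma I].

Definition U1 T sigma y : Cx R := RS_integral T y sigma.
Definition V1 T y : Cx R := y T.
Definition V2 T y : Cx R := deriv_in T y T.

Definition Delta1 T sigma (X1 X2 : R -> Cx R -> Cx R) lam : Cx R :=
  U1 T sigma (X1 ^~ lam) * V1 T (X2 ^~ lam) -
  U1 T sigma (X2 ^~ lam) * V1 T (X1 ^~ lam).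

Definition Delta11 T sigma (X1 X2 : R -> Cx R -> Cx R) lam : Cx R :=
  U1 T sigma (X1 ^~ lam) * V2 T (X2 ^~ lam) -
  U1 T sigma (X2 ^~ lam) * V2 T (X1 ^~ lam).

(* Order of vanishing at z, with complex derivatives; the order is 0 when
   F z <> 0. *)
Definition zero_order (F : Cx R -> Cx R) z (m : nat) : Prop :=
  (forall k, (k < m)%N -> @derive1n (R[i]) (Cx R) k F z = 0) /\
  @derive1n (R[i]) (Cx R) m F z <> 0.

(* The sequence ev_1, ev_2, ... (the value ev 0 is irrelevant) lists the zeros
   of F, each one as often as its multiplicity, and nothing else. *)
Definition zeros_with_multiplicity (F : Cx R -> Cx R) (ev : nat -> Cx R) : Prop :=
  forall z, exists2 m : nat, zero_order F z m &
    ([set n : nat | (0 < n)%N /\ ev n = z] #= `I_m)%card.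

End SturmLiouville.

(* Main.v *)
Require Import Defs.
From mathcomp Require Import all_boot all_order all_algebra.
From mathcomp Require Import all_classical all_reals all_analysis.
From mathcomp Require Import complex.
From mathcomp Require Import ring lra zify.
Import Order.TTheory GRing.Theory Num.Theory.
Import numFieldNormedType.Exports.
Local Open Scope classical_set_scope.
Local Open Scope complex_scope.
Local Open Scope ring_scope.

Set Implicit Arguments.
Unset Strict Implicit.
Unset Printing Implicit Defensive.

(** Let [phi] and [psi] be the solutions with Cauchy data (1, 0) and (0, 1) at the right end point
[T].  In terms of them the two characteristic functions are [- U1 psi] and [U1 phi]
([characteristic_forms]), and the theorem says that these two functions of the spectral parameter
determine the potential.

Two entire functions of this kind with the same zeros are equal ([form_eq_of_zeros]).  Put
[lam = - kappa^2].  Since [U1] has a mass [H] at 0, its value on a solution is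
[H (y T - y' T / kappa) exp (kappa T) / 2] up to a smaller error, as long as [lam] stays off a
narrow sector around the positive half-line ([form_asymptotics]); only the data at [T] enter, so
the quotient of the characteristic functions for [q] and [qt] tends to 1 there.  The quotient is
entire, and a lower bound for entire functions of order 1/2 on a sequence of circles
([min_modulus]) makes its growth there less than that of [exp (|lam|^2)].  The Phragmen-Lindelof
principle in the sector and Liouville's theorem show that it is 1 ([sector_liouville]).

Now [U1 phi = U1 phit] and [U1 psi = U1 psit], where the second functions belong to [qt].
Suppose that [phi = phit] and [psi = psit] on [a, T], which holds for [a = T].  By linearity the
form [Ua], which is [U1] applied after the argument is frozen beyond [a], also takes the same
values on [phi] and [phit], and on [psi] and [psit].  For [x] between [a / 2] and [a] the difference
[A = phi psit - psi phit] at [x] satisfies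
[A Ua psi = (phi Ua psi - psi Ua phi) psit - psi (phit Ua psit - psit Ua phit)].
The combinations in parentheses are values of [Ua] on solutions that vanish at [x] with
derivative [1]; as [Ua] sees only points at distance at most [x] from [x], they are at most
[exp (x Re kappa) / |kappa|] up to a constant, while [psi] and [psit] at [x] are at most
[exp ((T - x) Re kappa) / |kappa|].  On the left, [Ua psi] is at least a constant times
[exp (T Re kappa) / |kappa|], since [Ua] has the mass [H] at 0, too.  Therefore [A] tends to 0 off
the sector, and it vanishes identically ([cross_decay]).  Comparing Wronskians, [phi = phit]
and [psi = psit] at [x] ([terminal_eq]).  So the agreement extends to [a / 2, T]
([halving_step]), hence to all of (0, T], and the potentials agree wherever both equations hold
([potential_eq]).

The complex analysis rests on expansions of all orders ([ana]) in place of power series or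
contour integrals: the maximum principle follows from averaging over four points
([max_principle]), and dividing by [z - z0] turns it into Cauchy's estimates ([slope_bound]).
On the interval, increments are estimated by Cousin's lemma; for absolutely continuous functions
the null set where the equation fails does not count ([gauge_bound]).  In this way every
solution is compared with the solution for potential zero ([solution_estimate]). *)

(** * Modulus of complex numbers *)

Section Modulus.
Variable R : realType.
Local Notation C := (R[i]).

(** The real-valued modulus: the norm of the field of complex numbers takes its values in the
field itself, which would make every estimate a complex inequality. *)
Definition cabs (z : C) : R := ComplexField.Normc.normc z.

Lemma cabsE (z : C) : `|z| = (cabs z)%:C.
Proof. by rewrite normc_def /cabs /ComplexField.Normc.normc; case: z. Qed.

Lemma cabs_ge0 z : 0 <= cabs z.
Proof. by rewrite /cabs /ComplexField.Normc.normc; case: z => a b; rewrite sqrtr_ge0. Qed.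

Lemma cabs0 : cabs 0 = 0. Proof. exact: ComplexField.Normc.normc0. Qed.
Lemma cabs1 : cabs 1 = 1. Proof. exact: ComplexField.Normc.normc1. Qed.
Lemma cabsM z w : cabs (z * w) = cabs z * cabs w.
Proof. exact: ComplexField.Normc.normcM. Qed.
Lemma cabsV z : cabs z^-1 = (cabs z)^-1.
Proof. exact: ComplexField.Normc.normcV. Qed.
Lemma cabsN z : cabs (- z) = cabs z. Proof. exact: normcN. Qed.
Lemma cabsD z w : cabs (z + w) <= cabs z + cabs w.
Proof. exact: le_normcD. Qed.
Lemma cabsB z w : cabs (z - w) <= cabs z + cabs w.
Proof. by rewrite -(cabsN w) cabsD. Qed.
Lemma cabsC z w : cabs (z - w) = cabs (w - z).
Proof. by rewrite -cabsN opprB. Qed.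

Lemma cabs_eq0 z : (cabs z == 0) = (z == 0).
Proof.
apply/eqP/eqP => [/ComplexField.Normc.eq0_normc //|->]; exact: cabs0.
Qed.

Lemma cabs_gt0 z : (0 < cabs z) = (z != 0).
Proof. by rewrite lt0r cabs_ge0 cabs_eq0 andbT. Qed.

Lemma cabsX z n : cabs (z ^+ n) = cabs z ^+ n.
Proof.
by elim: n => [|n IH]; rewrite ?expr0 ?cabs1 // !exprS cabsM IH.
Qed.

Lemma cabs_real (x : R) : cabs x%:C = `|x|.
Proof. by rewrite /cabs /= expr0n addr0 sqrtr_sqr. Qed.

Lemma cabs_sqr z : cabs z ^+ 2 = complex.Re z ^+ 2 + complex.Im z ^+ 2.
Proof.
by case: z => a b; rewrite /cabs /= sqr_sqrtr // addr_ge0 // sqr_ge0.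
Qed.

Lemma cabs_Re z : `|complex.Re z| <= cabs z.
Proof.
rewrite -(@ler_pXn2r _ 2) ?nnegrE ?normr_ge0 ?cabs_ge0 // cabs_sqr.
by rewrite real_normK ?num_real // lerDl sqr_ge0.
Qed.

Lemma cabs_Im z : `|complex.Im z| <= cabs z.
Proof.
rewrite -(@ler_pXn2r _ 2) ?nnegrE ?normr_ge0 ?cabs_ge0 // cabs_sqr.
by rewrite real_normK ?num_real // lerDr sqr_ge0.
Qed.

Lemma cabs_ReIm z : cabs z <= `|complex.Re z| + `|complex.Im z|.
Proof.
rewrite {1}[z]complexE.
apply: (le_trans (cabsD _ _)).
rewrite cabsM !cabs_real.
suff -> : cabs 'i%C = 1 by rewrite mul1r.
by rewrite /cabs /= expr0n add0r expr1n sqrtr1.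
Qed.

Lemma cabs_tri z w : cabs z - cabs w <= cabs (z - w).
Proof. by rewrite lerBlDr; apply: le_trans (cabsD _ _); rewrite subrK. Qed.

Lemma cabs_sum (I : Type) (s : seq I) (P : pred I) (F : I -> C) :
  cabs (\sum_(i <- s | P i) F i) <= \sum_(i <- s | P i) cabs (F i).
Proof.
elim/big_ind2: _ => [|x1 x2 y1 y2 h1 h2|//]; first by rewrite cabs0.
exact: le_trans (cabsD _ _) (lerD h1 h2).
Qed.

Lemma le0_small (x : R) : (forall e : R, 0 < e -> x <= e) -> x <= 0.
Proof.
by move=> h; apply/ler_addgt0Pr => e e0; rewrite add0r h.
Qed.

Lemma cabs_le_small (z : C) : (forall e : R, 0 < e -> cabs z <= e) -> z = 0.
Proof.
move=> /le0_small h; apply/eqP; rewrite -cabs_eq0 eq_le h /=; exact: cabs_ge0.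
Qed.

End Modulus.
Arguments cabs {R}.

(** * Taylor expansions of all orders *)

Section Taylor.
Variable R : realType.
Local Notation C := (R[i]).
Implicit Types (f g : C -> C) (z h : C) (p : {poly C}).

(** The polynomial [p] approximates [f] at [z] up to order [n]; nothing is asked of the degree of
[p], so that sums and products of approximations are approximations without truncation. *)
Definition taylor f z n p := exists K r : R, [/\ 0 <= K, 0 < r, r <= 1 &
  forall h, cabs h <= r -> cabs (f (z + h) - p.[h]) <= K * cabs h ^+ n].

(** Analyticity as existence of Taylor expansions of all orders. It passes to products, quotients
and compositions by algebra alone, and it suffices for the maximum principle, so that neither
power series nor contour integrals enter. *)
Definition ana f z := forall n, exists p, taylor f z n p.

Lemma taylorI f z n p (K r : R) : 0 < r ->
  (forall h, cabs h <= r -> cabs (f (z + h) - p.[h]) <= K * cabs h ^+ n) ->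
  taylor f z n p.
Proof.
move=> r0 H; exists `|K|, (Num.min r 1); split => //.
- by rewrite lt_min r0 ltr01.
- by rewrite ge_min lexx orbT.
move=> h; rewrite le_min => /andP[hr _].
apply: (le_trans (H _ hr)); apply: ler_wpM2r; first exact/exprn_ge0/cabs_ge0.
exact: ler_norm.
Qed.

Lemma poly_bounded p : exists2 M : R, 0 <= M &
  forall h, cabs h <= 1 -> cabs p.[h] <= M.
Proof.
exists (\sum_(i < size p) cabs p`_i); first by apply: sumr_ge0 => i _; exact: cabs_ge0.
move=> h h1; rewrite horner_coef; apply: (le_trans (cabs_sum _ _ _)).
apply: ler_sum => i _; rewrite cabsM cabsX ler_piMr ?cabs_ge0 //.
by rewrite exprn_ile1 // cabs_ge0.
Qed.

Lemma taylor_le f z m n p : (m <= n)%N -> taylor f z n p -> taylor f z m p.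
Proof.
move=> mn [K [r [K0 r0 r1 H]]]; exists K, r; split => // h hr.
apply: (le_trans (H _ hr)); apply: ler_wpM2l => //.
by apply: ler_wiXn2l => //; [exact: cabs_ge0|exact: le_trans hr r1].
Qed.

Lemma taylor0 f z n p : taylor f z n.+1 p -> p.[0] = f z.
Proof.
move=> [K [r [K0 r0 r1 H]]].
have := H 0; rewrite cabs0 expr0n mulr0 addr0 => /(_ (ltW r0)) h.
by apply/esym/eqP; rewrite -subr_eq0 -cabs_eq0 eq_le h cabs_ge0.
Qed.

(** The constant coefficient is a limit along small real [h]; divide by [h] and repeat. *)
Lemma taylor_small n p (K r : R) : 0 < r ->
  (forall h, h != 0 -> cabs h <= r -> cabs p.[h] <= K * cabs h ^+ n) ->
  forall k, (k < n)%N -> p`_k = 0.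
Proof.
elim: n p K r => [//|n IH] p K r r0 H.
have [M M0 HM] := poly_bounded (drop_poly 1 p).
have pE h : p.[h] = (drop_poly 1 p).[h] * h + p`_0.
  rewrite -[in LHS](poly_take_drop 1 p) hornerD hornerM hornerX addrC.
  congr (_ + _); rewrite (@size1_polyC _ (take_poly 1 p)) ?size_take_poly //.
  by rewrite hornerC coef_take_poly.
have p0 : p`_0 = 0.
  apply: cabs_le_small => e e0.
  pose t : R := Num.min (Num.min r 1) (e / (`|K| + M + 1)).
  have D0 : 0 < `|K| + M + 1 by have := normr_ge0 K; lra.
  have t0 : 0 < t by rewrite !lt_min r0 ltr01 divr_gt0.
  have tr : t <= r by rewrite /t !ge_min lexx.
  have t1 : t <= 1 by rewrite /t !ge_min lexx !orbT.
  have te : t <= e / (`|K| + M + 1) by rewrite /t ge_min lexx orbT.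
  have ct : cabs t%:C = t by rewrite cabs_real gtr0_norm.
  have tn : t%:C != 0 :> C by rewrite -cabs_gt0 ct.
  have {}h1 := H _ tn; rewrite ct in h1; have {}h1 := h1 tr.
  have h2 := HM t%:C; rewrite ct in h2; have {}h2 := h2 t1.
  have -> : p`_0 = p.[t%:C] - (drop_poly 1 p).[t%:C] * t%:C.
    by rewrite pE addrAC subrr add0r.
  apply: (le_trans (cabsB _ _)); rewrite cabsM ct.
  have h3 : K * t ^+ n.+1 <= `|K| * t.
    apply: (le_trans (ler_norm _)); rewrite normrM ler_wpM2l //.
    have t0' := ltW t0.
    by rewrite ger0_norm ?exprn_ge0 // exprS ler_piMr // exprn_ile1.
  have h4 : cabs (drop_poly 1 p).[t%:C] * t <= M * t.
    by rewrite ler_wpM2r // (ltW t0).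
  rewrite ler_pdivlMr // in te.
  have K0 := normr_ge0 K.
  nra.
have pE' h : p.[h] = (drop_poly 1 p).[h] * h by rewrite pE p0 addr0.
have {}IH : forall k, (k < n)%N -> (drop_poly 1 p)`_k = 0.
  apply: (IH _ K r r0) => h hn hr.
  have := H h hn hr; rewrite pE' cabsM exprSr mulrA ler_pM2r //.
  by rewrite cabs_gt0.
case=> [//|k]; rewrite ltnS => /IH.
by rewrite coef_drop_poly addn1.
Qed.

Lemma taylor_uniq f z n p1 p2 : taylor f z n p1 -> taylor f z n p2 ->
  forall k, (k < n)%N -> p1`_k = p2`_k.
Proof.
move=> [K [r [K0 r0 r1 H]]] [L [s [L0 s0 s1 H']]] k kn.
apply/eqP; rewrite -subr_eq0 -coefB; apply/eqP.
apply: (@taylor_small n _ (K + L) (Num.min r s)) kn.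
  by rewrite lt_min r0 s0.
move=> h _; rewrite le_min => /andP[hr hs].
rewrite hornerD hornerN mulrDl.
have -> : p1.[h] - p2.[h] = (f (z + h) - p2.[h]) - (f (z + h) - p1.[h]) by ring.
by apply: (le_trans (cabsB _ _)); rewrite addrC lerD // ?H ?H'.
Qed.

Lemma taylor_cst (c z : C) n : taylor (fun=> c) z n c%:P.
Proof.
exists 0, 1; split => // h _.
by rewrite hornerC subrr cabs0 mul0r.
Qed.

Lemma taylor_id z n : taylor id z n (z%:P + 'X).
Proof.
exists 0, 1; split => // h _.
by rewrite hornerD hornerC hornerX subrr cabs0 mul0r.
Qed.

Lemma taylorD f g z n p q : taylor f z n p -> taylor g z n q ->
  taylor (fun w => f w + g w) z n (p + q).
Proof.
move=> [K [r [K0 r0 r1 H]]] [L [s [L0 s0 s1 H']]].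
apply: (@taylorI _ _ _ _ (K + L) (Num.min r s)).
  by rewrite lt_min r0 s0.
move=> h; rewrite le_min => /andP[hr hs].
rewrite hornerD mulrDl.
have -> : f (z + h) + g (z + h) - (p.[h] + q.[h]) =
  (f (z + h) - p.[h]) + (g (z + h) - q.[h]) by ring.
by apply: (le_trans (cabsD _ _)); rewrite lerD // ?H ?H'.
Qed.

Lemma taylorM f g z n p q : taylor f z n p -> taylor g z n q ->
  taylor (fun w => f w * g w) z n (p * q).
Proof.
move=> [K [r [K0 r0 r1 H]]] [L [s [L0 s0 s1 H']]].
have [M M0 HM] := poly_bounded p.
have [N N0 HN] := poly_bounded q.
apply: (@taylorI _ _ _ _ (K * (L + N) + M * L) (Num.min r s)).
  by rewrite lt_min r0 s0.
move=> h; rewrite le_min => /andP[hr hs].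
have h1 : cabs h <= 1 by exact: le_trans hr r1.
have hn1 : cabs h ^+ n <= 1 by rewrite exprn_ile1 // cabs_ge0.
have hn0 : 0 <= cabs h ^+ n by rewrite exprn_ge0 // cabs_ge0.
rewrite hornerM.
have -> : f (z + h) * g (z + h) - (p.[h] * q.[h]) =
  (f (z + h) - p.[h]) * ((g (z + h) - q.[h]) + q.[h])
  + p.[h] * (g (z + h) - q.[h]) by ring.
apply: (le_trans (cabsD _ _)); rewrite !cabsM mulrDl; apply: lerD.
  rewrite -mulrA [_ * _ ^+ _]mulrC mulrA.
  apply: ler_pM; rewrite ?cabs_ge0 //; first exact: H.
  apply: (le_trans (cabsD _ _)); apply: lerD; last exact: HN.
  by apply: (le_trans (H' _ hs)); rewrite ler_piMr.
rewrite -mulrA; apply: ler_pM; rewrite ?cabs_ge0 ?HM ?H' //.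
Qed.

Lemma taylor_near f g z n p (r : R) : 0 < r ->
  (forall h, cabs h <= r -> f (z + h) = g (z + h)) ->
  taylor f z n p -> taylor g z n p.
Proof.
move=> r0 fg [L [s [L0 s0 s1 H']]].
apply: (@taylorI _ _ _ _ L (Num.min r s)).
  by rewrite lt_min r0 s0.
move=> h; rewrite le_min => /andP[hr hs].
by rewrite -fg // H'.
Qed.

Lemma ana_near f g z (r : R) : 0 < r ->
  (forall h, cabs h <= r -> f (z + h) = g (z + h)) -> ana f z -> ana g z.
Proof. by move=> r0 fg fa n; have [p hp] := fa n; exists p; exact: (taylor_near r0 fg hp). Qed.

Lemma ana_ext f g z : (forall w, f w = g w) -> ana f z -> ana g z.
Proof. by move=> fg; apply: (@ana_near _ _ _ 1) => // h _. Qed.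

Lemma ana_cst (c z : C) : ana (fun=> c) z.
Proof. by move=> n; exists c%:P; exact: taylor_cst. Qed.

Lemma ana_id z : ana id z.
Proof. by move=> n; exists (z%:P + 'X); exact: taylor_id. Qed.

Lemma anaD f g z : ana f z -> ana g z -> ana (fun w => f w + g w) z.
Proof.
by move=> fa ga n; have [p hp] := fa n; have [q hq] := ga n; exists (p + q); exact: taylorD.
Qed.

Lemma anaM f g z : ana f z -> ana g z -> ana (fun w => f w * g w) z.
Proof.
by move=> fa ga n; have [p hp] := fa n; have [q hq] := ga n; exists (p * q); exact: taylorM.
Qed.

Lemma anaN f z : ana f z -> ana (fun w => - f w) z.
Proof.
move=> fa; apply: (@ana_ext (fun w => (-1) * f w)); first by move=> w; rewrite mulN1r.
by apply: anaM => //; exact: ana_cst.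
Qed.

Lemma anaB f g z : ana f z -> ana g z -> ana (fun w => f w - g w) z.
Proof. by move=> fa ga; apply: anaD => //; exact: anaN. Qed.

Lemma ana_cont f z : ana f z -> forall e : R, 0 < e ->
  exists2 d : R, 0 < d & forall h, cabs h <= d -> cabs (f (z + h) - f z) <= e.
Proof.
move=> fa e e0; have [p [K [r [K0 r0 r1 H]]]] := fa 1%N.
have p0 : p.[0] = f z by apply: (@taylor0 _ _ 0); exists K, r; split.
have [M M0 HM] := poly_bounded (drop_poly 1 p).
have pE h : p.[h] = (drop_poly 1 p).[h] * h + f z.
  have E w : p.[w] = (drop_poly 1 p).[w] * w + p`_0.
    rewrite -[in LHS](poly_take_drop 1 p) hornerD hornerM hornerX addrC.
    congr (_ + _); rewrite (@size1_polyC _ (take_poly 1 p)) ?size_take_poly //.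
    by rewrite hornerC coef_take_poly.
  by rewrite -p0 !E mulr0 add0r.
have D0 : 0 < K + M + 1 by lra.
exists (Num.min r (e / (K + M + 1))); first by rewrite lt_min r0 divr_gt0.
move=> h; rewrite le_min => /andP[hr]; rewrite ler_pdivlMr // => he.
have -> : f (z + h) - f z = (f (z + h) - p.[h]) + (drop_poly 1 p).[h] * h.
  by rewrite pE; ring.
apply: (le_trans (cabsD _ _)); rewrite cabsM.
have h1 := H h hr; rewrite expr1 in h1.
have h2 : cabs (drop_poly 1 p).[h] * cabs h <= M * cabs h.
  by apply: ler_wpM2r; rewrite ?cabs_ge0 // HM // (le_trans hr r1).
have := cabs_ge0 h; nra.
Qed.

Lemma ana_neq0 f z : ana f z -> f z != 0 ->
  exists2 d : R, 0 < d & forall h, cabs h <= d -> cabs (f z) / 2 <= cabs (f (z + h)).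
Proof.
move=> fa; rewrite -cabs_gt0 => fz.
have [d d0 H] := @ana_cont _ _ fa (cabs (f z) / 2) ltac:(by rewrite divr_gt0).
exists d => // h /H; rewrite cabsC => h1.
have := cabs_tri (f z) (f (z + h)); lra.
Qed.

(** Modulo a power of ['X] the inverse is a geometric sum. *)
Lemma poly_inv_mod p n : p`_0 != 0 -> exists q s, p * q = 1 - s * 'X^n.
Proof.
move=> p0; pose c := p`_0.
have [w pE] : exists w, p = c *: (1 - w * 'X).
  exists (- c^-1 *: drop_poly 1 p).
  rewrite -[LHS](poly_take_drop 1 p) (@size1_polyC _ (take_poly 1 p)) ?size_take_poly //.
  rewrite coef_take_poly /= -/c expr1 scalerBr scaleNr mulNr scalerN opprK.
  by rewrite -scalerAl scalerA mulfV // scale1r alg_polyC.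
exists (c^-1 *: \sum_(i < n) (w * 'X) ^+ i), (w ^+ n).
rewrite pE -scalerAr -scalerAl scalerA mulVf // scale1r.
have := subrXX 1 (w * 'X) n; rewrite expr1n exprMn => ->.
by congr (_ * _); apply: eq_bigr => i _; rewrite expr1n mul1r.
Qed.

(** With [p] an expansion of [f] and [q] an inverse of [p] modulo ['X^n], the difference [1 / f -
q] is [(1 - f q) / f], and [f] stays away from 0 near [z]. *)
Lemma anaV f z : ana f z -> f z != 0 -> ana (fun w => (f w)^-1) z.
Proof.
move=> fa fz n.
have [p hp] := fa n.+1.
have p0 := taylor0 hp.
have {}p0 : p`_0 != 0 by rewrite -horner_coef0 p0.
have [q [s pq]] := poly_inv_mod n p0.
have {}hp := taylor_le (leqnSn n) hp.
move: hp => [K [r [K0 r0 r1 H]]].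
have [d d0 Hd] := ana_neq0 fa fz.
have [M M0 HM] := poly_bounded q.
have [N N0 HN] := poly_bounded s.
exists q.
apply: (@taylorI _ _ _ _ ((2 / cabs (f z)) * (N + K * M)) (Num.min r d)).
  by rewrite lt_min r0 d0.
move=> h; rewrite le_min => /andP[hr hd].
have h1 : cabs h <= 1 by exact: le_trans hr r1.
have fz0 : 0 < cabs (f z) by rewrite cabs_gt0.
have g0 : 0 < cabs (f (z + h)) by apply: lt_le_trans (Hd h hd); rewrite divr_gt0.
have gn : f (z + h) != 0 by rewrite -cabs_gt0.
have E : 1 = p.[h] * q.[h] + s.[h] * h ^+ n.
  by rewrite -hornerM pq hornerD hornerN hornerM hornerXn hornerC subrK.
have -> : (f (z + h))^-1 - q.[h] =
   (f (z + h))^-1 * (s.[h] * h ^+ n - (f (z + h) - p.[h]) * q.[h]).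
  apply: (mulfI gn); rewrite mulrA divff // mulrBr divff // {1}E; ring.
rewrite cabsM cabsV -[leRHS]mulrA; apply: ler_pM; rewrite ?invr_ge0 ?cabs_ge0 //.
  by rewrite -invf_div lef_pV2 ?posrE ?divr_gt0 ?Hd.
apply: (le_trans (cabsB _ _)); rewrite !cabsM cabsX mulrDl; apply: lerD.
  by rewrite ler_wpM2r ?HN ?exprn_ge0 ?cabs_ge0.
rewrite mulrAC; apply: ler_pM; rewrite ?cabs_ge0 ?HM ?H //.
Qed.

End Taylor.

(** * The maximum principle *)

Section MaximumPrinciple.
Variable R : realType.
Local Notation C := (R[i]).
Implicit Types (f g : C -> C) (z h : C) (p : {poly C}).

Lemma taylor2 f z : ana f z -> exists b c, exists K r : R,
  [/\ 0 <= K, 0 < r & forall h, cabs h <= r ->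
    cabs (f (z + h) - (f z + b * h + c * h ^+ 2)) <= K * cabs h ^+ 3].
Proof.
move=> fa; have [p hp] := fa 3%N; have p0 := taylor0 hp.
have [K [r [K0 r0 r1 H]]] := hp.
have [M M0 HM] := poly_bounded (drop_poly 3 p).
exists p`_1, p`_2, (K + M), r; split => //; first by rewrite addr_ge0.
move=> h hr; have h1 : cabs h <= 1 by exact: le_trans hr r1.
have E w : p.[w] = p`_0 + p`_1 * w + p`_2 * w ^+ 2 + (drop_poly 3 p).[w] * w ^+ 3.
  rewrite -[in LHS](poly_take_drop 3 p) hornerD hornerM hornerXn; congr (_ + _).
  rewrite (@horner_coef_wide _ 3) ?size_take_poly // !big_ord_recl big_ord0 /=.
  by rewrite !coef_take_poly /= /bump /= addr0 expr0 mulr1 expr1 addrA.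
have p0' : p`_0 = f z by rewrite -horner_coef0 p0.
have -> : f (z + h) - (f z + p`_1 * h + p`_2 * h ^+ 2) =
  (f (z + h) - p.[h]) + (drop_poly 3 p).[h] * h ^+ 3 by rewrite E p0'; ring.
apply: (le_trans (cabsD _ _)); rewrite mulrDl cabsM cabsX lerD ?H //.
by rewrite ler_wpM2r ?HM ?exprn_ge0 ?cabs_ge0.
Qed.

(** Parseval's identity on the fourth roots of unity: the cross terms cancel since the
coefficients of degrees 0, 1, 2 belong to different characters. *)
Lemma four_roots_mean (a b c : C) :
  cabs (a + b + c) ^+ 2 + cabs (a - b + c) ^+ 2 +
  cabs (a + 'i%C * b - c) ^+ 2 + cabs (a - 'i%C * b - c) ^+ 2 =
  4 * (cabs a ^+ 2 + cabs b ^+ 2 + cabs c ^+ 2).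
Proof. by rewrite !cabs_sqr; case: a b c => [a1 a2] [b1 b2] [c1 c2] /=; ring. Qed.

(** Transported to the plane, where closed bounded sets are known to be compact. *)
Definition closedC (K : C -> Prop) := closed [set xy : R * R | K (xy.1 +i* xy.2)%C].

Lemma closedCP (K : C -> Prop) :
  (forall z, ~ K z -> exists2 d : R, 0 < d & forall h, cabs h <= d -> ~ K (z + h)) ->
  closedC K.
Proof.
move=> H; rewrite /closedC -[X in closed X]setCK; apply: open_closedC.
rewrite openE => -[x y] /= nK.
have [d d0 Hd] := H _ nK.
have d20 : 0 < d / 2 by rewrite divr_gt0.
exists (ball x (d / 2), ball y (d / 2)); first by split; exact: nbhsx_ballx.
move=> -[x' y'] [/= b1 b2].
have -> : (x' +i* y')%C = (x +i* y)%C + ((x' +i* y')%C - (x +i* y)%C) by ring.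
apply: Hd; apply: (le_trans (cabs_ReIm _)) => /=.
move: b1 b2; rewrite /ball /= => b1 b2.
by rewrite [`|x' - _|]distrC [`|y' - _|]distrC (splitr d) lerD // ltW.
Qed.

Lemma evtC (K : C -> Prop) (u : C -> R) (M : R) z0 : closedC K ->
  (forall z, K z -> cabs z <= M) ->
  (forall z, K z -> forall e : R, 0 < e -> exists2 d : R, 0 < d &
     forall h, cabs h <= d -> `|u (z + h) - u z| <= e) ->
  K z0 -> exists2 zm, K zm & forall z, K z -> u z <= u zm.
Proof.
move=> cK bK uc Kz0.
pose A := [set xy : R * R | K (xy.1 +i* xy.2)%C].
have cA : compact A.
  apply: (@subclosed_compact _ _ (`[-M, M] `*` `[-M, M])%classic cK).
    by apply: compact_setX; exact: segment_compact.
  move=> [x y] /= /bK h.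
  have := cabs_Re (x +i* y)%C; have := cabs_Im (x +i* y)%C => /= h1 h2.
  by split; rewrite /= in_itv /= -ler_norml; apply: le_trans h.
have A0 : A !=set0 by exists (complex.Re z0, complex.Im z0); rewrite /A /=; case: z0 Kz0.
have uA : {within A, continuous (fun xy : R * R => u (xy.1 +i* xy.2)%C)}.
  apply: continuous_in_subspaceT => xy /[!inE] Axy.
  apply/cvgrPdist_le => e e0.
  have [d d0 Hd] := uc _ Axy _ e0.
  have d20 : 0 < d / 2 by rewrite divr_gt0.
  exists (ball xy.1 (d / 2), ball xy.2 (d / 2)); first by split; exact: nbhsx_ballx.
  move=> -[x' y'] [/= b1 b2].
  rewrite distrC; set w := (x' +i* y')%C; set w0 := (xy.1 +i* xy.2)%C.
  have -> : w = w0 + (w - w0) by ring.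
  apply: Hd; apply: (le_trans (cabs_ReIm _)).
  rewrite /w /w0 /=; move: b1 b2; rewrite /ball /= => b1 b2.
  by rewrite [`|x' - _|]distrC [`|y' - _|]distrC (splitr d) lerD // ltW.
have [[x y]] := compact_EVT_max A0 cA uA.
rewrite inE => Axy Hm; exists (x +i* y)%C => // -[a b] Kz.
by have := Hm (a, b); apply; rewrite inE.
Qed.

Lemma ana_bounded (K : C -> Prop) f (M : R) : closedC K ->
  (forall z, K z -> cabs z <= M) -> (forall z, K z -> ana f z) ->
  exists B : R, forall z, K z -> cabs (f z) <= B.
Proof.
move=> cK bK fa.
have [[z0 Kz0]|N] := pselect (exists z, K z); last first.
  by exists 0 => z Kz; case: N; exists z.
have [|zm _ H] := @evtC K (fun z => cabs (f z)) M z0 cK bK _ Kz0.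
  move=> z Kz e e0; have [d d0 Hd] := ana_cont (fa z Kz) e0.
  exists d => // h /Hd; apply: le_trans.
  rewrite ler_norml lerNl opprB; apply/andP; split; last exact: cabs_tri.
  by rewrite cabsC cabs_tri.
by exists (cabs (f zm)).
Qed.

(** The value of [|f|^2 + d |z|^2] at a point is strictly below its mean over the four points [z +
t i^k], [t] small, so that function has no interior maximum; then let [d] tend to 0. Only a
second-order expansion of [f] is used. [Z] contains the boundary of [K]. *)
Lemma max_principle (K Z : C -> Prop) f (M B : R) : closedC K ->
  (forall z, K z -> cabs z <= M) -> (forall z, K z -> ana f z) ->
  0 <= B -> (forall z, K z -> Z z -> cabs (f z) <= B) ->
  (forall z, K z -> ~ Z z -> exists2 r : R, 0 < r & forall h, cabs h <= r -> K (z + h)) ->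
  forall z, K z -> cabs (f z) <= B.
Proof.
move=> cK bK fa B0 fZ KZ z Kz.
have M0 : 0 <= M by apply: le_trans (bK _ Kz); exact: cabs_ge0.
rewrite -(@ler_pXn2r _ 2) ?nnegrE ?cabs_ge0 // -subr_le0.
apply: le0_small => e e0.
(* [d |z|^2 <= e] on [K]. *)
pose d := e / (M ^+ 2 + 1).
have D0 : 0 < M ^+ 2 + 1 by have := sqr_ge0 M; lra.
have d0 : 0 < d by rewrite divr_gt0.
have dM : d * M ^+ 2 <= e by rewrite /d -mulrA ler_piMr ?(ltW e0) // ler_pdivrMl // mulr1; lra.
pose u z := cabs (f z) ^+ 2 + d * cabs z ^+ 2.
have [|zm Kzm Hm] := @evtC K u M z cK bK _ Kz.
  move=> w Kw e' e'0.
  pose G := cabs (f w) + 1; pose H := cabs w + 1.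
  have G0 : 0 < G by have := cabs_ge0 (f w); rewrite /G; lra.
  have H0 : 0 < H by have := cabs_ge0 w; rewrite /H; lra.
  pose e1 := Num.min 1 (e' / (4 * G)).
  have e10 : 0 < e1 by rewrite lt_min ltr01 divr_gt0 // mulr_gt0.
  have [d1 d10 Hd] := ana_cont (fa w Kw) e10.
  exists (Num.min d1 (Num.min 1 (e' / (4 * d * H)))).
    by rewrite !lt_min d10 ltr01 divr_gt0 // mulr_gt0 // mulr_gt0.
  move=> h; rewrite !le_min => /andP[/Hd]; rewrite le_min => /andP[f1 f2] /andP[h1 h2].
  rewrite /u.
  have A1 : `|cabs (f (w + h)) - cabs (f w)| <= cabs (f (w + h) - f w).
    by rewrite ler_norml lerNl opprB cabsC cabs_tri cabsC cabs_tri.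
  have A2 : `|cabs (w + h) - cabs w| <= cabs h.
    rewrite ler_norml lerNl opprB; apply/andP; split.
      have := cabs_tri w (w + h).
      by rewrite (_ : w - (w + h) = - h) ?cabsN //; ring.
    by rewrite lerBlDr addrC cabsD.
  rewrite ler_pdivlMr in f2; last by rewrite mulr_gt0.
  rewrite ler_pdivlMr in h2; last by rewrite mulr_gt0 // mulr_gt0.
  have A3 : `|cabs (f (w + h)) ^+ 2 - cabs (f w) ^+ 2| <= e' / 2.
    rewrite subr_sqr normrM.
    have S1 : `|cabs (f (w + h)) + cabs (f w)| <= 2 * G.
      rewrite ger0_norm ?addr_ge0 ?cabs_ge0 // /G.
      move: A1; rewrite ler_norml => /andP[_]; lra.
    have := normr_ge0 (cabs (f (w + h)) - cabs (f w)).
    have := normr_ge0 (cabs (f (w + h)) + cabs (f w)).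
    have := cabs_ge0 (f (w + h) - f w); nra.
  have A4 : d * `|cabs (w + h) ^+ 2 - cabs w ^+ 2| <= e' / 2.
    rewrite subr_sqr normrM.
    have S1 : `|cabs (w + h) + cabs w| <= 2 * H.
      rewrite ger0_norm ?addr_ge0 ?cabs_ge0 // /H.
      move: A2; rewrite ler_norml => /andP[_]; lra.
    have S2 : `|cabs (w + h) - cabs w| * `|cabs (w + h) + cabs w| <= cabs h * (2 * H).
      by apply: ler_pM.
    have S3 := ler_wpM2l (ltW d0) S2.
    by apply: (le_trans S3); nra.
  have -> : cabs (f (w + h)) ^+ 2 + d * cabs (w + h) ^+ 2 - (cabs (f w) ^+ 2 + d * cabs w ^+ 2)
    = (cabs (f (w + h)) ^+ 2 - cabs (f w) ^+ 2) + d * (cabs (w + h) ^+ 2 - cabs w ^+ 2).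
    by ring.
  by apply: (le_trans (ler_normD _ _)); rewrite normrM (gtr0_norm d0) (splitr e') lerD.
have uz : cabs (f z) ^+ 2 <= u zm.
  by apply: le_trans (Hm _ Kz); rewrite lerDl mulr_ge0 ?sqr_ge0 // ltW.
have [Zm|nZm] := pselect (Z zm).
  have h1 : cabs (f zm) ^+ 2 <= B ^+ 2 by rewrite ler_pXn2r ?nnegrE ?cabs_ge0 ?fZ.
  have h2 : d * cabs zm ^+ 2 <= d * M ^+ 2.
    by rewrite ler_pM2l // ler_pXn2r ?nnegrE ?cabs_ge0 ?bK.
  move: uz; rewrite /u; lra.
exfalso.
have [r r0 Hr] := KZ _ Kzm nZm.
have [b [c [L [s [L0 s0 Hs]]]]] := taylor2 (fa _ Kzm).
pose a := f zm.
(* Replacing [f] by its second-order expansion costs at most [Q t^3] in [|f|^2], which is less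
than the gain [d t^2] for small [t]. *)
pose Q := 2 * (cabs a + cabs b + cabs c) * L + 1.
have Q0 : 0 < Q.
  by rewrite ltr_wpDl // !mulr_ge0 // !addr_ge0 ?cabs_ge0.
pose t := Num.min (Num.min r s) (Num.min 1 (d / (2 * Q))).
have t0 : 0 < t by rewrite !lt_min r0 s0 ltr01 divr_gt0 // mulr_gt0.
have tr : t <= r by rewrite /t !ge_min lexx.
have ts : t <= s by rewrite /t !ge_min lexx orbT.
have t1 : t <= 1 by rewrite /t !ge_min lexx !orbT.
have td : t <= d / (2 * Q) by rewrite /t !ge_min lexx !orbT.
have key h : cabs h = t -> cabs (a + b * h + c * h ^+ 2) ^+ 2 + d * cabs (zm + h) ^+ 2 <=
    cabs a ^+ 2 + d * cabs zm ^+ 2 + Q * t ^+ 3.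
  move=> ht.
  have h1 : u (zm + h) <= u zm by apply: Hm; apply: Hr; rewrite ht.
  have h2 := Hs h; rewrite ht in h2; have {}h2 := h2 ts.
  set P := a + b * h + c * h ^+ 2 in h2 *.
  have P1 : cabs P <= cabs a + cabs b + cabs c.
    apply: (le_trans (cabsD _ _)); apply: lerD; last first.
      by rewrite cabsM cabsX ht ler_piMr ?cabs_ge0 // exprn_ile1 // ltW.
    apply: (le_trans (cabsD _ _)); apply: lerD => //.
    by rewrite cabsM ht ler_piMr ?cabs_ge0.
  have P2 : cabs P - L * t ^+ 3 <= cabs (f (zm + h)).
    have := cabs_tri P (f (zm + h)); rewrite cabsC; lra.
  have P3 : cabs P ^+ 2 - 2 * cabs P * (L * t ^+ 3) <= cabs (f (zm + h)) ^+ 2.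
    have := cabs_ge0 (f (zm + h)); have := cabs_ge0 P; have : 0 <= L * t ^+ 3.
      by rewrite mulr_ge0 // exprn_ge0 // ltW.
    case: (lerP (cabs P) (L * t ^+ 3)); nra.
  have P4 : 2 * cabs P * (L * t ^+ 3) <= Q * t ^+ 3.
    rewrite mulrA; apply: ler_wpM2r; first by rewrite exprn_ge0 // ltW.
    rewrite /Q; have := cabs_ge0 P; nra.
  move: h1; rewrite /u -/a; lra.
have ci : cabs ('i%C : C) = 1 by rewrite /cabs /= expr0n add0r expr1n sqrtr1.
have ct : cabs t%:C = t by rewrite cabs_real gtr0_norm.
have sqi : ('i%C : C) ^+ 2 = -1 by exact: sqr_i.
have k1 := key t%:C ct.
have k2 := key (- t%:C); rewrite cabsN in k2; have {}k2 := k2 ct.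
have k3 := key ('i%C * t%:C); rewrite cabsM ci mul1r in k3; have {}k3 := k3 ct.
have k4 := key (- ('i%C * t%:C)); rewrite cabsN cabsM ci mul1r in k4; have {}k4 := k4 ct.
have m1 := four_roots_mean a (b * t%:C) (c * t%:C ^+ 2).
have m2 := four_roots_mean zm t%:C 0.
move: k1 k2 k3 k4.
have -> : a + b * - t%:C + c * (- t%:C) ^+ 2 = a - b * t%:C + c * t%:C ^+ 2 by ring.
have -> : a + b * ('i%C * t%:C) + c * ('i%C * t%:C) ^+ 2 =
  a + 'i%C * (b * t%:C) - c * t%:C ^+ 2 by rewrite exprMn sqi; ring.
have -> : a + b * - ('i%C * t%:C) + c * (- ('i%C * t%:C)) ^+ 2 =
  a - 'i%C * (b * t%:C) - c * t%:C ^+ 2 by rewrite sqrrN exprMn sqi; ring.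
rewrite subr0 !addr0 in m2.
rewrite ct cabs0 expr0n addr0 in m2.
rewrite !subr0 in m2.
have := sqr_ge0 (cabs (b * t%:C)); have := sqr_ge0 (cabs (c * t%:C ^+ 2)).
have tQ : Q * t ^+ 3 <= d / 2 * t ^+ 2.
  rewrite exprS mulrA ler_wpM2r ?sqr_ge0 //.
  by rewrite ler_pdivlMr ?mulr_gt0 // in td; lra.
have : 0 < d * t ^+ 2 by rewrite mulr_gt0 // exprn_gt0.
nra.
Qed.

Lemma closedC_disk z0 (r : R) : closedC (fun z => cabs (z - z0) <= r).
Proof.
apply: closedCP => z /negP; rewrite -ltNge => h.
exists ((cabs (z - z0) - r) / 2); first by rewrite divr_gt0 // subr_gt0.
move=> w hw; apply/negP; rewrite -ltNge.
have := cabs_tri (z - z0) (- w).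
have -> : z - z0 - - w = z + w - z0 by ring.
rewrite cabsN; lra.
Qed.

Lemma max_disk f z0 (r B : R) : 0 < r -> (forall z, ana f z) ->
  (forall z, cabs (z - z0) = r -> cabs (f z) <= B) ->
  forall z, cabs (z - z0) <= r -> cabs (f z) <= B.
Proof.
move=> r0 fa fB.
have B0 : 0 <= B.
  apply: le_trans (fB (z0 + r%:C) _); first exact: cabs_ge0.
  by rewrite addrAC subrr add0r cabs_real gtr0_norm.
apply: (@max_principle _ (fun z => cabs (z - z0) = r) f (r + cabs z0)) => //.
- exact: closedC_disk.
- move=> z h; rewrite -[z](subrK z0); apply: (le_trans (cabsD _ _)).
  by rewrite lerD2r.
- by move=> z _; exact: fB.
move=> z zr zn; exists (r - cabs (z - z0)).
  by rewrite subr_gt0 lt_neqAle zr andbT; apply/eqP.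
move=> h hh; rewrite addrAC; apply: (le_trans (cabsD _ _)); lra.
Qed.

End MaximumPrinciple.

(** * Division by powers, derivatives and zeros *)

Section Division.
Variable R : realType.
Local Notation C := (R[i]).
Implicit Types (f g : C -> C) (z h : C) (p : {poly C}).

Lemma anaX f z n : ana f z -> ana (fun w => f w ^+ n) z.
Proof.
move=> fa; elim: n => [|n IH].
  by apply: (@ana_ext _ (fun=> 1)); [move=> w; rewrite expr0|exact: ana_cst].
by apply: (@ana_ext _ (fun w => f w * f w ^+ n)); [move=> w; rewrite exprS|exact: anaM].
Qed.

Lemma ana_poly p z : ana (fun w => p.[w]) z.
Proof.
elim/poly_ind: p => [|p c IH].
  by apply: (@ana_ext _ (fun=> 0)); [move=> w; rewrite horner0|exact: ana_cst].
apply: (@ana_ext _ (fun w => p.[w] * w + c)).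
  by move=> w; rewrite hornerMXaddC.
by apply: anaD; [apply: anaM => //; exact: ana_id|exact: ana_cst].
Qed.

Lemma ana_comp f (w0 z : C) : ana f (z - w0) -> ana (fun w => f (w - w0)) z.
Proof.
move=> fa n; have [p [K [r [K0 r0 r1 H]]]] := fa n.
exists p, K, r; split => // h hr; apply: le_trans (H h hr).
by rewrite (_ : z + h - w0 = z - w0 + h) //; ring.
Qed.

Lemma low_coefs p m : (forall k, (k < m)%N -> p`_k = 0) ->
  p = drop_poly m p * 'X^m.
Proof.
move=> H; rewrite -[LHS](poly_take_drop m p) (_ : take_poly m p = 0) ?add0r //.
by apply/polyP => i; rewrite coef_take_poly coef0; case: ifP => // h; exact: H.
Qed.

(** [f / (z - z0)^m], with the value at [z0] filled in. *)
Definition divat f (z0 c : C) m (z : C) : C :=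
  if z == z0 then c else f z / (z - z0) ^+ m.

Lemma divatE f z0 c m p : taylor f z0 m.+1 p -> (forall k, (k < m)%N -> p`_k = 0) ->
  p`_m = c -> forall z, f z = (z - z0) ^+ m * divat f z0 c m z.
Proof.
move=> hp p0 pm z; rewrite /divat; case: eqVneq => [->|zn]; last first.
  by rewrite mulrC divfK // expf_neq0 // subr_eq0.
rewrite subrr expr0n; have := taylor0 hp; rewrite horner_coef0.
by case: m hp p0 pm => [|m] hp p0 pm <-; rewrite ?mul1r ?mul0r // p0.
Qed.

Lemma taylor_divat f z0 c m n p q : taylor f z0 m.+1 p ->
  (forall k, (k < m)%N -> p`_k = 0) -> p`_m = c ->
  taylor f z0 (n + m).+1 q -> taylor (divat f z0 c m) z0 n (drop_poly m q).
Proof.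
move=> hp p0 pm hq.
have pq k : (k < m.+1)%N -> p`_k = q`_k.
  by apply: (@taylor_uniq _ f z0 m.+1) => //; apply: taylor_le hq; rewrite ltnS leq_addl.
have qE : q = drop_poly m q * 'X^m.
  by apply: low_coefs => k km; rewrite -pq ?p0 // ltnW.
move: hq => [K [r [K0 r0 r1 H]]].
exists K, r; split => // h hr.
rewrite /divat; case: eqVneq => [E|hn].
  have h0 : h = 0 by apply: (addrI z0); rewrite E addr0.
  rewrite h0 horner_coef0 coef_drop_poly add0n -pq // pm subrr cabs0.
  by rewrite mulr_ge0 // exprn_ge0.
have {hn}hn : h != 0 by apply: contraNneq hn => ->; rewrite addr0.
have E : z0 + h - z0 = h by ring.
have hX : h ^+ m != 0 by rewrite expf_neq0.
have -> : f (z0 + h) / (z0 + h - z0) ^+ m - (drop_poly m q).[h] =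
    (f (z0 + h) - q.[h]) / h ^+ m.
  by rewrite E mulrBl; congr (_ - _); rewrite [in RHS]qE hornerM hornerXn mulfK.
rewrite cabsM cabsV cabsX ler_pdivrMr ?exprn_gt0 ?cabs_gt0 //.
apply: (le_trans (H _ hr)); rewrite -mulrA -exprD; apply: ler_wpM2l => //.
by apply: ler_wiXn2l; rewrite ?cabs_ge0 ?(le_trans hr) // leqnSn.
Qed.

Lemma ana_divat f z0 c m p : (forall z, ana f z) -> taylor f z0 m.+1 p ->
  (forall k, (k < m)%N -> p`_k = 0) -> p`_m = c ->
  forall z, ana (divat f z0 c m) z.
Proof.
move=> fa hp p0 pm z; have [->|zn] := eqVneq z z0.
  move=> n; have [q hq] := fa z0 (n + m).+1.
  by exists (drop_poly m q); exact: (taylor_divat hp p0 pm hq).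
have zc : 0 < cabs (z - z0) by rewrite cabs_gt0 subr_eq0.
apply: (@ana_near _ (fun w => f w * ((w - z0) ^+ m)^-1) _ _ (cabs (z - z0) / 2)).
- by rewrite divr_gt0.
- move=> h hh; rewrite /divat; case: eqVneq => // E; exfalso.
  have : h = - (z - z0) by rewrite -E; ring.
  by move=> hE; move: hh; rewrite hE cabsN; lra.
apply: anaM => //; apply: anaV; last by rewrite expf_neq0 // subr_eq0.
by apply: anaX; apply: anaB; [exact: ana_id|exact: ana_cst].
Qed.

(** Dividing by [z - z0] and applying the maximum principle to the quotient takes over the part of
Cauchy's integral formula: it yields Cauchy's estimates, Liouville's theorem and the bound for
Taylor remainders. *)
Lemma ana_slope f z0 : (forall z, ana f z) ->
  exists g, (forall z, ana g z) /\ (forall z, f z = f z0 + (z - z0) * g z).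
Proof.
move=> fa; pose F z := f z - f z0.
have Fa z : ana F z by apply: anaB => //; exact: ana_cst.
have [p hp] := Fa z0 2%N.
have p0 : forall k, (k < 1)%N -> p`_k = 0.
  case=> // _; rewrite -horner_coef0.
  by rewrite (taylor0 hp) /F subrr.
exists (divat F z0 p`_1 1); split; first exact: (ana_divat Fa hp p0 erefl).
move=> z; have := divatE hp p0 erefl z; rewrite expr1 /F => <-; ring.
Qed.

(** On the circle of radius [r] the quotient is at most [2 M / r]; the maximum principle carries
this bound inside. *)
Lemma slope_bound f g z0 (r M : R) : 0 < r ->
  (forall z, ana g z) -> (forall z, f z = f z0 + (z - z0) * g z) ->
  (forall z, cabs (z - z0) <= r -> cabs (f z) <= M) ->
  forall z, cabs (z - z0) <= r -> cabs (g z) <= 2 * M / r.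
Proof.
move=> r0 ga fg fM.
apply: max_disk => // z zr; rewrite ler_pdivlMr // mulrC -{1}zr -cabsM.
have -> : (z - z0) * g z = f z - f z0 by rewrite fg; ring.
apply: (le_trans (cabsB _ _)).
have h1 := fM z ltac:(by rewrite zr).
have h2 : cabs (f z0) <= M by apply: fM; rewrite subrr cabs0 ltW.
lra.
Qed.

(** Cauchy's estimate: the coefficient is the value at [z0] of the difference quotient. *)
Lemma taylor_coef1_bound f z0 p (r M : R) : 0 < r -> (forall z, ana f z) ->
  taylor f z0 2 p -> (forall z, cabs (z - z0) <= r -> cabs (f z) <= M) ->
  cabs p`_1 <= 2 * M / r.
Proof.
move=> r0 fa hp fM.
have [g [ga fg]] := ana_slope z0 fa.
have -> : p`_1 = g z0.
  have [q hq] := ga z0 2%N.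
  have h1 : taylor f z0 2 ((f z0)%:P + 'X * q).
    apply: (@taylor_near _ (fun z => f z0 + (z - z0) * g z) _ _ _ _ 1) => //.
    apply: taylorD; first exact: taylor_cst.
    apply: taylorM => //.
    have -> : 'X = (z0%:P + 'X) + (- z0)%:P :> {poly C} by rewrite polyCN; ring.
    by apply: taylorD; [exact: taylor_id|exact: taylor_cst].
  rewrite (taylor_uniq hp h1) // coefD coefC add0r coefXM /= -horner_coef0.
  exact: taylor0 hq.
by apply: slope_bound fg fM _ _; rewrite ?subrr ?cabs0 ?ltW.
Qed.

Lemma derive1_taylor (f : C -> C) z p : taylor f z 2 p ->
  @derive1 (R[i]) (Cx R) f z = p`_1.
Proof.
move=> hp; have p0 := taylor0 hp; move: hp => [K [r [K0 r0 r1 H]]].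
have [M M0 HM] := poly_bounded (drop_poly 2 p).
have pE h : p.[h] = f z + p`_1 * h + (drop_poly 2 p).[h] * h ^+ 2.
  rewrite -[in LHS](poly_take_drop 2 p) hornerD hornerM hornerXn; congr (_ + _).
  rewrite (@horner_coef_wide _ 2) ?size_take_poly // !big_ord_recl big_ord0 /=.
  by rewrite !coef_take_poly /= /bump /= addr0 expr0 mulr1 expr1 -p0 horner_coef0.
apply: cvg_lim; first exact: (@norm_hausdorff (R[i]) (Cx R)).
apply/cvgrPdist_le => /= e e0.
have eE : e = (complex.Re e)%:C by case: e e0 => a b; rewrite ltcE /= => /andP[/eqP -> _].
have {}e0 : 0 < complex.Re e by move: e0; rewrite eE ltcR.
set e' := complex.Re e in eE e0.
pose d := Num.min r (e' / (K + M + 1)).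
have D0 : 0 < K + M + 1 by lra.
have d0 : 0 < d by rewrite lt_min r0 divr_gt0.
apply/nbhs_ballP; exists d%:C; first by rewrite /= ltcR.
move=> h; rewrite /ball /= sub0r normrN cabsE ltcR => hd hn.
rewrite eE cabsE lecR.
have hr : cabs h <= r by apply: le_trans (ltW hd) _; rewrite /d ge_min lexx.
have he : cabs h * (K + M + 1) <= e'.
  by rewrite -ler_pdivlMr // (le_trans (ltW hd)) // /d ge_min lexx orbT.
have h0 : 0 < cabs h by rewrite cabs_gt0.
rewrite -(ler_pM2r h0) -cabsM.
have -> : (p`_1 - h^-1 *: (f (h + z) - f z)) * h =
   - ((f (z + h) - p.[h]) + (drop_poly 2 p).[h] * h ^+ 2).
  rewrite [h + z]addrC pE mulrBl.
  have -> : h^-1 *: (f (z + h) - f z) * h = f (z + h) - f z.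
    by rewrite /GRing.scale /= mulrAC mulVf // mul1r.
  by ring.
rewrite cabsN; apply: (le_trans (cabsD _ _)); rewrite cabsM cabsX.
have h1 := H h hr.
have h2 : cabs (drop_poly 2 p).[h] * cabs h ^+ 2 <= M * cabs h ^+ 2.
  by rewrite ler_wpM2r ?sqr_ge0 // HM // (le_trans hr).
nra.
Qed.

(** The remainder of the expansion is [(z - z0)^(n+1) G] with [G] analytic. Both [G] and its
derivative are bounded near [z0], the latter by Cauchy's estimate, so by the product rule the
derivative of the remainder is of order [n]. *)
Lemma taylor_deriv f z0 n p : (forall z, ana f z) -> taylor f z0 n.+2 p ->
  taylor (fun z => @derive1 (R[i]) (Cx R) f z) z0 n p^`().
Proof.
move=> fa hp.
pose F z := f z - p.[z - z0].
have Fa z : ana F z.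
  by apply: anaB => //; apply: (@ana_comp (fun w => p.[w])); exact: ana_poly.
have F0 : taylor F z0 n.+2 0.
  have [K [r [K0 r0 r1 H]]] := hp.
  exists K, r; split => // h hr; rewrite horner0 subr0 /F.
  by rewrite (_ : z0 + h - z0 = h) ?H //; ring.
have c0 k : (k < n.+1)%N -> (0 : {poly C})`_k = 0 by rewrite coef0.
have c1 : (0 : {poly C})`_n.+1 = 0 by rewrite coef0.
pose G := divat F z0 0 n.+1.
have Ga z : ana G z by exact: (ana_divat Fa F0 c0 c1).
have FG z : F z = (z - z0) ^+ n.+1 * G z by exact: (divatE F0 c0 c1).
have [B HB] : exists B : R, forall z, cabs (z - z0) <= 2 -> cabs (G z) <= B.
  apply: (@ana_bounded _ (fun z => cabs (z - z0) <= 2) G (2 + cabs z0)) => //.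
    exact: closedC_disk.
  by move=> z h; rewrite -[z](subrK z0); apply: (le_trans (cabsD _ _)); rewrite lerD2r.
have B0 : 0 <= B by apply: le_trans (HB z0 _); rewrite ?cabs_ge0 // subrr cabs0.
apply: (@taylorI _ _ _ _ _ (n.+1%:R * B + 2 * B) 1) => // h h1.
set z := z0 + h.
have [q hq] := Ga z 2%N.
have hh : z - z0 = h by rewrite /z; ring.
have q1 : cabs q`_1 <= 2 * B.
  rewrite -[2 * B]divr1; apply: (@taylor_coef1_bound G z q 1 B) => // w hw.
  apply: HB; have -> : w - z0 = (w - z) + h by rewrite /z; ring.
  by apply: (le_trans (cabsD _ _)); lra.
have q0 : cabs q`_0 <= B.
  by rewrite -horner_coef0 (taylor0 hq) HB // hh; lra.
have hs : taylor f z 2 ((p \Po (h%:P + 'X)) + (h%:P + 'X) ^+ n.+1 * q).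
  have hX : taylor (fun w => w - z0) z 2 (h%:P + 'X).
    exists 0, 1; split => // k _.
    by rewrite hornerD hornerC hornerX (_ : _ - _ = 0) ?cabs0 ?mul0r // /z; ring.
  apply: (@taylor_near _ (fun w => p.[w - z0] + (w - z0) ^+ n.+1 * G w) _ _ _ _ 1) => //.
    by move=> k _; rewrite -FG /F; ring.
  apply: taylorD.
    exists 0, 1; split => // k _.
    rewrite horner_comp hornerD hornerC hornerX (_ : z + k - z0 = h + k); last by rewrite /z; ring.
    by rewrite subrr cabs0 mul0r.
  apply: taylorM => //.
  elim: n.+1 => [|m IH].
    apply: (@taylor_near _ (fun=> 1) _ _ _ _ 1) => //.
    by have := taylor_cst (1 : C) z 2; rewrite polyC1 expr0.
  apply: (@taylor_near _ (fun w => (w - z0) * (w - z0) ^+ m) _ _ _ _ 1) => //.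
    by move=> k _; rewrite exprS.
  by rewrite exprS; exact: taylorM.
have cP (r : {poly C}) : r`_1 = r^`().[0].
  by rewrite horner_coef0 coef_deriv mulr1n.
have -> : @derive1 (R[i]) (Cx R) f z =
   p^`().[h] + h ^+ n.+1 * q`_1 + h ^+ n *+ n.+1 * q`_0.
  rewrite (derive1_taylor hs) cP derivD deriv_comp derivM deriv_exp !derivD !derivC !derivX add0r mulr1 mul1r /=.
  rewrite !(hornerE, horner_comp, hornerMn, horner_exp) /= ?addr0.
  rewrite -!horner_coef0 -cP; ring.
have -> : p^`().[h] + h ^+ n.+1 * q`_1 + h ^+ n *+ n.+1 * q`_0 - p^`().[h] =
   h ^+ n.+1 * q`_1 + h ^+ n *+ n.+1 * q`_0 by ring.
apply: (le_trans (cabsD _ _)); rewrite addrC mulrDl; apply: lerD.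
  rewrite -mulr_natl !cabsM cabsX mulrAC.
  have -> : cabs (n.+1%:R : C) = n.+1%:R.
    have -> : (n.+1%:R : C) = (n.+1%:R : R)%:C by rewrite rmorph_nat.
    by rewrite cabs_real ger0_norm.
  by apply: ler_wpM2r; [rewrite exprn_ge0 ?cabs_ge0|apply: ler_wpM2l].
rewrite cabsM cabsX mulrC; apply: ler_pM; rewrite ?exprn_ge0 ?cabs_ge0 //.
by apply: ler_wiXn2l; rewrite ?cabs_ge0.
Qed.

Lemma ana_derive1 f : (forall z, ana f z) -> forall z, ana (@derive1 (R[i]) (Cx R) f) z.
Proof. by move=> fa z n; have [p hp] := fa z n.+2; exists p^`(); exact: taylor_deriv. Qed.

Lemma ana_derive1n f : (forall z, ana f z) ->
  forall k z, ana (@derive1n (R[i]) (Cx R) k f) z.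
Proof. by move=> fa; elim=> [//|k IH]; exact: ana_derive1. Qed.

(** Each use of [taylor_deriv] costs two orders, hence [k.*2]. *)
Lemma derive1n_taylor f z k p : (forall z, ana f z) -> taylor f z (k.*2).+1 p ->
  @derive1n (R[i]) (Cx R) k f z = p`_k *+ k`!.
Proof.
move=> fa hp.
have H j : (j <= k)%N -> taylor (@derive1n (R[i]) (Cx R) j f) z ((k - j).*2).+1 p^`(j).
  elim: j => [|j IH] jk; first by rewrite subn0 derivn0.
  rewrite derivnS; apply: taylor_deriv; first exact: ana_derive1n.
  by apply: taylor_le (IH (ltnW jk)); rewrite -!addnn; lia.
have := H k (leqnn k); rewrite subnn => /taylor0 <-.
by rewrite horner_coef0 coef_derivn addn0 ffactnn.
Qed.

(** Iterated derivatives are Taylor coefficients up to factorials, so a zero of order [m] kills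
the first [m] coefficients and nothing more. *)
Lemma zero_order_factor f z0 m : (forall z, ana f z) -> zero_order f z0 m ->
  exists g, [/\ forall z, ana g z, g z0 != 0 & forall z, f z = (z - z0) ^+ m * g z].
Proof.
move=> fa [z1 z2].
have [p hp] := fa z0 (m.*2).+1.
have kf k : (k <= m)%N -> @derive1n (R[i]) (Cx R) k f z0 = p`_k *+ k`!.
  move=> km; apply: derive1n_taylor => //; apply: taylor_le hp.
  by rewrite ltnS leq_double.
have nz k : (p`_k *+ k`! == 0) = (p`_k == 0).
  by rewrite mulrn_eq0 eqn0Ngt fact_gt0.
have p0 k : (k < m)%N -> p`_k = 0.
  by move=> km; apply/eqP; rewrite -nz -kf ?(ltnW km) // z1.
have hp' : taylor f z0 m.+1 p by apply: taylor_le hp; rewrite ltnS -addnn leq_addl.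
exists (divat f z0 p`_m m); split; first exact: (ana_divat fa hp' p0 erefl).
  by rewrite /divat eqxx -nz -kf //; apply/eqP.
exact: (divatE hp' p0 erefl).
Qed.

(** Near each point both functions are the same power of [z - z0] times an analytic function
without zero there, so the quotient extends analytically; away from the zeros it is a quotient,
and the two descriptions agree. *)
Lemma ana_quotient f g (ord : C -> nat) : (forall z, ana f z) -> (forall z, ana g z) ->
  (forall z, zero_order f z (ord z)) -> (forall z, zero_order g z (ord z)) ->
  exists k, (forall z, ana k z) /\ (forall z, f z = k z * g z).
Proof.
move=> fa ga fo go.
have V z0 := cid (zero_order_factor fa (fo z0)).
have W z0 := cid (zero_order_factor ga (go z0)).
exists (fun z => if g z == 0 then sval (V z) z / sval (W z) z else f z / g z).
split=> [z0|z]; last first.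
  case: eqVneq => [gz|gz]; last by rewrite divfK.
  have [_ _ /(_ z) fE] := svalP (V z); have [_ w0 /(_ z) gE] := svalP (W z).
  move: fE gE; rewrite gz subrr => -> /esym/eqP.
  by rewrite mulf_eq0 (negPf w0) orbF => /eqP ->; rewrite mul0r mulr0.
have [va v0 vE] := svalP (V z0); have [wa w0 wE] := svalP (W z0).
pose v := sval (V z0); pose w := sval (W z0).
rewrite -/v in va v0 vE; rewrite -/w in wa w0 wE.
have [d d0 Hd] := ana_neq0 (wa z0) w0.
apply: (@ana_near _ (fun z => v z * (w z)^-1) _ _ d) => //; last first.
  by apply: anaM => //; exact: anaV.
move=> h /Hd hh.
have wn : w (z0 + h) != 0 by rewrite -cabs_gt0; apply: lt_le_trans hh; rewrite divr_gt0 // cabs_gt0.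
case: eqVneq => [gz|gz]; last first.
  move: gz; rewrite vE wE mulf_eq0 negb_or => /andP[a0 _].
  by rewrite invfM mulrACA mulfV // mul1r.
have h0 : h = 0.
  move: gz; rewrite wE => /eqP; rewrite mulf_eq0 (negPf wn) orbF expf_eq0.
  by move=> /andP[_ /eqP <-]; ring.
by rewrite h0 addr0.
Qed.

End Division.

(** * Differentiation on an interval *)

Section RealCalculus.
Variable R : realType.
Local Notation C := (R[i]).
Implicit Types (f g : R -> C) (Q : R -> R) (x t T a b : R).

(** Cousin's lemma in the form of an induction over intervals: the supremum of the points that can
be reached from [a] is reached, and is [b]. It replaces partitions and compactness in all
arguments about one real variable below. *)
Lemma cousin a b (L : R -> R -> Prop) : a <= b ->
  (forall u v w, a <= u -> u <= v -> v <= w -> w <= b -> L u v -> L v w -> L u w) ->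
  (forall x, a <= x -> x <= b -> exists2 d : R, 0 < d & forall u v, a <= u -> u <= x ->
     x <= v -> v <= b -> x - u <= d -> v - x <= d -> L u v) -> L a b.
Proof.
move=> ab tr loc.
pose E := [set c | [/\ a <= c, c <= b & L a c]].
have Ea : E a.
  split => //; have [d d0 H] := loc a (lexx _) ab.
  by apply: H; rewrite ?lexx // subrr ltW.
have hE : has_sup E by split; [exists a|exists b => c []].
have [hE1 hE2] := hE.
pose s := sup E.
have as_ : a <= s by exact: (ub_le_sup hE2 Ea).
have sb : s <= b by apply: ge_sup; [exists a|move=> c []].
have [d d0 H] := loc s as_ sb.
have [c Ec cs] := sup_adherent d0 hE.
have {}cs : s - d < c by [].
have cs' : c <= s by exact: (ub_le_sup hE2 Ec).
have [ac cb Lac] := Ec.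
pose v := Num.min b (s + d).
have vb : v <= b by rewrite /v ge_min lexx.
have vsd : v <= s + d by rewrite /v ge_min lexx orbT.
have sv : s <= v by rewrite le_min sb lerDl ltW.
have Lcv : L c v by apply: H => //; lra.
have Lav : L a v by apply: tr Lac Lcv => //; lra.
have vs : v <= s by apply: (ub_le_sup hE2); split => //; lra.
have [bsd|bsd] := lerP b (s + d); last first.
  by move: vs; rewrite /v min_r ?(ltW bsd) //; lra.
by move: Lav; rewrite /v min_l.
Qed.

(** Derivative relative to [0, T], hence one-sided at the end points. *)
Definition isd T f x (l : C) := forall e : R, 0 < e -> exists2 d : R, 0 < d &
  forall t, 0 <= t -> t <= T -> `|t - x| <= d ->
    cabs (f t - f x - (t - x)%:C * l) <= e * `|t - x|.

Definition contI T f := forall x, 0 <= x -> x <= T -> forall e : R, 0 < e ->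
  exists2 d : R, 0 < d & forall t, 0 <= t -> t <= T -> `|t - x| <= d ->
    cabs (f t - f x) <= e.

Lemma isd_locLip T f x l : isd T f x l -> exists2 d : R, 0 < d &
  forall t, 0 <= t -> t <= T -> `|t - x| <= d -> cabs (f t - f x) <= (cabs l + 1) * `|t - x|.
Proof.
move=> H; have [d d0 Hd] := H 1 ltr01; exists d => // t t0 tT td.
have -> : f t - f x = (f t - f x - (t - x)%:C * l) + (t - x)%:C * l by ring.
apply: (le_trans (cabsD _ _)); rewrite cabsM cabs_real.
have := Hd t t0 tT td; lra.
Qed.

Lemma isd_cont T f (l : R -> C) : (forall x, 0 <= x -> x <= T -> isd T f x (l x)) ->
  contI T f.
Proof.
move=> H x x0 xT e e0; have [d d0 Hd] := isd_locLip (H x x0 xT).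
have D0 : 0 < cabs (l x) + 1 by have := cabs_ge0 (l x); lra.
exists (Num.min d (e / (cabs (l x) + 1))); first by rewrite lt_min d0 divr_gt0.
move=> t t0 tT; rewrite le_min => /andP[td]; rewrite ler_pdivlMr // mulrC.
by apply: le_trans; exact: Hd.
Qed.

Lemma isd_cst T (c : C) x : isd T (fun=> c) x 0.
Proof.
move=> e e0; exists 1 => // t _ _ _; rewrite subrr mulr0 subr0 cabs0.
by rewrite mulr_ge0 // ltW.
Qed.

Lemma isd_id T x : isd T (fun t => t%:C) x 1.
Proof.
move=> e e0; exists 1 => // t _ _ _; rewrite mulr1 -rmorphB subrr cabs0.
by rewrite mulr_ge0 // ltW.
Qed.

Lemma isdD T f g x l m : isd T f x l -> isd T g x m -> isd T (fun t => f t + g t) x (l + m).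
Proof.
move=> H H' e e0.
have e20 : 0 < e / 2 by rewrite divr_gt0.
have [d d0 Hd] := H _ e20; have [d' d'0 Hd'] := H' _ e20.
exists (Num.min d d'); first by rewrite lt_min d0.
move=> t t0 tT; rewrite le_min => /andP[td td'].
have -> : f t + g t - (f x + g x) - (t - x)%:C * (l + m) =
  (f t - f x - (t - x)%:C * l) + (g t - g x - (t - x)%:C * m) by ring.
apply: (le_trans (cabsD _ _)).
have := Hd t t0 tT td; have := Hd' t t0 tT td'; lra.
Qed.

Lemma isdM T f g x l m : isd T f x l -> isd T g x m ->
  isd T (fun t => f t * g t) x (l * g x + f x * m).
Proof.
move=> H H' e e0.
have [d1 d10 Hd1] := isd_locLip H.
have [d2 d20 Hd2] := isd_locLip H'.
pose A := cabs l + 1; pose B := cabs m + 1; pose G := cabs (g x) + 1; pose F := cabs (f x) + 1.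
have A0 : 0 < A by rewrite /A; have := cabs_ge0 l; lra.
have B0 : 0 < B by rewrite /B; have := cabs_ge0 m; lra.
have G0 : 0 < G by rewrite /G; have := cabs_ge0 (g x); lra.
have F0 : 0 < F by rewrite /F; have := cabs_ge0 (f x); lra.
have e1 : 0 < e / (3 * G) by rewrite divr_gt0 // mulr_gt0.
have e2 : 0 < e / (3 * F) by rewrite divr_gt0 // mulr_gt0.
have AB0 : 0 < 3 * (A * B) by rewrite !mulr_gt0.
have [d3 d30 Hd3] := H _ e1; have [d4 d40 Hd4] := H' _ e2.
exists (Num.min (Num.min d1 d2) (Num.min (Num.min d3 d4) (e / (3 * (A * B))))).
  by rewrite !lt_min d10 d20 d30 d40 divr_gt0.
move=> t t0 tT; rewrite !le_min => /andP[/andP[td1 td2] /andP[/andP[td3 td4] td5]].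
rewrite ler_pdivlMr // in td5.
have -> : f t * g t - f x * g x - (t - x)%:C * (l * g x + f x * m) =
  (f t - f x - (t - x)%:C * l) * g x + f x * (g t - g x - (t - x)%:C * m) +
  (f t - f x) * (g t - g x) by ring.
have h1 := Hd1 t t0 tT td1; have h2 := Hd2 t t0 tT td2.
have h3 := Hd3 t t0 tT td3; have h4 := Hd4 t t0 tT td4.
have E1 : cabs ((f t - f x - (t - x)%:C * l) * g x) <= e / 3 * `|t - x|.
  rewrite cabsM; apply: (@le_trans _ _ (e / (3 * G) * `|t - x| * G)).
    by apply: ler_pM; rewrite ?cabs_ge0 // /G lerDl.
  by rewrite le_eqVlt; apply/orP; left; apply/eqP; field; rewrite gt_eqF.
have E2 : cabs (f x * (g t - g x - (t - x)%:C * m)) <= e / 3 * `|t - x|.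
  rewrite cabsM; apply: (@le_trans _ _ (F * (e / (3 * F) * `|t - x|))).
    by apply: ler_pM; rewrite ?cabs_ge0 // /F lerDl.
  by rewrite le_eqVlt; apply/orP; left; apply/eqP; field; rewrite gt_eqF.
have E3 : cabs ((f t - f x) * (g t - g x)) <= e / 3 * `|t - x|.
  rewrite cabsM; apply: (@le_trans _ _ ((A * `|t - x|) * (B * `|t - x|))).
    by apply: ler_pM; rewrite ?cabs_ge0.
  have -> : A * `|t - x| * (B * `|t - x|) = (`|t - x| * (A * B)) * `|t - x| by ring.
  by rewrite ler_wpM2r // ler_pdivlMr //; lra.
apply: (le_trans (cabsD _ _)); have := cabsD ((f t - f x - (t - x)%:C * l) * g x)
  (f x * (g t - g x - (t - x)%:C * m)); lra.
Qed.

Lemma isdZ T (c : C) f x l : isd T f x l -> isd T (fun t => c * f t) x (c * l).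
Proof.
move=> H; have := isdM (isd_cst T c x) H; by rewrite mul0r add0r.
Qed.

Lemma isdN T f x l : isd T f x l -> isd T (fun t => - f t) x (- l).
Proof.
move=> H; have := isdZ (-1) H; rewrite mulN1r => h e e0; have [d d0 Hd] := h e e0.
by exists d => // t t0 tT td; have := Hd t t0 tT td; rewrite !mulN1r.
Qed.

Lemma isdB T f g x l m : isd T f x l -> isd T g x m -> isd T (fun t => f t - g t) x (l - m).
Proof. by move=> H H'; apply: isdD => //; exact: isdN. Qed.

(** Bounds on small increments add up along a partition. The point [x] lies between [u] and [v],
so a bound is only asked on intervals around [x]. *)
Lemma mvt_bound a b f Q : a <= b ->
  (forall x, a <= x -> x <= b -> forall e : R, 0 < e -> exists2 d : R, 0 < d &
    forall u v, a <= u -> u <= x -> x <= v -> v <= b -> x - u <= d -> v - x <= d ->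
      cabs (f v - f u) <= Q v - Q u + e * (v - u)) ->
  cabs (f b - f a) <= Q b - Q a.
Proof.
move=> ab H; rewrite -subr_le0; apply: le0_small => e e0.
pose e' := e / (b - a + 1).
have D0 : 0 < b - a + 1 by lra.
have e'0 : 0 < e' by rewrite divr_gt0.
have he : e' * (b - a) <= e.
  by rewrite /e' mulrAC ler_pdivrMr //; nra.
have : cabs (f b - f a) <= Q b - Q a + e' * (b - a).
  apply: (@cousin a b (fun u v => cabs (f v - f u) <= Q v - Q u + e' * (v - u))) => //.
    move=> u v w _ _ _ _ h1 h2.
    have -> : f w - f u = (f v - f u) + (f w - f v) by ring.
    by apply: (le_trans (cabsD _ _)); lra.
  by move=> x ax xb; exact: H.
lra.
Qed.

Lemma mvt_isd T f (l : R -> C) (M a b : R) : 0 <= a -> a <= b -> b <= T ->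
  (forall x, a <= x -> x <= b -> isd T f x (l x)) ->
  (forall x, a <= x -> x <= b -> cabs (l x) <= M) -> cabs (f b - f a) <= M * (b - a).
Proof.
move=> a0 ab bT H HM; rewrite mulrBr.
apply: (@mvt_bound a b f (fun t => M * t)) => // x ax xb e e0.
have [d d0 Hd] := H x ax xb e e0; exists d => // u v au ux xv vb xu vx.
have h1 := Hd u; rewrite distrC ger0_norm ?subr_ge0 // in h1.
have h2 := Hd v; rewrite ger0_norm ?subr_ge0 // in h2.
have {}h1 := h1 ltac:(lra) ltac:(lra) xu.
have {}h2 := h2 ltac:(lra) ltac:(lra) vx.
have -> : f v - f u = (f v - f x - (v - x)%:C * l x) - (f u - f x - (u - x)%:C * l x)
   + (v - u)%:C * l x.
  by rewrite !rmorphB; ring.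
apply: (le_trans (cabsD _ _)); have := cabsB (f v - f x - (v - x)%:C * l x) (f u - f x - (u - x)%:C * l x).
rewrite cabsM cabs_real ger0_norm; last by lra.
have := HM x ax xb; have : 0 <= v - u by lra.
nra.
Qed.

Lemma isd0_cst T f a b : 0 <= a -> a <= b -> b <= T ->
  (forall x, a <= x -> x <= b -> isd T f x 0) -> f b = f a.
Proof.
move=> a0 ab bT H; apply/eqP; rewrite -subr_eq0 -cabs_eq0 eq_le cabs_ge0 andbT.
rewrite -(mul0r (b - a)); apply: (@mvt_isd T f (fun=> 0)) => // x _ _.
by rewrite cabs0.
Qed.

Lemma contI_bounded T f : 0 <= T -> contI T f ->
  exists2 M : R, 0 <= M & forall x, 0 <= x -> x <= T -> cabs (f x) <= M.
Proof.
move=> T0 fc.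
suff [M HM] : exists M : R, forall x, 0 <= x -> x <= T -> cabs (f x) <= M.
  by exists M => //; apply: le_trans (HM 0 _ _); rewrite ?cabs_ge0.
apply: (@cousin 0 T (fun u v => exists M : R, forall x, u <= x -> x <= v -> cabs (f x) <= M)) => //.
  move=> u v w _ _ _ _ [M HM] [N HN]; exists (Num.max M N) => x ux xw.
  rewrite le_max; have [xv|vx] := lerP x v; first by rewrite HM.
  by rewrite HN ?orbT // ltW.
move=> x x0 xT; have [d d0 Hd] := fc x x0 xT 1 ltr01.
exists d => // u v u0 ux xv vT xu vx; exists (cabs (f x) + 1) => t ut tv.
have -> : f t = f x + (f t - f x) by ring.
apply: (le_trans (cabsD _ _)); rewrite lerD2l; apply: Hd; try lra.
by rewrite ler_norml; apply/andP; split; lra.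
Qed.

Lemma contI_unif T f : 0 <= T -> contI T f -> forall e : R, 0 < e ->
  exists2 d : R, 0 < d & forall s t, 0 <= s -> s <= T -> 0 <= t -> t <= T ->
    `|s - t| <= d -> cabs (f s - f t) <= e.
Proof.
move=> T0 fc e e0.
apply: (@cousin 0 T (fun u v => exists2 d : R, 0 < d & forall s t, u <= s -> s <= v ->
  0 <= t -> t <= T -> `|s - t| <= d -> cabs (f s - f t) <= e)) => //.
  move=> u v w _ _ _ _ [d d0 Hd] [d' d'0 Hd']; exists (Num.min d d').
    by rewrite lt_min d0.
  move=> s t us sw t0 tT; rewrite le_min => /andP[h h'].
  by have [sv|vs] := lerP s v; [exact: Hd|apply: Hd' => //; exact: ltW].
move=> x x0 xT; have [d d0 Hd] := fc x x0 xT (e / 2) ltac:(by rewrite divr_gt0).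
exists (d / 2); first by rewrite divr_gt0.
move=> u v u0 ux xv vT xu vx; exists (d / 2); first by rewrite divr_gt0.
move=> s t us sv t0 tT; rewrite ler_norml => /andP[st1 st2].
have -> : f s - f t = (f s - f x) - (f t - f x) by ring.
apply: (le_trans (cabsB _ _)); rewrite (splitr e) lerD // Hd //; try lra;
  by rewrite ler_norml; apply/andP; split; lra.
Qed.

Lemma contI_cst T (c : C) : contI T (fun=> c).
Proof. by move=> x _ _ e e0; exists 1 => // t _ _ _; rewrite subrr cabs0 ltW. Qed.

Lemma contID T f g : contI T f -> contI T g -> contI T (fun t => f t + g t).
Proof.
move=> fc gc x x0 xT e e0.
have e20 : 0 < e / 2 by rewrite divr_gt0.
have [d d0 Hd] := fc x x0 xT _ e20; have [d' d'0 Hd'] := gc x x0 xT _ e20.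
exists (Num.min d d'); first by rewrite lt_min d0.
move=> t t0 tT; rewrite le_min => /andP[h h'].
have -> : f t + g t - (f x + g x) = (f t - f x) + (g t - g x) by ring.
by apply: (le_trans (cabsD _ _)); rewrite (splitr e) lerD ?Hd ?Hd'.
Qed.

Lemma contIM T f g : 0 <= T -> contI T f -> contI T g -> contI T (fun t => f t * g t).
Proof.
move=> T0 fc gc x x0 xT e e0.
have [M M0 HM] := contI_bounded T0 fc; have [N N0 HN] := contI_bounded T0 gc.
have D0 : 0 < M + N + 1 by lra.
have e20 : 0 < e / (M + N + 1) by rewrite divr_gt0.
have [d d0 Hd] := fc x x0 xT _ e20; have [d' d'0 Hd'] := gc x x0 xT _ e20.
exists (Num.min d d'); first by rewrite lt_min d0.
move=> t t0 tT; rewrite le_min => /andP[h h'].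
have -> : f t * g t - (f x * g x) = (f t - f x) * g t + f x * (g t - g x) by ring.
apply: (le_trans (cabsD _ _)); rewrite !cabsM.
have h1 := Hd t t0 tT h; have h2 := Hd' t t0 tT h'.
have E : e / (M + N + 1) * (M + N + 1) = e by rewrite divfK // gt_eqF.
have k1 : cabs (f t - f x) * cabs (g t) <= e / (M + N + 1) * N.
  by apply: ler_pM; rewrite ?cabs_ge0 ?HN.
have k2 : cabs (f x) * cabs (g t - g x) <= M * (e / (M + N + 1)).
  by apply: ler_pM; rewrite ?cabs_ge0 ?HM.
rewrite -E; lra.
Qed.

Lemma contIZ T (c : C) f : 0 <= T -> contI T f -> contI T (fun t => c * f t).
Proof. by move=> T0 fc; apply: contIM => //; exact: contI_cst. Qed.

Lemma contIN T f : 0 <= T -> contI T f -> contI T (fun t => - f t).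
Proof.
move=> T0 fc x x0 xT e e0; have [d d0 Hd] := fc x x0 xT e e0; exists d => // t t0 tT td.
by rewrite -opprD cabsN Hd.
Qed.

Lemma contI_ext T f g : (forall t, 0 <= t -> t <= T -> f t = g t) -> contI T f -> contI T g.
Proof.
move=> fg fc x x0 xT e e0; have [d d0 Hd] := fc x x0 xT e e0; exists d => // t t0 tT td.
by rewrite -!fg // Hd.
Qed.

End RealCalculus.

(** * Absolute continuity *)

Section AbsoluteContinuity.
Variable R : realType.
Local Notation C := (R[i]).
Local Notation mu := (@lebesgue_measure R).
Implicit Types (f g : R -> C) (Q : R -> R) (x t T a b : R) (s : seq (R * R)).

Definition family T s := all (fun I : R * R => [&& 0 <= I.1, I.1 <= I.2 & I.2 <= T]) s /\
  pairwise (fun I J : R * R => I.2 <= J.1) s.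

Definition ac T f := forall e : R, 0 < e -> exists2 d : R, 0 < d & forall s, family T s ->
  \sum_(I <- s) (I.2 - I.1) < d -> \sum_(I <- s) cabs (f I.2 - f I.1) <= e.

Lemma abs_continuousP T f : abs_continuous T (f : R -> Cx R) -> ac T f.
Proof.
move=> H e e0; have [d d0 Hd] := H e e0; exists d => // s [s1 s2] s3.
have := Hd s s1 s2 s3.
rewrite (eq_bigr (fun I : R * R => (cabs (f I.2 - f I.1))%:C)); last by move=> I _; rewrite -cabsE.
by rewrite -rmorph_sum ltcR => /ltW.
Qed.

Lemma ac_cont T f : ac T f -> contI T f.
Proof.
move=> H x x0 xT e e0; have [d d0 Hd] := H e e0.
exists (d / 2); first by rewrite divr_gt0.
move=> t t0 tT td.
have [tx|xt] := lerP t x.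
  have := Hd [:: (t, x)]; rewrite !big_seq1 /= cabsC; apply.
    by split => //=; rewrite t0 tx xT.
  move: td; rewrite distrC ger0_norm ?subr_ge0 //; lra.
have := Hd [:: (x, t)]; rewrite !big_seq1 /=; apply.
  by split => //=; rewrite x0 (ltW xt) tT.
by move: td; rewrite ger0_norm ?subr_ge0 ?(ltW xt) //; lra.
Qed.

Lemma family_bound T s (F G : R * R -> R) : family T s ->
  (forall I, 0 <= I.1 -> I.1 <= I.2 -> I.2 <= T -> F I <= G I) ->
  \sum_(I <- s) F I <= \sum_(I <- s) G I.
Proof.
move=> [/allP s1 _] H; rewrite big_seq [leRHS]big_seq; apply: ler_sum => I /s1 /and3P[].
exact: H.
Qed.

Lemma acD T f g : ac T f -> ac T g -> ac T (fun t => f t + g t).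
Proof.
move=> H H' e e0.
have e20 : 0 < e / 2 by rewrite divr_gt0.
have [d d0 Hd] := H _ e20; have [d' d'0 Hd'] := H' _ e20.
exists (Num.min d d'); first by rewrite lt_min d0.
move=> s sf; rewrite lt_min => /andP[h h'].
apply: (@le_trans _ _ (\sum_(I <- s) (cabs (f I.2 - f I.1) + cabs (g I.2 - g I.1)))).
  apply: (family_bound sf) => I _ _ _.
  by apply: le_trans (cabsD _ _); rewrite opprD addrACA.
by rewrite big_split /= (splitr e) lerD ?Hd ?Hd'.
Qed.

Lemma acM T f g : 0 <= T -> ac T f -> ac T g -> ac T (fun t => f t * g t).
Proof.
move=> T0 H H' e e0.
have [M M0 HM] := contI_bounded T0 (ac_cont H).
have [N N0 HN] := contI_bounded T0 (ac_cont H').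
have D0 : 0 < M + N + 1 by lra.
have e20 : 0 < e / (M + N + 1) by rewrite divr_gt0.
have [d d0 Hd] := H _ e20; have [d' d'0 Hd'] := H' _ e20.
exists (Num.min d d'); first by rewrite lt_min d0.
move=> s sf; rewrite lt_min => /andP[h h'].
apply: (@le_trans _ _ (\sum_(I <- s) (N * cabs (f I.2 - f I.1) + M * cabs (g I.2 - g I.1)))).
  apply: (family_bound sf) => I i0 i12 iT.
  have -> : f I.2 * g I.2 - f I.1 * g I.1 = g I.2 * (f I.2 - f I.1) + f I.1 * (g I.2 - g I.1) by ring.
  apply: (le_trans (cabsD _ _)); rewrite !cabsM; apply: lerD; apply: ler_wpM2r; rewrite ?cabs_ge0 //.
    by apply: HN => //; apply: le_trans i12.
  by apply: HM => //; apply: le_trans iT.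
rewrite big_split /= -!mulr_sumr.
have h1 := ler_wpM2l N0 (Hd _ sf h).
have h2 := ler_wpM2l M0 (Hd' _ sf h').
have E : e / (M + N + 1) * (M + N + 1) = e by rewrite divfK // gt_eqF.
rewrite -E; lra.
Qed.

Lemma ac_lip T f (M : R) : (forall a b, 0 <= a -> a <= b -> b <= T ->
  cabs (f b - f a) <= M * (b - a)) -> ac T f.
Proof.
move=> H e e0; pose M' := `|M| + 1.
have M0 : 0 < M' by rewrite /M'; have := normr_ge0 M; lra.
exists (e / M'); first by rewrite divr_gt0.
move=> s sf; rewrite ltr_pdivlMr // => h.
apply: (@le_trans _ _ (\sum_(I <- s) (M' * (I.2 - I.1)))).
  apply: (family_bound sf) => I i0 i12 iT; apply: (le_trans (H _ _ i0 i12 iT)).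
  by apply: ler_wpM2r; [lra|rewrite /M'; have := ler_norm M; lra].
by rewrite -mulr_sumr mulrC ltW.
Qed.

Lemma acN T f : ac T f -> ac T (fun t => - f t).
Proof.
move=> H e e0; have [d d0 Hd] := H e e0; exists d => // s sf h.
apply: le_trans (Hd s sf h); apply: (family_bound sf) => I _ _ _.
by rewrite -opprD cabsN.
Qed.

Lemma acB T f g : ac T f -> ac T g -> ac T (fun t => f t - g t).
Proof. by move=> H H'; apply: acD => //; exact: acN. Qed.

Lemma ac_isd T f (l : R -> C) : 0 <= T -> (forall x, 0 <= x -> x <= T -> isd T f x (l x)) ->
  contI T l -> ac T f.
Proof.
move=> T0 H lc; have [M M0 HM] := contI_bounded T0 lc.
apply: (@ac_lip _ _ M) => a b a0 ab bT.
apply: (mvt_isd a0 ab bT) => x ax xb; first by apply: H; lra.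
by apply: HM; lra.
Qed.

Lemma family_measure s (O : set R) : measurable O ->
  (forall I, I \in s -> I.1 <= I.2) -> pairwise (fun I J : R * R => I.2 <= J.1) s ->
  (forall I, I \in s -> `]I.1, I.2]%classic `<=` O) ->
  ((\sum_(I <- s) (I.2 - I.1))%:E <= mu O)%E.
Proof.
elim: s O => [|I s IH] O mO s1 s2 s3; first by rewrite big_nil measure_ge0.
rewrite big_cons EFinD.
move: s2 => /= /andP[/allP sI s2].
have mO1 : measurable (O `&` `]I.2, +oo[%classic) by exact: measurableI.
have -> : O = (O `&` `]-oo, I.2]%classic) `|` (O `&` `]I.2, +oo[%classic).
  rewrite -setIUr (_ : _ `|` _ = setT) ?setIT //; apply/seteqP; split => // x _ /=.
  by rewrite !in_itv /= andbT; case: (lerP x I.2) => h; [left|right].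
rewrite measureU //; first last.
- apply/seteqP; split => // x [] [] _ /= + [] _ /=; rewrite !in_itv /= andbT.
  by move=> h1 h2; move: h1; rewrite leNgt h2.
- exact: measurableI.
apply: leeD; last first.
  apply: IH => //.
  - by move=> J Js; apply: s1; rewrite inE Js orbT.
  - move=> J Js x /= hx; split; first by apply: (s3 J); rewrite ?inE ?Js ?orbT.
    move: hx; rewrite /= !in_itv /= andbT => /andP[h _]; apply: le_lt_trans h.
    exact: sI.
have -> : (I.2 - I.1)%:E = mu `]I.1, I.2]%classic.
  rewrite lebesgue_measure_itv /= lte_fin; case: ltP => [_|h]; first by rewrite EFinB.
  have := s1 I (mem_head _ _) => h'.
  by rewrite (_ : I.1 = I.2) ?subrr //; apply/eqP; rewrite eq_le h h'.
apply: le_measure; rewrite ?inE //; first exact: measurableI.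
move=> x hx; split; first by apply: (s3 I) => //; exact: mem_head.
by move: hx; rewrite /= !in_itv /= => /andP[].
Qed.

Lemma straddle_bound T f Q x (d e u v : R) :
  (forall r w : R, 0 <= r -> r <= w -> w <= T -> Q r <= Q w) ->
  (forall t, 0 <= t -> t <= T -> `|t - x| <= d ->
     cabs (f t - f x) <= `|Q t - Q x| + e * `|t - x|) ->
  0 <= u -> u <= x -> x <= v -> v <= T -> x - u <= d -> v - x <= d ->
  cabs (f v - f u) <= Q v - Q u + e * (v - u).
Proof.
move=> Qm H u0 ux xv vT xu vx.
have x0 := le_trans u0 ux; have xT := le_trans xv vT.
have h1 := H u u0 (le_trans ux xT); have h2 := H v (le_trans x0 xv) vT.
rewrite distrC ger0_norm ?subr_ge0 // [`|Q u - _|]distrC ger0_norm ?subr_ge0 ?Qm // in h1.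
rewrite ger0_norm ?subr_ge0 // ger0_norm ?subr_ge0 ?Qm // in h2.
have {}h1 := h1 xu; have {}h2 := h2 vx.
have -> : f v - f u = (f v - f x) + (f x - f u) by ring.
by apply: (le_trans (cabsD _ _)); rewrite (cabsC (f x)); clear -h1 h2; lra.
Qed.

(** A null set of bad points is covered by an open set so small that absolute continuity controls
the increments over it; at the other points the local bound applies. This gives the fundamental
theorem of calculus in the form needed for solutions, whose derivatives satisfy the equation only
almost everywhere. *)
Lemma gauge_bound T f Q (E : set R) a b : ac T f -> mu.-negligible E ->
  0 <= a -> a <= b -> b <= T ->
  (forall u v : R, 0 <= u -> u <= v -> v <= T -> Q u <= Q v) ->
  (forall x, a <= x -> x <= b -> ~ E x -> forall e : R, 0 < e -> exists2 d : R, 0 < d &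
    forall t, 0 <= t -> t <= T -> `|t - x| <= d ->
      cabs (f t - f x) <= `|Q t - Q x| + e * `|t - x|) ->
  cabs (f b - f a) <= Q b - Q a.
Proof.
move=> fac [N [mN N0 EN]] a0 ab bT Qm H; rewrite -subr_le0; apply: le0_small => e e0.
pose e' := e / (b - a + 1).
have D0 : 0 < b - a + 1 by lra.
have e'0 : 0 < e' by rewrite divr_gt0.
have he : e' * (b - a) + e' = e by rewrite /e'; field; rewrite gt_eqF.
have [d d0 Hd] := fac _ e'0.
have fN : (mu N < +oo)%E by rewrite [mu N]N0.
have [W [openW NW muW]] := @lebesgue_regularity_outer R N d mN fN d0.
have mW : measurable W by exact: measurable_realfun.open_measurable.
have {}muW : (mu W < d%:E)%E.
  apply: le_lt_trans muW; rewrite -[X in (_ <= X)%E]add0e.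
  have E0 : mu (W `&` N) = 0%E.
    apply/eqP; rewrite eq_le measure_ge0 andbT -N0.
    by apply: le_measure; rewrite ?inE //; exact: measurableI.
  by rewrite -E0 addeC -(measureDI mu mW mN).
(* Either the bound holds between [u] and [v], or the excess is due to increments over disjoint
intervals inside the small open set. *)
pose L u v := exists s, [/\ all (fun I : R * R => [&& u <= I.1, I.1 <= I.2 & I.2 <= v]) s,
  pairwise (fun I J : R * R => I.2 <= J.1) s,
  (forall I, I \in s -> `]I.1, I.2]%classic `<=` W) &
  cabs (f v - f u) <= Q v - Q u + e' * (v - u) + \sum_(I <- s) cabs (f I.2 - f I.1)].
suff [s [s1 s2 s3 s4]] : L a b.
  have sf : family T s.
    split => //; apply/allP => I Is; move/allP: s1 => /(_ I Is) /and3P[h1 h2 h3].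
    by rewrite h2 (le_trans a0 h1) (le_trans h3 bT).
  have hm : \sum_(I <- s) (I.2 - I.1) < d.
    rewrite -lte_fin; apply: le_lt_trans muW; apply: family_measure => //.
    by move=> I Is; move/allP: s1 => /(_ I Is) /and3P[].
  have := Hd s sf hm; lra.
apply: cousin => //.
  move=> u v w _ uv vw _ [s [s1 s2 s3 s4]] [r [r1 r2 r3 r4]]; exists (s ++ r).
  move/allP: s1 => s1; move/allP: r1 => r1; split.
  - apply/allP => I; rewrite mem_cat => /orP[/s1|/r1] /and3P[h1 -> h2].
      by rewrite h1 (le_trans h2 vw).
    by rewrite h2 (le_trans uv h1).
  - rewrite pairwise_cat s2 r2 !andbT; apply/allrelP => I J /s1 /and3P[_ _ h1] /r1 /and3P[h2 _ _].
    exact: le_trans h1 h2.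
  - by move=> I; rewrite mem_cat => /orP[/s3|/r3].
  - rewrite big_cat /=; have -> : f w - f u = (f v - f u) + (f w - f v) by ring.
    by apply: (le_trans (cabsD _ _)); lra.
move=> x ax xb.
have [Ex|nEx] := pselect (E x).
  have Wx : W x by apply/NW/EN.
  have [d' /= d'0 Hd'] : exists2 d' : R, 0 < d' & ball x d' `<=` W.
    by move: openW; rewrite openE => /(_ x Wx); move/nbhs_ballP.
  exists (d' / 2); first by rewrite divr_gt0.
  move=> u v au ux xv vb xu vx; exists [:: (u, v)]; split => //=.
  - by rewrite !lexx (le_trans ux xv).
  - move=> I; rewrite inE => /eqP -> y /=; rewrite in_itv /= => /andP[uy yv].
    by apply: Hd'; rewrite /ball /= ltr_norml; clear -uy yv xu vx d'0; apply/andP; split; lra.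
  - rewrite big_seq1 /=.
    have uv := le_trans ux xv.
    rewrite lerDr addr_ge0 ?subr_ge0 ?Qm ?(le_trans a0 au) ?(le_trans vb bT) //.
    by rewrite mulr_ge0 ?subr_ge0 // ltW.
have [d' d'0 Hd'] := H x ax xb nEx e' e'0.
exists d' => // u v au ux xv vb xu vx; exists [::]; split => //; rewrite big_nil addr0.
exact: (straddle_bound Qm Hd' (le_trans a0 au) ux xv (le_trans vb bT) xu vx).
Qed.

Lemma derivable_eps (F : R -> R) x (l : R) : derivable F x 1 -> derive1 F x = l ->
  forall e : R, 0 < e -> exists2 d : R, 0 < d & forall t, `|t - x| <= d ->
    `|F t - F x - (t - x) * l| <= e * `|t - x|.
Proof.
move=> dF Fl e e0.
have : h^-1 *: (F (h + x) - F x) @[h --> 0^'] --> l.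
  rewrite -Fl; have := dF; rewrite /derivable derive1E /derive => dF'.
  have E : (fun h => h^-1 *: (F (h + x) - F x)) = (fun h => h^-1 *: (F (h *: 1 + x) - F x)).
    by apply/funext => h; rewrite /GRing.scale /= mulr1.
  by rewrite E; exact: dF'.
move=> /cvgrPdist_le /(_ e e0) /nbhs_ballP[d /= d0 Hd].
exists (d / 2); first by rewrite divr_gt0.
move=> t td; have [->|tx] := eqVneq t x.
  by rewrite !subrr mul0r subr0 normr0 mulr0.
have tx0 : t - x != 0 by rewrite subr_eq0.
have := Hd (t - x); rewrite /ball /= sub0r normrN => /(_ _ tx0).
have td' : `|t - x| < d by lra.
move=> /(_ td'); rewrite subrK.
rewrite -[leLHS](@mulfK _ `|t - x|) ?normr_eq0 // => h.
have p0 : 0 < `|t - x| by rewrite normr_gt0.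
move: h; rewrite ler_pdivrMr // => h; apply: le_trans h.
have -> : F t - F x - (t - x) * l = - ((l - (t - x)^-1 * (F t - F x)) * (t - x)) by field.
by rewrite normrN normrM.
Qed.

(** The integral of [|Re q| + |Im q|]. By Lebesgue's differentiation theorem it grows almost
everywhere at least as fast as [|q|], and estimates of solutions need no more of the integral of
[|q|]. *)
Lemma L1_majorant T (q : R -> C) : 0 < T -> L1_potential T q -> exists Q, exists E,
  [/\ mu.-negligible E, (forall u v : R, u <= v -> Q u <= Q v) &
   forall x, ~ E x -> 0 < x -> x < T -> forall e : R, 0 < e -> exists2 d : R, 0 < d &
    forall t, `|t - x| <= d -> cabs (q x) * `|t - x| <= `|Q t - Q x| + e * `|t - x|].
Proof.
move=> T0 [iR iI].
pose f0 x : R := `|complex.Re (q x)| + `|complex.Im (q x)|.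
have if0 : mu.-integrable `]0, T[ (EFin \o f0).
  refine (eq_integrable _ _ _ _ (integrableD _ (integrable_abse iR) (integrable_abse iI))) => //;
    exact: measurable_itv.
pose f := f0 \_ `]0, T[.
have intf : mu.-integrable setT (EFin \o f).
  by have := if0; rewrite integrable_mkcond //= /f restrict_EFin.
have f_ge0 x : 0 <= f x by rewrite /f patchE; case: ifP => // _; rewrite addr_ge0.
pose Q x := (\int[mu]_(t in `]-oo, x]) f t)%R.
have intfx x : mu.-integrable `]-oo, x] (EFin \o f) by exact: integrableS intf.
have := FTC1Ny intfx (integrable_locally (measurable_itv _) if0).
move=> [N [mN N0 HN]].
exists Q, N; split.
- exists N; split => //; exact: subset_refl.
- move=> s t st; rewrite /Q /Rintegral; apply: fine_le.
  + exact: integrable_fin_num.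
  + exact: integrable_fin_num.
  + apply: ge0_subset_integral => //=.
    * by case/integrableP: (intfx t).
    * by move=> x _; rewrite lee_fin.
    * by apply: subset_itvl; rewrite bnd_simp.
move=> x nx x0 xT e e0.
have [dQ Q'] : derivable Q x 1 /\ derive1 Q x = f x.
  by apply: contrapT => h; apply: nx; apply: HN.
have [d d0 Hd] := derivable_eps dQ Q' e0; exists d => // t td.
have := Hd t td.
have fx : f x = f0 x by rewrite /f patchE mem_set //= in_itv /= x0 xT.
have h1 : cabs (q x) <= f x by rewrite fx; exact: cabs_ReIm.
have h2 := normr_ge0 (t - x).
have h3 : `|(t - x) * f x| = f x * `|t - x| by rewrite normrM mulrC ger0_norm.
have h4 := lerB_dist ((t - x) * f x) (Q t - Q x).
rewrite [X in _ <= X]distrC h3 in h4.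
have h5 : cabs (q x) * `|t - x| <= f x * `|t - x| by apply: ler_wpM2r.
lra.
Qed.

(** The retraction of the line onto [0, T]; it extends functions continuous on [0, T] to
continuous functions on the line. *)
Definition clamp T t : R := Num.max 0 (Num.min T t).

Lemma clamp_id T t : 0 <= t -> t <= T -> clamp T t = t.
Proof. by move=> t0 tT; rewrite /clamp min_r // max_r. Qed.

Lemma clamp_itv T t : 0 <= T -> 0 <= clamp T t /\ clamp T t <= T.
Proof. by move=> T0; rewrite /clamp le_max lexx ge_max T0 ge_min lexx. Qed.

Lemma clamp_lip T (s t : R) : 0 <= T -> `|clamp T s - clamp T t| <= `|s - t|.
Proof.
move=> T0.
have H (u v : R) : u <= v -> clamp T u <= clamp T v /\ clamp T v - clamp T u <= v - u.
  move=> st; rewrite /clamp; case: (lerP T u) => h1; case: (lerP T v) => h2; rewrite ?(max_r T0).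
  - by split; lra.
  - by split; lra.
  - by case: (lerP 0 u) => h3; split; lra.
  - by case: (lerP 0 u) => h3; case: (lerP 0 v) => h4; split; lra.
have [st|/ltW ts] := lerP s t.
  have [h1 h2] := H _ _ st; rewrite ler_norml.
  by apply/andP; split; lra.
have [h1 h2] := H _ _ ts; rewrite ler_norml.
by apply/andP; split; lra.
Qed.

Lemma real_primitive T (f : R -> R) : 0 < T ->
  (forall x, 0 <= x -> x <= T -> forall e : R, 0 < e -> exists2 d : R, 0 < d &
     forall t, 0 <= t -> t <= T -> `|t - x| <= d -> `|f t - f x| <= e) ->
  exists F : R -> R, forall x, 0 <= x -> x <= T -> forall e : R, 0 < e ->
    exists2 d : R, 0 < d & forall t, `|t - x| <= d ->
    `|F t - F x - (t - x) * f x| <= e * `|t - x|.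
Proof.
move=> T0 fc; pose g t := f (clamp T t).
have gc : continuous g.
  move=> x; apply/cvgrPdist_le => e e0.
  have [c0 cT] := clamp_itv x (ltW T0).
  have [d d0 Hd] := fc _ c0 cT e e0.
  apply/nbhs_ballP; exists d => //= t; rewrite /ball /= => xt.
  have [c0' cT'] := clamp_itv t (ltW T0).
  rewrite distrC; apply: Hd => //; apply: le_trans (clamp_lip _ _ (ltW T0)) _.
  by rewrite distrC ltW.
have ig : mu.-integrable `[-1, T + 1] (EFin \o g).
  apply: continuous_compact_integrable; first exact: segment_compact.
  exact: continuous_subspaceT.
exists (fun x => (\int[mu]_(t in `[-1, x]) g t)%R) => x x0 xT.
have h1 : x < T + 1 by lra.
have h2 : -1 < x by lra.
have [dF F'] := continuous_FTC1_closed h1 ig h2 (gc x).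
have E : g x = f x by rewrite /g clamp_id.
by rewrite -E; exact: derivable_eps.
Qed.

Lemma primitive T (f : R -> C) : 0 < T -> contI T f ->
  exists F : R -> C, forall x, 0 <= x -> x <= T -> isd T F x (f x).
Proof.
move=> T0 fc.
have [F HF] : exists F : R -> R, forall x, 0 <= x -> x <= T -> forall e : R, 0 < e ->
    exists2 d : R, 0 < d & forall t, `|t - x| <= d ->
    `|F t - F x - (t - x) * complex.Re (f x)| <= e * `|t - x|.
  apply: real_primitive => // x x0 xT e e0.
  have [d d0 Hd] := fc x x0 xT e e0; exists d => // t t0 tT td.
  by apply: le_trans (Hd t t0 tT td); rewrite -raddfB; exact: cabs_Re.
have [G HG] : exists F : R -> R, forall x, 0 <= x -> x <= T -> forall e : R, 0 < e ->
    exists2 d : R, 0 < d & forall t, `|t - x| <= d ->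
    `|F t - F x - (t - x) * complex.Im (f x)| <= e * `|t - x|.
  apply: real_primitive => // x x0 xT e e0.
  have [d d0 Hd] := fc x x0 xT e e0; exists d => // t t0 tT td.
  by apply: le_trans (Hd t t0 tT td); rewrite -raddfB; exact: cabs_Im.
exists (fun x => (F x +i* G x)%C) => x x0 xT e e0.
have e20 : 0 < e / 2 by rewrite divr_gt0.
have [d d0 Hd] := HF x x0 xT _ e20; have [d' d'0 Hd'] := HG x x0 xT _ e20.
exists (Num.min d d'); first by rewrite lt_min d0.
move=> t _ _; rewrite le_min => /andP[h h'].
apply: (le_trans (cabs_ReIm _)).
have := Hd t h; have := Hd' t h'; case: (f x) => u v /=.
rewrite !(mul0r, subr0, addr0); lra.
Qed.

End AbsoluteContinuity.

(** * The complex exponential *)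

Section ComplexExponential.
Variable R : realType.
Local Notation C := (R[i]).
Implicit Types (z w h : C) (t : R).

Definition cexp z : C :=
  (expR (complex.Re z))%:C * (cos (complex.Im z) +i* sin (complex.Im z))%C.

Lemma cexpD z w : cexp (z + w) = cexp z * cexp w.
Proof.
rewrite /cexp; case: z w => [a b] [c d] /=; rewrite expRD cosD sinD.
apply/eqP; rewrite eq_complex /= !mul0r !subr0 !addr0; apply/andP; split; apply/eqP; ring.
Qed.

Lemma cabs_cexp z : cabs (cexp z) = expR (complex.Re z).
Proof.
rewrite /cexp cabsM cabs_real ger0_norm ?expR_ge0 //.
by rewrite /cabs /= cos2Dsin2 sqrtr1 mulr1.
Qed.

Lemma cexp_real (a : R) : cexp a%:C = (expR a)%:C.
Proof. by rewrite /cexp /= cos0 sin0 mulr1. Qed.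

Lemma cexp0 : cexp 0 = 1. Proof. by rewrite cexp_real expR0. Qed.

Lemma cexp_first_order (e : R) : 0 < e -> exists2 d : R, 0 < d &
  forall h, cabs h <= d -> cabs (cexp h - 1 - h) <= e * cabs h.
Proof.
move=> e0.
pose e' := Num.min 1 (e / 16).
have e'0 : 0 < e' by rewrite lt_min ltr01 divr_gt0.
have e'1 : e' <= 1 by rewrite /e' ge_min lexx.
have e'e : e' <= e / 16 by rewrite /e' ge_min lexx orbT.
clearbody e'.
have dx : derivable (@expR R) 0 1 by exact: derivable_expR.
have dx' : derive1 (@expR R) 0 = 1 by rewrite derive1E (@derive_val _ _ _ _ _ _ _ (is_derive_expR 0)) expR0.
have dc : derivable (@cos R) 0 1 by exact: derivable_cos.
have dc' : derive1 (@cos R) 0 = 0 by rewrite derive1E (@derive_val _ _ _ _ _ _ _ (is_derive_cos 0)) sin0 oppr0.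
have ds : derivable (@sin R) 0 1 by exact: derivable_sin.
have ds' : derive1 (@sin R) 0 = 1 by rewrite derive1E (@derive_val _ _ _ _ _ _ _ (is_derive_sin 0)) cos0.
have [d1 d10 H1] := derivable_eps dx dx' e'0.
have [d2 d20 H2] := derivable_eps dc dc' e'0.
have [d3 d30 H3] := derivable_eps ds ds' e'0.
exists (Num.min (Num.min d1 d2) (Num.min d3 e')).
  by rewrite !lt_min d10 d20 d30.
move=> h; rewrite !le_min => /andP[/andP[h1 h2] /andP[h3 h4]].
have A := cabs_Re h; have B := cabs_Im h.
have {H1} := H1 (complex.Re h); have {H2} := H2 (complex.Im h); have {H3} := H3 (complex.Im h).
rewrite !subr0 expR0 cos0 sin0 mulr1 !mulr0 !subr0 mulr1.
move=> /(_ (le_trans B h3)) H3 /(_ (le_trans B h2)) H2 /(_ (le_trans A h1)) H1.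
apply: (le_trans (cabs_ReIm _)).
move: A B H1 H2 H3 h4; rewrite /cexp.
move: (cabs h) (cabs_ge0 h); case: h {h1 h2 h3} => a b /= N N0 A B H1 H2 H3 h4.
rewrite !mul0r !subr0 !addr0.
set E := expR a; set c := cos b in H2 *; set s := sin b in H3 *.
rewrite -/E in H1.
have E3 : `|E| <= 3.
  have -> : E = (E - 1 - a) + a + 1 by ring.
  apply: (le_trans (ler_normD _ _)); rewrite normr1.
  have := ler_normD (E - 1 - a) a.
  have : e' * `|a| <= 1 by apply: mulr_ile1; rewrite ?(ltW e'0) //; lra.
  lra.
have ha : e' * `|a| <= e' * N by rewrite ler_wpM2l // ltW.
have hb : e' * `|b| <= e' * N by rewrite ler_wpM2l // ltW.
have en : e' * N <= e / 16 * N by apply: ler_wpM2r.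
have k1 : `|E * c - 1 - a| <= 4 * (e' * N).
  have -> : E * c - 1 - a = (E - 1 - a) + E * (c - 1) by ring.
  apply: (le_trans (ler_normD _ _)); rewrite normrM.
  have : `|E| * `|c - 1| <= 3 * (e' * N) by apply: ler_pM => //; lra.
  lra.
have k2 : `|E * s - b| <= 5 * (e' * N).
  have -> : E * s - b = E * (s - b) + (E - 1 - a) * b + a * b by ring.
  have N1 := ler_normD (E * (s - b) + (E - 1 - a) * b) (a * b).
  have N2 := ler_normD (E * (s - b)) ((E - 1 - a) * b).
  rewrite !normrM in N1 N2.
  have : `|E| * `|s - b| <= 3 * (e' * N) by apply: ler_pM => //; lra.
  have : `|E - 1 - a| * `|b| <= (e' * N) * 1 by apply: ler_pM => //; lra.
  have : `|a| * `|b| <= e' * N by apply: ler_pM => //; lra.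
  lra.
have := mulr_ge0 (ltW e0) N0; lra.
Qed.

Lemma isd_cexp T (k : C) x : isd T (fun t => cexp (t%:C * k)) x (k * cexp (x%:C * k)).
Proof.
move=> e e0.
have D0 : 0 < (cabs k + 1) * (cabs (cexp (x%:C * k)) + 1).
  by rewrite mulr_gt0 //; [have := cabs_ge0 k; lra|have := cabs_ge0 (cexp (x%:C * k)); lra].
have e1 : 0 < e / ((cabs k + 1) * (cabs (cexp (x%:C * k)) + 1)) by rewrite divr_gt0.
have [d d0 Hd] := cexp_first_order e1.
have k1 : 0 < cabs k + 1 by have := cabs_ge0 k; lra.
exists (d / (cabs k + 1)); first by rewrite divr_gt0.
move=> t _ _; rewrite ler_pdivlMr // => td.
have -> : t%:C * k = x%:C * k + (t - x)%:C * k by rewrite rmorphB; ring.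
rewrite cexpD.
set h := (t - x)%:C * k; set E := cexp (x%:C * k).
have -> : E * cexp h - E - (t - x)%:C * (k * E) = E * (cexp h - 1 - h) by rewrite /h; ring.
have hh : cabs h = `|t - x| * cabs k by rewrite /h cabsM cabs_real.
have hd : cabs h <= d by rewrite hh; apply: le_trans td; rewrite ler_wpM2l //; lra.
rewrite cabsM; apply: (le_trans (ler_wpM2l (cabs_ge0 _) (Hd h hd))).
rewrite -/E hh.
have -> : e * `|t - x| = (cabs E + 1) * (e / ((cabs k + 1) * (cabs E + 1)) * (`|t - x| * (cabs k + 1))).
  by field; have := cabs_ge0 E; have := cabs_ge0 k => ? ?; apply/andP; split; rewrite gt_eqF //; lra.
apply: ler_pM; rewrite ?cabs_ge0 //.
- by apply: mulr_ge0; [exact: ltW e1|apply: mulr_ge0; rewrite ?cabs_ge0].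
- lra.
- by rewrite ler_pM2l // ler_wpM2l //; lra.
Qed.

Definition exp_poly n : {poly C} := \sum_(k < n) (k`!%:R^-1) *: 'X^k.

Lemma exp_poly_deriv n : (exp_poly n.+1)^`() = exp_poly n.
Proof.
rewrite /exp_poly raddf_sum big_ord_recl /= expr0 alg_polyC derivC add0r.
apply: eq_bigr => i _; rewrite derivZ derivXn /= /bump /= add1n add0n.
rewrite -scalerMnr scalerMnl; congr (_ *: _).
rewrite -mulr_natr factS natrM invfM mulrAC mulVf ?mul1r //.
Qed.

Lemma isd_poly T (p : {poly C}) (h : C) x :
  isd T (fun t => p.[t%:C * h]) x (h * p^`().[x%:C * h]).
Proof.
elim/poly_ind: p => [|p c IH].
  rewrite linear0 horner0 mulr0 => e e0; exists 1 => // t _ _ _.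
  by rewrite !horner0 subrr mulr0 subrr cabs0 mulr_ge0 // ltW.
have H : isd T (fun t => t%:C * h) x h.
  have := isdM (isd_id T x) (isd_cst T h x); by rewrite mulr0 addr0 mul1r.
have := isdD (isdM IH H) (isd_cst T c x).
have -> : h * p^`().[x%:C * h] * (x%:C * h) + p.[x%:C * h] * h + 0 =
   h * (p * 'X + c%:P)^`().[x%:C * h].
  by rewrite derivD derivM derivX derivC !addr0 mulr1 !(hornerD, hornerM, hornerX); ring.
move=> K e e0; have [d d0 Hd] := K e e0; exists d => // t t0 tT td.
by have := Hd t t0 tT td; rewrite !hornerMXaddC.
Qed.

(** Induction on [n]: for [n > 0] the difference vanishes at [t = 0], and its derivative along the
ray is [h] times the difference of the preceding order. *)
Lemma cexp_remainder n h t : cabs h <= 1 -> 0 <= t -> t <= 1 ->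
  cabs (cexp (t%:C * h) - (exp_poly n).[t%:C * h]) <= expR 1 * cabs h ^+ n.
Proof.
move=> h1; elim: n t => [|n IH] t t0 t1.
  rewrite /exp_poly big_ord0 horner0 subr0 expr0 mulr1 cabs_cexp ler_expR.
  apply: (le_trans (ler_norm _)); apply: (le_trans (cabs_Re _)).
  by rewrite cabsM cabs_real ger0_norm // mulr_ile1 ?cabs_ge0.
have H0 : cexp ((0 : R)%:C * h) - (exp_poly n.+1).[(0 : R)%:C * h] = 0.
  rewrite mul0r cexp0 horner_coef0 /exp_poly coef_sum big_ord_recl /= coefZ coefXn eqxx mulr1 invr1.
  by rewrite big1 ?addr0 ?subrr // => i _; rewrite coefZ coefXn mulr0.
rewrite -[X in cabs X]subr0 -H0.
have D x : isd 1 (fun t => cexp (t%:C * h) - (exp_poly n.+1).[t%:C * h]) x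
   (h * (cexp (x%:C * h) - (exp_poly n).[x%:C * h])).
  rewrite mulrBr -(exp_poly_deriv n); apply: isdB; [exact: isd_cexp|exact: isd_poly].
apply: (le_trans (@mvt_isd _ 1 _ _ (expR 1 * cabs h ^+ n.+1) 0 t (lexx 0) t0 t1 (fun x _ _ => D x) _)).
  move=> x x0 xt; rewrite cabsM exprS mulrCA ler_wpM2l ?cabs_ge0 // IH //; lra.
by rewrite subr0 ler_piMr // mulr_ge0 ?expR_ge0 // exprn_ge0 // cabs_ge0.
Qed.

Lemma ana_cexp z : ana cexp z.
Proof.
move=> n; exists ((cexp z)%:P * exp_poly n).
apply: (@taylorI _ _ _ _ _ (cabs (cexp z) * expR 1) 1) => // h h1.
rewrite cexpD hornerM hornerC -mulrBr cabsM -mulrA ler_wpM2l ?cabs_ge0 //.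
by have := @cexp_remainder n h 1 h1 ler01 (lexx 1); rewrite mul1r.
Qed.

Lemma ana_lip (f : C -> C) z : ana f z -> exists L r : R, [/\ 0 <= L, 0 < r &
  forall h, cabs h <= r -> cabs (f (z + h) - f z) <= L * cabs h].
Proof.
move=> fa; have [b [c [K [r [K0 r0 H]]]]] := taylor2 fa.
exists (K + cabs b + cabs c), (Num.min r 1); split.
- by rewrite !addr_ge0 ?cabs_ge0.
- by rewrite lt_min r0 ltr01.
move=> h; rewrite le_min => /andP[hr h1].
have -> : f (z + h) - f z = (f (z + h) - (f z + b * h + c * h ^+ 2)) + b * h + c * h * h by ring.
apply: (le_trans (cabsD _ _)); have := cabsD (f (z + h) - (f z + b * h + c * h ^+ 2)) (b * h).
rewrite !cabsM => h2; have := H h hr.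
have h3 : K * cabs h ^+ 3 <= K * cabs h.
  rewrite ler_wpM2l // exprSr ler_piMl ?cabs_ge0 // exprn_ile1 ?cabs_ge0 //.
have h4 : cabs c * cabs h * cabs h <= cabs c * cabs h.
  by rewrite ler_piMr // mulr_ge0 ?cabs_ge0.
lra.
Qed.

Lemma ana_compose (f g : C -> C) z : ana f (g z) -> ana g z -> ana (fun w => f (g w)) z.
Proof.
move=> fa ga n.
have [p [K [r [K0 r0 r1 H]]]] := fa n.
have [L [s [L0 s0 HL]]] := ana_lip ga.
have Ga : ana (fun w => p.[g w - g z]) z.
  elim/poly_ind: {H} p => [|p c IH].
    by apply: (@ana_ext _ (fun=> 0)); [move=> w; rewrite horner0|exact: ana_cst].
  apply: (@ana_ext _ (fun w => p.[g w - g z] * (g w - g z) + c)).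
    by move=> w; rewrite hornerMXaddC.
  by apply: anaD; [apply: anaM => //; apply: anaB|]; try exact: ana_cst.
have [q [M [u [M0 u0 u1 HM]]]] := Ga n.
have D0 : 0 < L + 1 by lra.
exists q; apply: (@taylorI _ _ _ _ _ (K * L ^+ n + M) (Num.min (Num.min s u) (r / (L + 1)))).
  by rewrite !lt_min s0 u0 divr_gt0.
move=> h; rewrite !le_min => /andP[/andP[hs hu]]; rewrite ler_pdivlMr // => hr.
have e1 := HL h hs.
have e2 : cabs (g (z + h) - g z) <= r by have := cabs_ge0 h; lra.
have -> : f (g (z + h)) - q.[h] = (f (g z + (g (z + h) - g z)) - p.[g (z + h) - g z]) +
  (p.[g (z + h) - g z] - q.[h]).
  by rewrite (_ : g z + (g (z + h) - g z) = g (z + h)); ring.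
apply: (le_trans (cabsD _ _)); rewrite mulrDl lerD ?HM //.
apply: (le_trans (H _ e2)); rewrite -mulrA -exprMn ler_wpM2l //.
by rewrite lerXn2r ?nnegrE ?mulr_ge0 ?cabs_ge0.
Qed.

End ComplexExponential.

(** * Growth in a sector *)

Section PhragmenLindelof.
Variable R : realType.
Local Notation C := (R[i]).
Implicit Types (f : C -> C) (z : C).

(** The excluded sector around the positive half-line is narrower than a right angle, so that the
real part of [z^2] is comparable to [|z|^2] inside. *)
Definition off_sector z := complex.Re z <= 2 * `|complex.Im z|.

(** The Phragmen-Lindelof principle. The order of growth 3/2 is less than 2, so the factor [exp (-
e z^2)] makes the function small on large arcs in the sector, and the maximum principle applies to
the truncated sector; then [e] tends to 0. *)
Lemma bounded_in_sector f (k B : R) : (forall z, ana f z) -> 1 <= B ->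
  (forall R1 : R, exists2 r : R, R1 <= r & forall z, cabs z = r ->
     cabs (f z) <= expR (k * (r * Num.sqrt r))) ->
  (forall z, off_sector z -> cabs (f z) <= B) ->
  forall z, cabs (f z) <= B.
Proof.
move=> fa B1 growth fB z0.
have [off|/negP] := pselect (off_sector z0); first exact: fB.
rewrite /off_sector -ltNge => z0S.
pose s := complex.Re z0 ^+ 2 - complex.Im z0 ^+ 2.
have s0 : 0 <= s.
  rewrite /s subr_ge0 -[leLHS]real_normK ?num_real // lerXn2r ?nnegrE //.
    by apply: ltW; apply: le_lt_trans z0S; rewrite mulr_ge0.
  by have := normr_ge0 (complex.Im z0); lra.
rewrite -subr_le0; apply: le0_small => e e0.
pose ep := e / (s * cabs (f z0) + 1).
have D0 : 0 < s * cabs (f z0) + 1 by rewrite ltr_wpDl // mulr_ge0 // cabs_ge0.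
have ep0 : 0 < ep by rewrite divr_gt0.
pose g z := f z * cexp (- (ep%:C * z ^+ 2)).
have ga z : ana g z.
  apply: anaM => //; apply: ana_compose; first exact: ana_cexp.
  apply: anaN; apply: anaM; first exact: ana_cst.
  by apply: anaX; exact: ana_id.
have gE z : cabs (g z) = cabs (f z) * expR (- ep * (complex.Re z ^+ 2 - complex.Im z ^+ 2)).
  rewrite /g cabsM cabs_cexp; congr (_ * expR _).
  by case: z => a b /=; ring.
suff H : cabs (g z0) <= B.
  have h1 := expR_ge1Dx (- ep * s).
  have h2 : cabs (f z0) * (1 + - ep * s) <= B.
    by apply: le_trans H; rewrite gE ler_wpM2l // cabs_ge0.
  have h3 : ep * (s * cabs (f z0)) <= e.
    rewrite /ep mulrAC ler_pdivrMr // ler_wpM2l ?(ltW e0) //; lra.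
  lra.
(* From this radius on [|k| r^(3/2) <= ep r^2 / 2], and [Re z^2 >= r^2 / 2] on the arc. *)
pose R1 := Num.max (cabs z0) (Num.max 1 ((2 * `|k| / ep) ^+ 2)).
have [r rR hr] := growth R1.
have [r0 r1 rk] : [/\ cabs z0 <= r, 1 <= r & (2 * `|k| / ep) ^+ 2 <= r].
  by move: rR; rewrite /R1 !ge_max => /andP[-> /andP[-> ->]].
apply: (@max_principle R (fun z => 2 * `|complex.Im z| <= complex.Re z /\ cabs z <= r)
  (fun z => complex.Re z = 2 * `|complex.Im z| \/ cabs z = r) g r B).
- apply: closedCP => z nK.
  have [h|h] := lerP (2 * `|complex.Im z|) (complex.Re z).
    have h' : r < cabs z by rewrite ltNge; apply/negP => ?; apply: nK.
    exists ((cabs z - r) / 2); first by rewrite divr_gt0 // subr_gt0.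
    move=> w hw [_ h2]; have := cabs_tri z (- w); rewrite opprK cabsN; lra.
  exists ((2 * `|complex.Im z| - complex.Re z) / 6); first by rewrite divr_gt0 // subr_gt0.
  move=> w hw [h2 _]; move: h2; rewrite !raddfD /=.
  have := cabs_Re w; have := cabs_Im w; have := ler_norm (complex.Re w).
  have := lerB_normD (complex.Im z) (complex.Im w); lra.
- by move=> z [].
- by move=> z _; exact: ga.
- lra.
- move=> z [zS zr] [zE|zE]; rewrite gE.
    apply: (@le_trans _ _ (B * 1)); last by rewrite mulr1.
    apply: ler_pM; rewrite ?cabs_ge0 ?expR_ge0 //; first by apply: fB; rewrite /off_sector zE.
    rewrite -expR0 ler_expR mulNr oppr_le0 mulr_ge0 ?(ltW ep0) // subr_ge0.
    rewrite -[leLHS]real_normK ?num_real // lerXn2r ?nnegrE // zE ?mulr_ge0 //.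
    by have := normr_ge0 (complex.Im z); lra.
  apply: le_trans B1; apply: (le_trans (ler_wpM2r (expR_ge0 _) (hr z zE))).
  rewrite -expRD -expR0 ler_expR.
  have x2 : r ^+ 2 / 2 <= complex.Re z ^+ 2 - complex.Im z ^+ 2.
    rewrite -zE cabs_sqr.
    have : complex.Im z ^+ 2 * 4 <= complex.Re z ^+ 2.
      have -> : complex.Im z ^+ 2 * 4 = (2 * `|complex.Im z|) ^+ 2.
        by rewrite exprMn real_normK ?num_real //; ring.
      rewrite lerXn2r ?nnegrE ?mulr_ge0 //; apply: le_trans zS; by rewrite mulr_ge0.
    have := sqr_ge0 (complex.Im z); lra.
  have x3 : ep * (r ^+ 2 / 2) <= ep * (complex.Re z ^+ 2 - complex.Im z ^+ 2).
    by rewrite ler_pM2l.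
  have r0' : 0 <= r by lra.
  have x4 : k * (r * Num.sqrt r) <= ep * (r ^+ 2 / 2).
    apply: (@le_trans _ _ (`|k| * (r * Num.sqrt r))).
      by rewrite ler_wpM2r ?ler_norm // mulr_ge0 // sqrtr_ge0.
    have q : 2 * `|k| / ep <= Num.sqrt r.
      have q1 : 0 <= 2 * `|k| / ep by rewrite divr_ge0 ?(ltW ep0) // mulr_ge0.
      by rewrite -(@ler_pXn2r _ 2) ?nnegrE ?sqrtr_ge0 ?sqr_sqrtr.
    rewrite ler_pdivrMr // in q.
    have rr : r ^+ 2 = r * (Num.sqrt r * Num.sqrt r) by rewrite -expr2 sqr_sqrtr.
    rewrite rr.
    have := sqrtr_ge0 r => q0.
    have := ler_wpM2r (mulr_ge0 r0' q0) q; lra.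
  lra.
- move=> z [zS zr] nZ.
  have h1 : 2 * `|complex.Im z| < complex.Re z.
    by rewrite lt_neqAle zS andbT; apply/eqP => h; apply: nZ; left.
  have h2 : cabs z < r by rewrite lt_neqAle zr andbT; apply/eqP => h; apply: nZ; right.
  exists (Num.min ((complex.Re z - 2 * `|complex.Im z|) / 6) (r - cabs z)).
    by rewrite lt_min divr_gt0 ?subr_gt0.
  move=> h; rewrite le_min => /andP[hh1 hh2]; split; last first.
    by apply: (le_trans (cabsD _ _)); lra.
  rewrite !raddfD /=.
  have := cabs_Re h; have := cabs_Im h; have := ler_norm (- complex.Re h); rewrite normrN.
  have := ler_normD (complex.Im z) (complex.Im h); lra.
- by split => //; exact: ltW.
Qed.

(** The difference quotient at 0 is bounded by [2 B / r] on disks of arbitrary radius [r]. *)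
Lemma liouville f (B : R) : (forall z, ana f z) -> (forall z, cabs (f z) <= B) ->
  forall z, f z = f 0.
Proof.
move=> fa fB z; have [g [ga fg]] := ana_slope 0 fa.
have B0 : 0 <= B by apply: le_trans (fB 0); exact: cabs_ge0.
suff g0 : g z = 0 by rewrite fg g0 mulr0 addr0.
apply: cabs_le_small => e e0.
pose r := cabs z + 2 * B / e + 1.
have D0 : 0 <= 2 * B / e by rewrite divr_ge0 ?(ltW e0) // mulr_ge0.
have r0 : 0 < r by have := cabs_ge0 z; rewrite /r; lra.
apply: (le_trans (@slope_bound R f g 0 r B r0 ga fg (fun w _ => fB w) z _)).
  by rewrite subr0 /r; lra.
rewrite ler_pdivrMr //.
have E : e * (2 * B / e) = 2 * B by field; rewrite gt_eqF.
rewrite /r; have := mulr_ge0 (ltW e0) (cabs_ge0 z); lra.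
Qed.

(** Convergence off the sector bounds the function there, the Phragmen-Lindelof principle bounds
it in the sector, so it is constant by Liouville's theorem, and the constant is its limit along
the negative half-line. *)
Lemma sector_liouville f (l : C) (k : R) : (forall z, ana f z) ->
  (forall R1 : R, exists2 r : R, R1 <= r & forall z, cabs z = r ->
     cabs (f z) <= expR (k * (r * Num.sqrt r))) ->
  (forall e : R, 0 < e -> exists R0 : R, forall z, off_sector z -> R0 <= cabs z ->
     cabs (f z - l) <= e) ->
  forall z, f z = l.
Proof.
move=> fa growth lim.
have [R0 HR] := lim 1 ltr01.
have bd z : cabs (z - 0) <= R0 -> cabs z <= R0 by rewrite subr0.
have [B2 HB2] := @ana_bounded R (fun z => cabs (z - 0) <= R0) f R0 (@closedC_disk R 0 R0)
  bd (fun z _ => fa z).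
pose B := Num.max 1 (Num.max (cabs l + 1) B2).
have fB : forall z, cabs (f z) <= B.
  apply: (@bounded_in_sector f k B) => //; first by rewrite /B le_max lexx.
  move=> z zoff; rewrite /B !le_max; have [h|h] := lerP R0 (cabs z).
    apply/orP; right; apply/orP; left.
    have := HR z zoff h; have := cabs_tri (f z) l; lra.
  by rewrite HB2 ?orbT // subr0 ltW.
have fc := liouville fa fB.
move=> z; rewrite fc; apply/eqP; rewrite -subr_eq0; apply/eqP/cabs_le_small => e e0.
have [R1 H1] := lim e e0.
rewrite -(fc (- (Num.max R1 0)%:C)).
have m0 : 0 <= Num.max R1 0 by rewrite le_max lexx orbT.
apply: H1.
  by rewrite /off_sector raddfN /= oppr0 normr0 mulr0 oppr_le0.
by rewrite cabsN cabs_real ger0_norm // le_max lexx.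
Qed.

End PhragmenLindelof.

(** * Minimum modulus of entire functions of order 1/2 *)

Section MinimumModulus.
Variable R : realType.
Local Notation C := (R[i]).
Implicit Types (f F : C -> C) (z : C) (p : {poly C}).

(** Each of the [k] divisions by [z] multiplies the bound by [2 / r]. *)
Lemma taylor_remainder f (r M : R) k : 0 < r -> (forall z, ana f z) ->
  (forall z, cabs z <= r -> cabs (f z) <= M) ->
  exists p, exists g, [/\ (size p <= k)%N, (0 < k)%N -> p.[0] = f 0, forall z, ana g z,
    forall z, f z = p.[z] + z ^+ k * g z &
    forall z, cabs z <= r -> cabs (g z) <= (2 / r) ^+ k * M].
Proof.
move=> r0 fa fM; elim: k => [|k [p [g [sp p0 ga fE gM]]]].
  exists 0, f; split => //; first by rewrite size_poly0.
    by move=> z; rewrite horner0 expr0 add0r mul1r.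
  by move=> z /fM; rewrite expr0 mul1r.
have [g' [g'a gE]] := ana_slope 0 ga.
exists (p + (g 0) *: 'X^k), g'; split.
- apply: (leq_trans (size_polyD _ _)); rewrite geq_max (leqW sp) /=.
  by apply: (leq_trans (size_scale_leq _ _)); rewrite size_polyXn.
- move=> _; rewrite hornerD hornerZ hornerXn expr0n.
  case: k p0 fE {sp gM} => [|k] p0 fE; last by rewrite mulr0 addr0 p0.
  by rewrite fE /= mulr1 expr0 mul1r.
- exact: g'a.
- move=> z; rewrite fE hornerD hornerZ hornerXn exprSr gE subr0; ring.
- move=> z zr; have := @slope_bound R g g' 0 r ((2 / r) ^+ k * M) r0 g'a gE.
  move=> /(_ (fun w hw => gM w (eq_ind _ (fun t => is_true (cabs t <= r)) hw _ (subr0 w)))).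
  move=> /(_ z); rewrite subr0 => /(_ zr); rewrite exprS.
  by have -> : 2 * ((2 / r) ^+ k * M) / r = 2 / r * (2 / r) ^+ k * M by ring.
Qed.

(** Pigeonhole: two radii that are close to the same point would be closer to each other than
their spacing. *)
Lemma far_radius (s : seq R) n (R0 : R) : (size s <= n)%N -> 0 < R0 ->
  exists r : R, [/\ R0 <= r, r <= 2 * R0 & forall a, a \in s -> R0 / (2 * n.+1%:R) <= `|r - a|].
Proof.
move=> sn R00; pose d := R0 / (2 * n.+1%:R).
have n0 : 0 < n.+1%:R :> R by rewrite ltr0n.
pose rad (j : 'I_n.+1) := R0 * (1 + j%:R / n.+1%:R).
have [[j Hj]|H] := pselect (exists j, forall a, a \in s -> d <= `|rad j - a|).
  exists (rad j); split => //; rewrite /rad.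
    by rewrite ler_pMr // lerDl divr_ge0.
  have : j%:R / n.+1%:R <= 1 :> R by rewrite ler_pdivrMr // mul1r ler_nat ltnW.
  by move: (j%:R / n.+1%:R) => t t1; rewrite [2 * _]mulrC ler_pM2l //; lra.
exfalso.
have Hf j : has (fun a => `|rad j - a| < d) s.
  apply/negPn/negP => /hasPn h; apply: H; exists j => a /h.
  by rewrite -leNgt.
have hj j : (find (fun a => (`|rad j - a| < d)%R) s < n)%N.
  by apply: leq_trans sn; rewrite -has_find.
pose phi (j : 'I_n.+1) := Ordinal (hj j).
have : injective phi.
  move=> j k /(congr1 val) /= jk; apply/val_inj/eqP => /=; apply: contraT => njk.
  have h1 := nth_find 0 (Hf j); have h2 := nth_find 0 (Hf k).
  rewrite -jk in h2; set a := nth _ _ _ in h1 h2.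
  have : `|rad j - rad k| < 2 * d.
    have -> : rad j - rad k = (rad j - a) - (rad k - a) by ring.
    by apply: (le_lt_trans (ler_normB _ _)); lra.
  have -> : rad j - rad k = R0 / n.+1%:R * (j%:R - k%:R) by rewrite /rad; field; rewrite gt_eqF.
  have -> : 2 * d = R0 / n.+1%:R * 1 by rewrite /d; field; rewrite gt_eqF.
  rewrite normrM gtr0_norm ?divr_gt0 // ltr_pM2l ?divr_gt0 //.
  rewrite ltNge => /negP[]; move: njk; rewrite neq_ltn => /orP[h|h].
    by rewrite distrC -natrB ?(ltnW h) // normr_nat ler1n subn_gt0.
  by rewrite -natrB ?(ltnW h) // normr_nat ler1n subn_gt0.
by move=> /leq_card; rewrite !card_ord ltnn.
Qed.

(** Compare the factors [|z - a|] and [|a|] for each root [a]. Roots of modulus up to [4 R0] are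
kept away by the choice of [r], and for the other ones [|z - a|] is at least half of [|a|]. *)
Lemma poly_lower_bound p n (R0 : R) : (size p <= n.+1)%N -> 0 < R0 -> p.[0] != 0 ->
  exists r : R, [/\ R0 <= r, r <= 2 * R0 & forall z, cabs z = r ->
     cabs p.[0] * ((8 * n.+1%:R)^-1) ^+ n <= cabs p.[z]].
Proof.
move=> sp R00 p0.
have [s sE] := closed_field_poly_normal p.
have pn0 : p != 0 by apply: contraNneq p0 => ->; rewrite horner0.
have ss : (size s <= n)%N.
  by move: sp; rewrite sE size_scale ?lead_coef_eq0 // size_prod_XsubC ltnS.
have [r [r1 r2 Hr]] := @far_radius (map (@cabs R) s) n R0 ltac:(by rewrite size_map) R00.
exists r; split => // z zr.
pose c : R := (8 * n.+1%:R)^-1.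
have n0 : 1 <= n.+1%:R :> R by rewrite ler1n.
have c0 : 0 < c by rewrite invr_gt0; lra.
have c1 : c <= 1 by rewrite invf_le1; lra.
have key a : a \in s -> c * cabs a <= cabs (z - a).
  move=> ai; have := Hr (cabs a) (map_f _ ai) => h.
  have t1 : `|r - cabs a| <= cabs (z - a).
    rewrite -zr ler_norml lerNl opprB; apply/andP; split; last exact: cabs_tri.
    by rewrite cabsC cabs_tri.
  have [a4|a4] := lerP (cabs a) (4 * R0).
    apply: le_trans t1; apply: le_trans h.
    have -> : R0 / (2 * n.+1%:R) = c * (4 * R0) by rewrite /c; field; rewrite gt_eqF //; lra.
    by rewrite ler_pM2l.
  apply: le_trans t1; rewrite distrC; apply: le_trans (ler_norm _).
  have : c * cabs a <= (1 / 2) * cabs a.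
    by rewrite ler_wpM2r ?cabs_ge0 // /c -[1/2]invf_div divr1 lef_pV2 ?posrE; lra.
  lra.
rewrite sE !hornerZ !cabsM -mulrA ler_wpM2l ?cabs_ge0 //.
apply: (@le_trans _ _ (cabs (\prod_(a <- s) ('X - a%:P)).[0] * c ^+ size s)).
  by rewrite ler_wpM2l ?cabs_ge0 // ler_wiXn2l // ltW.
elim: s key {sE ss Hr} => [|a s IH] key.
  by rewrite !big_nil expr0 mulr1 !hornerC.
rewrite !big_cons !hornerM !cabsM exprS.
have -> x y t w : x * y * (t * w) = (t * x) * (y * w) :> R by ring.
apply: ler_pM.
- by rewrite mulr_ge0 ?cabs_ge0 // ltW.
- by rewrite mulr_ge0 ?cabs_ge0 // exprn_ge0 // ltW.
- by rewrite !hornerXsubC sub0r cabsN key // mem_head.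
- by apply: IH => b bs; apply: key; rewrite inE bs orbT.
Qed.

Lemma expR_half_le2 : expR (1 / 2) <= 2 :> R.
Proof.
have := expR_ge1Dx (- (1 / 2) : R); rewrite expRN => h.
have e0 := expR_gt0 (1 / 2 : R).
have : (1 / 2) * expR (1 / 2) <= (expR (1 / 2))^-1 * expR (1 / 2) :> R.
  by rewrite ler_pM2r //; lra.
rewrite mulVf ?gt_eqF //; lra.
Qed.

Lemma expR_pow_le2 k : expR (k%:R / 2) <= 2 ^+ k :> R.
Proof.
have -> : k%:R / 2 = (1 / 2) * k%:R :> R by field.
by rewrite expRM_natr lerXn2r ?nnegrE ?expR_ge0 // expR_half_le2.
Qed.

(** With [s] the square root of [k] this is [8 s^2 <= exp (4 s)], which follows from [4 s <= (1 +
s)^2 <= exp (2 s)]. *)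
Lemma pow_le_expR k : (0 < k)%N -> (8 * k%:R) ^+ k <= expR (4 * (k%:R * Num.sqrt k%:R)) :> R.
Proof.
move=> k0; set s := Num.sqrt _.
have -> : 4 * (k%:R * s) = (4 * s) * k%:R by ring.
rewrite expRM_natr; apply: lerXn2r; rewrite ?nnegrE ?mulr_ge0 ?expR_ge0 //.
have s0 : 0 <= s by exact: sqrtr_ge0.
have -> : k%:R = s ^+ 2 :> R by rewrite sqr_sqrtr.
rewrite (expRM_natl 4).
have h1 := expR_ge1Dx s.
have h2 : (1 + s) ^+ 4 <= expR s ^+ 4.
  by rewrite lerXn2r ?nnegrE ?expR_ge0 //; lra.
apply: le_trans h2.
have h3 : 4 * s <= (1 + s) ^+ 2 by have := sqr_ge0 (1 - s); lra.
have h4 : (4 * s) ^+ 2 <= ((1 + s) ^+ 2) ^+ 2.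
  by rewrite lerXn2r ?nnegrE ?mulr_ge0 ?exprn_ge0 //; lra.
rewrite -exprM in h4; apply: le_trans h4; rewrite exprMn.
have := sqr_ge0 s; lra.
Qed.

(** Away from suitable circles an entire function of order 1/2 cannot be too small: it is close to
a Taylor polynomial whose degree is comparable to the radius, and the lower bound for polynomials
applies. The resulting order 3/2 is far from optimal, but is below 2. *)
Lemma min_modulus F (A : R) : 0 <= A -> (forall z, ana F z) -> F 0 != 0 ->
  (forall z, cabs (F z) <= expR (A * (1 + Num.sqrt (cabs z)))) ->
  exists k0 : R, forall R1 : R, exists r : R, [/\ R1 <= r, 1 <= r &
    forall z, cabs z = r -> expR (- (k0 * (r * Num.sqrt r))) <= cabs (F z)].
Proof.
move=> A0 Fa F0 FA.
pose a := cabs (F 0); have a0 : 0 < a by rewrite cabs_gt0.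
pose L := 2 / a; have L0 : 0 < L by rewrite divr_gt0.
have La : expR (- L) <= a / 2.
  rewrite expRN -invf_div lef_pV2 ?posrE ?expR_gt0 ?divr_gt0 //.
  by have := expR_ge1Dx L; rewrite -/L; lra.
(* With [n] about [K R0], and the disk of radius [rho] so much larger than the circle to be found,
the Taylor remainder of order [n + 1] is at most half of the lower bound for the polynomial. *)
pose K := (32 * A) ^+ 2 + 1.
have K1 : 1 <= K by rewrite /K; have := sqr_ge0 (32 * A); lra.
pose K' := K + 2.
exists (L + 4 * (K' * Num.sqrt K')) => R1.
pose R0 := Num.max (Num.max R1 1) (4 * (A + L)).
have [R01 R02 R03] : [/\ R1 <= R0, 1 <= R0 & 4 * (A + L) <= R0].
  by rewrite /R0 !le_max !lexx !orbT.
clearbody R0.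
have R00 : 0 < R0 by lra.
pose n := Num.truncn (K * R0).
have KR0 : 0 <= K * R0 by rewrite mulr_ge0; lra.
have [n1 n2] : n%:R <= K * R0 /\ K * R0 < n.+1%:R.
  by have := truncn_itv KR0 => /andP[].
have k1 : 1 <= n.+1%:R :> R by rewrite ler1n.
pose rho := 64 * n.+1%:R * R0.
have rho0 : 0 < rho by rewrite /rho !mulr_gt0 //; lra.
pose M := expR (A * (1 + Num.sqrt rho)).
have FM z : cabs z <= rho -> cabs (F z) <= M.
  move=> h; apply: (le_trans (FA z)); rewrite ler_expR ler_wpM2l // lerD2l.
  by rewrite ler_wsqrtr.
have [p [g [sp p0 ga FE gM]]] := @taylor_remainder F rho M n.+1 rho0 Fa FM.
have {}p0 := p0 (ltn0Sn n).
have [r [r1 r2 Hr]] := @poly_lower_bound p n R0 sp R00 ltac:(by rewrite p0).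
exists r; split; [lra|lra|] => z zr.
have {}Hr := Hr z zr; rewrite p0 -/a in Hr.
pose c : R := (8 * n.+1%:R)^-1.
rewrite -/c in Hr.
have c0 : 0 < c by rewrite invr_gt0; lra.
have c1 : c <= 1 by rewrite invf_le1; lra.
have err : cabs (z ^+ n.+1 * g z) <= a / 2 * c ^+ n.+1.
  have zrho : cabs z <= rho.
    rewrite zr; apply: (le_trans r2); rewrite /rho ler_pM2r //; lra.
  rewrite cabsM cabsX zr.
  apply: (@le_trans _ _ ((2 * R0) ^+ n.+1 * ((2 / rho) ^+ n.+1 * M))).
    apply: ler_pM; rewrite ?cabs_ge0 ?exprn_ge0 ?gM //; try lra.
    by rewrite lerXn2r ?nnegrE //; lra.
  have -> : (2 * R0) ^+ n.+1 * ((2 / rho) ^+ n.+1 * M) = (c / 2) ^+ n.+1 * M.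
    rewrite mulrA -exprMn; congr (_ ^+ _ * _); rewrite /rho /c; field.
    by rewrite !gt_eqF //; lra.
  rewrite expr_div_n -[leLHS]mulrA [leRHS]mulrC ler_pM2l ?exprn_gt0 // mulrC ler_pdivrMr ?exprn_gt0 //.
  apply: (@le_trans _ _ (expR (- L + n.+1%:R / 2))); last first.
    rewrite expRD; apply: ler_pM; rewrite ?expR_ge0 //; exact: expR_pow_le2.
  rewrite ler_expR.
  have sr : A * Num.sqrt rho <= n.+1%:R / 4.
    rewrite -(@ler_pXn2r _ 2) ?nnegrE ?mulr_ge0 ?sqrtr_ge0 ?divr_ge0 //.
    rewrite exprMn sqr_sqrtr ?(ltW rho0) // /rho.
    have q : (32 * A) ^+ 2 * R0 <= n.+1%:R.
      apply: ltW; apply: le_lt_trans n2; rewrite ler_pM2r // /K; lra.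
    have : n.+1%:R * ((32 * A) ^+ 2 * R0) <= n.+1%:R * n.+1%:R by rewrite ler_wpM2l.
    lra.
  have : R0 <= n.+1%:R.
    by apply: ltW; apply: le_lt_trans n2; rewrite ler_peMl // ltW.
  lra.
have low : a / 2 * c ^+ n.+1 <= cabs (F z).
  have h1 := cabs_tri p.[z] (- (z ^+ n.+1 * g z)); rewrite opprK cabsN -FE in h1.
  have h2 : c ^+ n.+1 <= c ^+ n by rewrite exprS ler_piMl // exprn_ge0 // ltW.
  have := ler_wpM2l (ltW a0) h2; lra.
apply: le_trans low.
rewrite expRN.
have -> : a / 2 * c ^+ n.+1 = (L * (8 * n.+1%:R) ^+ n.+1)^-1.
  by rewrite /L /c exprVn invfM invf_div.
have H8 : 0 < 8 * n.+1%:R :> R by lra.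
have D : 0 < L * (8 * n.+1%:R) ^+ n.+1 by apply: mulr_gt0 => //; apply: exprn_gt0.
rewrite lef_pV2 ?posrE ?expR_gt0 //.
apply: (@le_trans _ _ (expR L * expR (4 * (n.+1%:R * Num.sqrt n.+1%:R)))).
  apply: ler_pM; rewrite ?(ltW L0) ?exprn_ge0 ?(ltW H8) ?pow_le_expR //.
  by have := expR_ge1Dx L; lra.
rewrite -expRD ler_expR [leRHS]mulrDl.
have rr : 1 <= r by lra.
have sq1 : 1 <= Num.sqrt r by rewrite -[X in X <= _]sqrtr1 ler_wsqrtr.
apply: lerD; first by rewrite ler_peMr ?(ltW L0) // -[1]mulr1 ler_pM.
rewrite -mulrA ler_pM2l //.
have kK : n.+1%:R <= K' * r.
  rewrite -natr1 /K' mulrDl.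
  have : K * R0 <= K * r by rewrite ler_wpM2l //; lra.
  lra.
have K'0 : 0 <= K' by rewrite /K'; lra.
have -> : K' * Num.sqrt K' * (r * Num.sqrt r) = (K' * r) * Num.sqrt (K' * r).
  by rewrite sqrtrM //; ring.
by apply: ler_pM; rewrite ?sqrtr_ge0 // ler_wsqrtr.
Qed.

(** A zero at the origin is divided out; the quotient is bounded on the unit disk by the maximum
principle. *)
Lemma min_modulus_gen F (A : R) m : 0 <= A -> (forall z, ana F z) -> zero_order F 0 m ->
  (forall z, cabs (F z) <= expR (A * (1 + Num.sqrt (cabs z)))) ->
  exists k0 : R, forall R1 : R, exists r : R, [/\ R1 <= r, 1 <= r &
    forall z, cabs z = r -> expR (- (k0 * (r * Num.sqrt r))) <= cabs (F z)].
Proof.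
move=> A0 Fa Fo FA; have [g [ga g0 FE]] := zero_order_factor Fa Fo.
have gF z : 1 <= cabs z -> cabs (g z) <= cabs (F z).
  move=> z1; rewrite FE subr0 cabsM ler_peMl ?cabs_ge0 // cabsX.
  exact: exprn_ege1.
have g1 z : cabs z <= 1 -> cabs (g z) <= expR (A * 2).
  move=> z1; apply: (@max_disk R g 0 1) => //; last by rewrite subr0.
  move=> w; rewrite subr0 => w1; apply: (le_trans (gF w _)); first by rewrite w1.
  apply: (le_trans (FA w)); rewrite w1 sqrtr1 ler_expR; lra.
have gA z : cabs (g z) <= expR ((A * 2) * (1 + Num.sqrt (cabs z))).
  have s0 := sqrtr_ge0 (cabs z).
  have [z1|z1] := lerP (cabs z) 1.
    apply: (le_trans (g1 z z1)); rewrite ler_expR ler_peMr //; lra.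
  apply: (le_trans (gF z (ltW z1))); apply: (le_trans (FA z)).
  by rewrite ler_expR ler_wpM2r //; lra.
have [k0 H] := @min_modulus g (A * 2) ltac:(lra) ga g0 gA.
exists k0 => R1; have [r [r1 r2 Hr]] := H R1; exists r; split => // z zr.
apply: (le_trans (Hr z zr)); rewrite FE subr0 cabsM ler_peMl ?cabs_ge0 // cabsX.
by apply: exprn_ege1; rewrite zr.
Qed.

(** The quotient is entire because the zeros agree, of order at most 3/2 along a sequence of
circles by the minimum modulus of the denominator, and tends to 1 off the sector. *)
Lemma eq_of_zeros F G (A : R) (ord : C -> nat) : 0 <= A ->
  (forall z, ana F z) -> (forall z, ana G z) ->
  (forall z, zero_order F z (ord z)) -> (forall z, zero_order G z (ord z)) ->
  (forall z, cabs (F z) <= expR (A * (1 + Num.sqrt (cabs z)))) ->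
  (forall z, cabs (G z) <= expR (A * (1 + Num.sqrt (cabs z)))) ->
  (forall e : R, 0 < e -> exists R0 : R, forall z, off_sector z -> R0 <= cabs z ->
     G z != 0 /\ cabs (F z - G z) <= e * cabs (G z)) ->
  forall z, F z = G z.
Proof.
move=> A0 Fa Ga Fo Go FA GA lim.
have [g [ga FE]] := ana_quotient Fa Ga Fo Go.
have [k0 Hk] := min_modulus_gen A0 Ga (Go 0) GA.
suff g1 : forall z, g z = 1 by move=> z; rewrite FE g1 mul1r.
apply: (@sector_liouville R g 1 (2 * A + k0) ga).
  move=> R1; have [r [r1 r2 Hr]] := Hk R1; exists r => // z zr.
  have G0 : 0 < cabs (G z) by apply: lt_le_trans (Hr z zr); exact: expR_gt0.
  rewrite -(ler_pM2r G0) -cabsM -FE; apply: (le_trans (FA z)).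
  apply: (@le_trans _ _ (expR ((2 * A + k0) * (r * Num.sqrt r)) * expR (- (k0 * (r * Num.sqrt r))))).
    rewrite -expRD ler_expR zr.
    have s1 : 1 <= Num.sqrt r by rewrite -[X in X <= _]sqrtr1 ler_wsqrtr.
    have : A * Num.sqrt r <= A * (r * Num.sqrt r) by rewrite ler_wpM2l // ler_peMl //; lra.
    have : A * 1 <= A * (r * Num.sqrt r) by rewrite ler_wpM2l // -[1]mulr1 ler_pM.
    lra.
  by rewrite ler_wpM2l ?expR_ge0 // Hr.
move=> e e0; have [R0 HR] := lim e e0; exists R0 => z zo zR.
have [G0 h] := HR z zo zR.
rewrite -cabs_gt0 in G0; rewrite -(ler_pM2r G0) -cabsM mulrBl mul1r -FE //.
Qed.

End MinimumModulus.

(** * Riemann-Stieltjes sums *)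

Section StieltjesSums.
Variable R : realType.
Local Notation C := (R[i]).
Implicit Types (y sigma : R -> C) (v : R -> R) (x xi : nat -> R).

Lemma complex_cauchy (a : nat -> C) :
  (forall e : R, 0 < e -> exists N, forall m n, (N <= m)%N -> (N <= n)%N -> cabs (a m - a n) <= e) ->
  exists l : C, forall e : R, 0 < e -> exists N, forall n, (N <= n)%N -> cabs (a n - l) <= e.
Proof.
move=> H.
have real_cauchy (u : nat -> R) : (forall m n, `|u m - u n| <= cabs (a m - a n)) ->
    exists l : R, forall e : R, 0 < e -> exists N, forall n, (N <= n)%N -> `|u n - l| <= e.
  move=> ua.
  have cu : cvg (u n @[n --> \oo]).
    apply/cauchy_cvgP/cauchy_exP => e e0.
    have [N HN] := H (e / 2) ltac:(by rewrite divr_gt0).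
    exists (u N); exists N => // n /= Nn; rewrite /ball /=.
    apply: (le_lt_trans (ua _ _)); apply: (le_lt_trans (HN _ _ (leqnn N) Nn)); lra.
  move/cvg_ex: cu => [l /cvgrPdist_le ul]; exists l => e e0.
  have [N _ HN] := ul e e0; exists N => n Nn; rewrite distrC; exact: HN.
have [l1 H1] := real_cauchy (fun n => complex.Re (a n)) (fun m n =>
  ltac:(rewrite -raddfB; exact: cabs_Re)).
have [l2 H2] := real_cauchy (fun n => complex.Im (a n)) (fun m n =>
  ltac:(rewrite -raddfB; exact: cabs_Im)).
exists (l1 +i* l2)%C => e e0.
have e20 : 0 < e / 2 by rewrite divr_gt0.
have [N1 K1] := H1 _ e20; have [N2 K2] := H2 _ e20.
exists (maxn N1 N2) => n; rewrite geq_max => /andP[n1 n2].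
apply: (le_trans (cabs_ReIm _)); rewrite (splitr e).
by have := K1 n n1; have := K2 n n2; case: (a n) => b c /=; lra.
Qed.

(** Degenerate cells are admitted here, which makes the estimates independent of strictness; the
partitions of the definition are a special case. *)
Definition tagged (T d : R) n x xi := [/\ x 0%N = 0, x n = T & forall i, (i < n)%N ->
  [/\ x i <= x i.+1, x i.+1 - x i < d, x i <= xi i & xi i <= x i.+1]].

Definition rsum y sigma n x xi : C := \sum_(i < n) y (xi i) * (sigma (x i.+1) - sigma (x i)).

Lemma tagged_mono T d n x xi : tagged T d n x xi ->
  forall i j, (i <= j)%N -> (j <= n)%N -> x i <= x j.
Proof.
move=> [_ _ H] i j; elim: j => [|j IH]; first by rewrite leqn0 => /eqP ->.
rewrite leq_eqVlt => /orP[/eqP -> //|]; rewrite ltnS => ij jn.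
by have [h _ _ _] := H j jn; apply: le_trans h; apply: IH => //; exact: ltnW.
Qed.

Lemma tagged_itv T d n x xi : tagged T d n x xi ->
  forall i, (i <= n)%N -> 0 <= x i /\ x i <= T.
Proof.
move=> P i i_n; have [x0 xn _] := P; rewrite -{1}x0 -xn.
by split; apply: (tagged_mono P).
Qed.

Lemma tagged_tag T d n x xi : tagged T d n x xi ->
  forall i, (i < n)%N -> 0 <= xi i /\ xi i <= T.
Proof.
move=> P i i_n; have [_ _ /(_ i i_n) [_ _ h1 h2]] := P.
have [h3 _] := tagged_itv P (ltnW i_n); have [_ h4] := tagged_itv P i_n.
by split; lra.
Qed.

Lemma telescope_ord (V : zmodType) (f : nat -> V) n : \sum_(i < n) (f i.+1 - f i) = f n - f 0%N.
Proof. by rewrite -(big_mkord xpredT (fun i => f i.+1 - f i)) telescope_sumr. Qed.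

Definition unif T n (i : nat) : R := T * (i%:R / n%:R).

Lemma unif_tagged T d n : 0 < T -> (0 < n)%N -> T / n%:R < d ->
  tagged T d n (unif T n) (unif T n).
Proof.
move=> T0 n0 nd; have n0' : 0 < n%:R :> R by rewrite ltr0n.
split; rewrite /unif; first by rewrite mul0r mulr0.
  by rewrite divff ?mulr1 // gt_eqF.
move=> i i_n.
have h : T * (i%:R / n%:R) <= T * (i.+1%:R / n%:R).
  by rewrite ler_pM2l // ler_pM2r ?invr_gt0 // ler_nat.
split => //; rewrite (_ : _ - _ = T / n%:R) // -natr1; field; by rewrite gt_eqF.
Qed.

Lemma exists_fine (T d : R) : 0 < T -> 0 < d -> exists N, forall n, (N <= n)%N ->
  (0 < n)%N /\ T / n%:R < d.
Proof.
move=> T0 d0; exists (Num.truncn (T / d)).+1 => n h.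
have n0 : (0 < n)%N by apply: leq_trans h.
split => //; rewrite ltr_pdivrMr ?ltr0n // mulrC -ltr_pdivrMr //.
have Td : 0 <= T / d by rewrite divr_ge0 // ltW.
by have /andP[_ h1] := truncn_itv Td; apply: lt_le_trans h1 _; rewrite ler_nat.
Qed.

Section Fixed.
Variables (T : R) (sigma : R -> C) (v : R -> R).
Hypothesis T0 : 0 < T.
Hypothesis sv : forall s t : R, 0 <= s -> s <= t -> t <= T -> cabs (sigma t - sigma s) <= v t - v s.

Lemma v_mono (s t : R) : 0 <= s -> s <= t -> t <= T -> v s <= v t.
Proof. by move=> s0 st tT; rewrite -subr_ge0; apply: le_trans (sv s0 st tT); exact: cabs_ge0. Qed.

Lemma v_total : 0 <= v T - v 0.
Proof. by rewrite subr_ge0; apply: v_mono => //; exact: ltW. Qed.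

Lemma rsum_bound y (B : R -> R) d n x xi : tagged T d n x xi ->
  (forall i, (i < n)%N -> cabs (y (xi i)) * (v (x i.+1) - v (x i)) <= B (x i.+1) - B (x i)) ->
  cabs (rsum y sigma n x xi) <= B T - B 0.
Proof.
move=> P H; have [x0 xn Hx] := P; rewrite /rsum; apply: (le_trans (cabs_sum _ _ _)).
have -> : B T - B 0 = \sum_(i < n) (B (x i.+1) - B (x i)).
  by rewrite (telescope_ord (fun i => B (x i))) x0 xn.
apply: ler_sum => i _.
apply: le_trans (H i (ltn_ord i)); rewrite cabsM ler_wpM2l ?cabs_ge0 //.
have [h1 _ _ _] := Hx i (ltn_ord i).
have [h2 _] := tagged_itv P (ltnW (ltn_ord i)); have [_ h3] := tagged_itv P (ltn_ord i).
exact: sv.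
Qed.

(** The increment of [f] over the intersection of the cells [a, b] and [c, d], arranged so that it
vanishes for disjoint cells and telescopes in either cell. *)
Definition overlap (V : zmodType) (f : R -> V) (a b c d : R) : V :=
  (f (Num.min b d) - f (Num.min a d)) - (f (Num.min b c) - f (Num.min a c)).

Lemma overlap_sum (V : zmodType) (f : R -> V) (c d D : R) n x xi : tagged T D n x xi ->
  0 <= c -> c <= T -> 0 <= d -> d <= T ->
  \sum_(i < n) overlap f (x i) (x i.+1) c d = f d - f c.
Proof.
move=> [x0 xn _] c0 cT d0 dT; rewrite /overlap sumrB.
rewrite (telescope_ord (fun i => f (Num.min (x i) d))) (telescope_ord (fun i => f (Num.min (x i) c))).
rewrite x0 xn (min_r dT) (min_r cT) (min_l d0) (min_l c0).
by rewrite opprB addrA subrK.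
Qed.

Lemma overlap_bound (a b c d : R) : 0 <= a -> a <= b -> b <= T -> 0 <= c -> c <= d -> d <= T ->
  cabs (overlap sigma a b c d) <= overlap v a b c d /\
  (overlap sigma a b c d = 0 \/ (a < d /\ c < b)).
Proof.
move=> a0 ab bT c0 cd dT; rewrite /overlap.
have [bc|cb] := lerP b c.
  rewrite !min_l; [|lra..].
  by rewrite !subrr cabs0; split => //; left.
have [da|ad] := lerP d a.
  rewrite !min_r; [|lra..].
  by rewrite !subrr cabs0; split => //; left.
split; last by right.
have [ac|ca] := lerP a c.
  have -> (V : zmodType) (p q r : V) : p - q - (r - q) = p - r.
    by rewrite opprB addrA subrK.
  have -> (V : zmodType) (p q r : V) : p - q - (r - q) = p - r.
    by rewrite opprB addrA subrK.
  by apply: sv; rewrite ?le_min ?ge_min ?bT ?(ltW cb) ?cd.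
rewrite !subrr !subr0.
by apply: sv; rewrite ?le_min ?ge_min ?bT ?(ltW ad) ?ab.
Qed.

(** Two tagged sums of mesh at most [d] differ by the oscillation of [y] at scale [2 d] times the
variation: compare them cell by cell on the common refinement. *)
Lemma rsum_close y (d e : R) n x xi m z zi :
  (forall s t : R, 0 <= s -> s <= T -> 0 <= t -> t <= T -> `|s - t| <= d + d -> cabs (y s - y t) <= e) ->
  tagged T d n x xi -> tagged T d m z zi ->
  cabs (rsum y sigma n x xi - rsum y sigma m z zi) <= e * (v T - v 0).
Proof.
move=> osc P Q; have [x0 xn Hx] := P; have [z0 zm Hz] := Q.
have T0' := ltW T0.
have E1 : rsum y sigma n x xi = \sum_(i < n) \sum_(j < m)
    y (xi i) * overlap sigma (x i) (x i.+1) (z j) (z j.+1).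
  apply: eq_bigr => i _; rewrite -mulr_sumr; congr (_ * _).
  have [h1 h2] := tagged_itv P (ltnW (ltn_ord i)); have [h3 h4] := tagged_itv P (ltn_ord i).
  rewrite -(overlap_sum sigma Q h1 h2 h3 h4); apply: eq_bigr => j _.
  rewrite /overlap !(minC _ (x i)) !(minC _ (x i.+1)); ring.
have E2 : rsum y sigma m z zi = \sum_(i < n) \sum_(j < m)
    y (zi j) * overlap sigma (x i) (x i.+1) (z j) (z j.+1).
  rewrite exchange_big; apply: eq_bigr => j _; rewrite -mulr_sumr; congr (_ * _).
  have [h1 h2] := tagged_itv Q (ltnW (ltn_ord j)); have [h3 h4] := tagged_itv Q (ltn_ord j).
  by rewrite (overlap_sum sigma P h1 h2 h3 h4).
have E3 : v T - v 0 = \sum_(j < m) \sum_(i < n) overlap v (x i) (x i.+1) (z j) (z j.+1).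
  have -> : v T - v 0 = \sum_(j < m) (v (z j.+1) - v (z j)).
    by rewrite (telescope_ord (fun j => v (z j))) z0 zm.
  apply: eq_bigr => j _.
  have [h1 h2] := tagged_itv Q (ltnW (ltn_ord j)); have [h3 h4] := tagged_itv Q (ltn_ord j).
  by rewrite (overlap_sum v P h1 h2 h3 h4).
rewrite E1 E2 E3 [X in _ <= _ * X]exchange_big -sumrB mulr_sumr; apply: (le_trans (cabs_sum _ _ _)).
apply: ler_sum => i _; rewrite -sumrB mulr_sumr; apply: (le_trans (cabs_sum _ _ _)).
apply: ler_sum => j _.
rewrite -mulrBl cabsM.
have [a1 a2 a3 a4] := Hx i (ltn_ord i); have [b1 b2 b3 b4] := Hz j (ltn_ord j).
have [h1 _] := tagged_itv P (ltnW (ltn_ord i)); have [_ h4] := tagged_itv P (ltn_ord i).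
have [k1 _] := tagged_itv Q (ltnW (ltn_ord j)); have [_ k4] := tagged_itv Q (ltn_ord j).
have [ov1 [ov2|[ov2 ov3]]] := overlap_bound h1 a1 h4 k1 b1 k4.
  rewrite ov2 cabs0 mulr0 mulr_ge0 //.
    by apply: le_trans (osc 0 0 _ _ _ _ _); rewrite ?cabs_ge0 // subrr normr0; lra.
  by apply: le_trans ov1; exact: cabs_ge0.
apply: ler_pM; rewrite ?cabs_ge0 //.
have [p1 p2] := tagged_tag P (ltn_ord i); have [q1 q2] := tagged_tag Q (ltn_ord j).
apply: osc => //; rewrite ler_norml; apply/andP; split; lra.
Qed.

Definition rsint y (I : C) := forall e : R, 0 < e -> exists2 d : R, 0 < d &
  forall n x xi, tagged T d n x xi -> cabs (rsum y sigma n x xi - I) <= e.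

Lemma tagged_le d d' n x xi : d <= d' -> tagged T d n x xi -> tagged T d' n x xi.
Proof.
move=> dd [h1 h2 h3]; split => // i /h3 [a1 a2 a3 a4]; split => //; lra.
Qed.

Lemma rsint_exists y : contI T y -> exists I, rsint y I.
Proof.
move=> yc; have V0 := v_total; pose V := v T - v 0 + 1.
have V1 : 0 < V by rewrite /V; lra.
have close (e : R) : 0 < e -> exists2 d : R, 0 < d & forall n x xi m z zi,
    tagged T d n x xi -> tagged T d m z zi ->
    cabs (rsum y sigma n x xi - rsum y sigma m z zi) <= e.
  move=> e0; have e'0 : 0 < e / V by rewrite divr_gt0.
  have [d d0 Hd] := contI_unif (ltW T0) yc e'0.
  exists (d / 2); first by rewrite divr_gt0.
  move=> n x xi m z zi P Q.
  apply: (@le_trans _ _ (e / V * (v T - v 0))).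
    apply: rsum_close P Q => s t s0 sT t0 tT h; apply: Hd => //; lra.
  have h : e / V * V = e by rewrite divfK // gt_eqF.
  rewrite -[leRHS]h ler_wpM2l ?(ltW e'0) // /V; lra.
have [|I HI] := @complex_cauchy (fun n => rsum y sigma n (unif T n) (unif T n)).
  move=> e e0; have [d d0 Hd] := close e e0.
  have [N HN] := exists_fine T0 d0; exists N => m n mN nN.
  by have [m0 md] := HN m mN; have [n0 nd] := HN n nN; apply: Hd; exact: unif_tagged.
exists I => e e0; have e20 : 0 < e / 2 by rewrite divr_gt0.
have [d d0 Hd] := close _ e20.
exists d => // n x xi P.
have [N HN] := exists_fine T0 d0; have [N' HN'] := HI _ e20.
have [n0 nd] := HN _ (leq_maxl N N'); have h := HN' _ (leq_maxr N N').
have Q := unif_tagged T0 n0 nd.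
have := Hd _ _ _ _ _ _ P Q; set S := rsum _ _ (maxn _ _) _ _ in h *.
have -> : rsum y sigma n x xi - I = (rsum y sigma n x xi - S) + (S - I) by ring.
move=> k; apply: (le_trans (cabsD _ _)); lra.
Qed.

Lemma rsint_test y I (d : R) : 0 < d -> rsint y I -> forall e : R, 0 < e ->
  exists n, [/\ (0 < n)%N, tagged T d n (unif T n) (unif T n) &
    cabs (rsum y sigma n (unif T n) (unif T n) - I) <= e].
Proof.
move=> d0 HI e e0; have [d' d'0 Hd] := HI e e0.
have m0 : 0 < Num.min d d' by rewrite lt_min d0.
have [N /(_ N (leqnn N)) [N0 HN]] := exists_fine T0 m0.
have P := unif_tagged T0 N0 HN; exists N; split => //.
  by apply: tagged_le P; rewrite ge_min lexx.
by apply: Hd; apply: tagged_le P; rewrite ge_min lexx orbT.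
Qed.

Lemma rsint_ext y1 y2 I : (forall t : R, 0 <= t -> t <= T -> y1 t = y2 t) -> rsint y1 I -> rsint y2 I.
Proof.
move=> E H e e0; have [d d0 Hd] := H e e0; exists d => // n x xi P.
apply: le_trans (Hd n x xi P); rewrite le_eqVlt; apply/orP; left; apply/eqP; congr (cabs (_ - _)).
by apply: eq_bigr => i _; have [h1 h2] := tagged_tag P (ltn_ord i); rewrite E.
Qed.

Lemma rsintD (c : C) y1 y2 I1 I2 : rsint y1 I1 -> rsint y2 I2 ->
  rsint (fun t => c * y1 t + y2 t) (c * I1 + I2).
Proof.
move=> H1 H2 e e0.
have D0 : 0 < cabs c + 1 by have := cabs_ge0 c; lra.
have e1 : 0 < e / 2 / (cabs c + 1) by rewrite !divr_gt0.
have e2 : 0 < e / 2 by rewrite divr_gt0.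
have [d1 d10 K1] := H1 _ e1; have [d2 d20 K2] := H2 _ e2.
exists (Num.min d1 d2); first by rewrite lt_min d10.
move=> n x xi P.
have h1 : cabs (rsum y1 sigma n x xi - I1) <= e / 2 / (cabs c + 1).
  by apply: K1; apply: tagged_le P; rewrite ge_min lexx.
have h2 : cabs (rsum y2 sigma n x xi - I2) <= e / 2.
  by apply: K2; apply: tagged_le P; rewrite ge_min lexx orbT.
have -> : rsum (fun t => c * y1 t + y2 t) sigma n x xi - (c * I1 + I2) =
  c * (rsum y1 sigma n x xi - I1) + (rsum y2 sigma n x xi - I2).
  have -> : rsum (fun t => c * y1 t + y2 t) sigma n x xi =
    c * rsum y1 sigma n x xi + rsum y2 sigma n x xi; last by ring.
  rewrite /rsum mulr_sumr -big_split /=; apply: eq_bigr => i _; ring.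
apply: (le_trans (cabsD _ _)); rewrite cabsM.
have h3 : cabs c * cabs (rsum y1 sigma n x xi - I1) <= e / 2.
  apply: (@le_trans _ _ ((cabs c + 1) * (e / 2 / (cabs c + 1)))).
    by apply: ler_pM; rewrite ?cabs_ge0 //; lra.
  by rewrite mulrC divfK // gt_eqF.
lra.
Qed.

Lemma rsint_bound y I (M : R) : 0 <= M -> (forall t : R, 0 <= t -> t <= T -> cabs (y t) <= M) ->
  rsint y I -> cabs I <= M * (v T - v 0).
Proof.
move=> M0 yM HI; rewrite -subr_le0; apply: le0_small => e e0.
have [n [n0 P h]] := rsint_test ltr01 HI e0.
have k : cabs (rsum y sigma n (unif T n) (unif T n)) <= M * v T - M * v 0.
  apply: (rsum_bound (B := fun t => M * v t) P) => i i_n.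
  rewrite -mulrBr ler_wpM2r //; last first.
    by have [p1 p2] := tagged_tag P i_n; exact: yM.
  have [_ _ /(_ i i_n) [a1 _ _ _]] := P.
  have [h1 _] := tagged_itv P (ltnW i_n); have [_ h3] := tagged_itv P i_n.
  by rewrite subr_ge0; exact: v_mono.
rewrite -mulrBr in k.
have := cabs_tri I (rsum y sigma n (unif T n) (unif T n)); rewrite cabsC; lra.
Qed.

Lemma rsint_uniq y I J : rsint y I -> rsint y J -> I = J.
Proof.
move=> HI HJ; have := rsintD (-1) HI HJ => H.
have : cabs (-1 * I + J) <= 0 * (v T - v 0).
  apply: rsint_bound H => // t _ _; rewrite mulN1r addNr cabs0 //.
rewrite mul0r mulN1r => h; apply/esym/eqP; rewrite -subr_eq0 addrC -cabs_eq0 eq_le h.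
exact: cabs_ge0.
Qed.

(** In left-tagged sums the first cell contributes the mass at 0. The cells that start before
[delta] see only the small variation [eta] away from 0, and on the other ones [y] is bounded by
[m]. *)
Lemma rsint_tail y I (H : C) (M m delta eta : R) : 0 <= M -> 0 <= m -> 0 < delta -> 2 * delta <= T ->
  (forall t : R, 0 <= t -> t <= T -> cabs (y t) <= M) ->
  (forall t : R, delta <= t -> t <= T -> cabs (y t) <= m) ->
  (forall s : R, 0 < s -> s <= 2 * delta -> v (2 * delta) - v s <= eta) ->
  (forall e : R, 0 < e -> exists2 d : R, 0 < d & forall s : R, 0 < s -> s <= d ->
     cabs (sigma s - sigma 0 - H) <= e) ->
  rsint y I -> cabs (I - H * y 0) <= M * eta + m * (v T - v 0).
Proof.
move=> M0 m0 d0 dT yM ym veta sH HI; rewrite -subr_le0; apply: le0_small => e e0.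
have D0 : 0 < M + 1 by lra.
have e2 : 0 < e / 2 by rewrite divr_gt0.
have e3 : 0 < e / 2 / (M + 1) by rewrite !divr_gt0.
have [d1 d10 Hd1] := sH _ e3.
have dd : 0 < Num.min delta d1 by rewrite lt_min d0.
have [n [n0 P h]] := rsint_test dd HI e2.
set x := unif T n in P h.
have [x0 xn Hx] := P.
have [a1 a2 _ _] := Hx 0%N n0; rewrite x0 subr0 in a2.
have x1 : 0 < x 1%N.
  by rewrite /x /unif mulr_gt0 // divr_gt0 ?ltr0n.
have [a3 a4] : x 1%N < delta /\ x 1%N < d1 by move: a2; rewrite lt_min => /andP[].
case: n n0 @x P h x0 xn Hx a1 a2 x1 a3 a4 => // n _ x P h x0 xn Hx a1 a2 x1 a3 a4.
rewrite /rsum big_ord_recl /= in h.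
have k1 : cabs (y (x 0%N) * (sigma (x 1%N) - sigma (x 0%N)) - H * y 0) <= e / 2.
  rewrite x0; have -> : y 0 * (sigma (x 1%N) - sigma 0) - H * y 0 =
    y 0 * (sigma (x 1%N) - sigma 0 - H) by ring.
  rewrite cabsM; apply: (@le_trans _ _ ((M + 1) * (e / 2 / (M + 1)))).
    apply: ler_pM; rewrite ?cabs_ge0 // ?Hd1 ?(ltW a4) //.
    by have := yM 0 (lexx _) (ltW T0); lra.
  by rewrite mulrC divfK // gt_eqF.
(* A majorant for all cells at once: the first term counts the cells near 0, which end before [2
delta] because the mesh is less than [delta]. *)
pose B t := M * v (Num.min t (2 * delta)) + m * v t.
set S := \sum_(i < n) _ in h.
have k2 : cabs S <= M * eta + m * (v T - v 0).
  apply: (@le_trans _ _ (B T - B (x 1%N))); last first.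
    rewrite /B (min_r dT) (min_l (_ : x 1%N <= 2 * delta)); last by lra.
    have q1 := veta (x 1%N) x1 ltac:(lra).
    have q2 : v 0 <= v (x 1%N) by apply: v_mono; lra.
    have := ler_wpM2l M0 q1; have := ler_wpM2l m0 q2; lra.
  apply: (le_trans (cabs_sum _ _ _)).
  have -> : B T - B (x 1%N) = \sum_(i < n) (B (x i.+2) - B (x i.+1)).
    by rewrite (telescope_ord (fun i => B (x i.+1))) xn.
  apply: ler_sum => i _.
  rewrite /bump /= add1n.
  have i1 : (i.+1 < n.+1)%N by rewrite ltnS.
  have [b1 b2 _ _] := Hx _ i1.
  have [h1 _] := tagged_itv P (ltnW i1); have [_ h3] := tagged_itv P i1.
  have b3 : x i.+2 < x i.+1 + delta by move: b2; rewrite lt_min => /andP[]; lra.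
  have vv := v_mono h1 b1 h3.
  rewrite cabsM.
  have ss := sv h1 b1 h3.
  have [q|q] := lerP delta (x i.+1).
    apply: (@le_trans _ _ (m * (v (x i.+2) - v (x i.+1)))).
      by apply: ler_pM; rewrite ?cabs_ge0 ?ym //; lra.
    have : v (Num.min (x i.+1) (2 * delta)) <= v (Num.min (x i.+2) (2 * delta)).
      apply: v_mono; rewrite ?le_min ?ge_min ?h1 ?h3 ?dT ?b1 ?lexx ?orbT //; lra.
    by rewrite /B => w; have := ler_wpM2l M0 w; lra.
  rewrite /B !min_l; [|lra..].
  have := ler_wpM2l m0 vv.
  have : cabs (y (x i.+1)) * cabs (sigma (x i.+2) - sigma (x i.+1)) <= M * (v (x i.+2) - v (x i.+1)).
    by apply: ler_pM; rewrite ?cabs_ge0 ?yM //; lra.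
  lra.
have -> : I - H * y 0 = (y (x 0%N) * (sigma (x 1%N) - sigma (x 0%N)) - H * y 0) + S -
   (y (x 0%N) * (sigma (x 1%N) - sigma (x 0%N)) + S - I) by ring.
have := cabsB ((y (x 0%N) * (sigma (x 1%N) - sigma (x 0%N)) - H * y 0) + S)
   (y (x 0%N) * (sigma (x 1%N) - sigma (x 0%N)) + S - I).
have := cabsD (y (x 0%N) * (sigma (x 1%N) - sigma (x 0%N)) - H * y 0) S.
lra.
Qed.

End Fixed.
End StieltjesSums.

(** * Forms with a mass at 0 *)

Section MassFunctional.
Variable R : realType.
Local Notation C := (R[i]).
Implicit Types (y sigma : R -> C) (v : R -> R).

(** The total variation on [0, t]. *)
Lemma real_bv_majorant (T : R) (f : R -> R) : bounded_variation 0 T f ->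
  exists v : R -> R, forall s t : R, 0 <= s -> s <= t -> t <= T -> `|f t - f s| <= v t - v s.
Proof.
move=> bf; exists (fun t => fine (total_variation 0 t f)) => s t s0 st tT.
have t0 : 0 <= t by exact: le_trans st.
have fint u : 0 <= u -> u <= T -> total_variation 0 u f \is a fin_num.
  by move=> u0 uT; apply/bounded_variationP => //; exact: (bounded_variationl u0 uT bf).
have ft := fint t t0 tT; have fs := fint s s0 (le_trans st tT).
have D := total_variationD f s0 st.
have G := total_variation_ge f st.
have fst : total_variation s t f \is a fin_num.
  by move: ft; rewrite D fin_numD => /andP[].
rewrite D fineD // addrAC subrr add0r -lee_fin fineK //.
Qed.

Lemma bv_majorant (T : R) sigma : complex_BV T sigma ->
  exists v, forall s t : R, 0 <= s -> s <= t -> t <= T -> cabs (sigma t - sigma s) <= v t - v s.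
Proof.
move=> [/real_bv_majorant[v1 H1] /real_bv_majorant[v2 H2]].
exists (fun t => v1 t + v2 t) => s t s0 st tT; apply: (le_trans (cabs_ReIm _)).
have := H1 s t s0 st tT; have := H2 s t s0 st tT.
by rewrite !raddfB /=; lra.
Qed.

(** A monotone function has a limit at 0 from the right. *)
Lemma small_variation (T eta : R) sigma v : 0 < T -> 0 < eta ->
  (forall s t : R, 0 <= s -> s <= t -> t <= T -> cabs (sigma t - sigma s) <= v t - v s) ->
  exists delta : R, [/\ 0 < delta, 2 * delta <= T &
    forall s : R, 0 < s -> s <= 2 * delta -> v (2 * delta) - v s <= eta].
Proof.
move=> T0 eta0 sv.
pose E := [set v t | t in [set t | 0 < t /\ t <= T]].
have hE : has_inf E.
  split; first by exists (v T), T.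
  by exists (v 0) => _ [t [t0 tT] <-]; exact: (v_mono sv (lexx _) (ltW t0) tT).
have [_ [t [t0 tT] <-] ht] := inf_adherent eta0 hE.
exists (t / 2); have -> : 2 * (t / 2) = t by field.
split; rewrite ?divr_gt0 // => s s0 st.
have : inf E <= v s by apply: ge_inf; [exact: hE.2|exists s => //; split => //; exact: le_trans tT].
lra.
Qed.

Lemma jump0_limit (T : R) sigma v : 0 < T ->
  (forall s t : R, 0 <= s -> s <= t -> t <= T -> cabs (sigma t - sigma s) <= v t - v s) ->
  forall e : R, 0 < e -> exists2 d : R, 0 < d & forall s : R, 0 < s -> s <= d ->
     cabs (sigma s - sigma 0 - jump0 (sigma : R -> Cx R)) <= e.
Proof.
move=> T0 sv.
have close (e : R) : 0 < e -> exists2 d : R, 0 < d & forall s t : R, 0 < s -> s <= d ->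
    0 < t -> t <= d -> cabs (sigma s - sigma t) <= e.
  move=> e0; have [d [d0 dT H]] := small_variation T0 e0 sv.
  exists (2 * d); first by rewrite mulr_gt0.
  have G (s t : R) : 0 < s -> s <= t -> t <= 2 * d -> cabs (sigma t - sigma s) <= e.
    move=> s0 st td; apply: (le_trans (sv s t (ltW s0) st (le_trans td dT))).
    have := H s s0 (le_trans st td).
    have := v_mono sv (le_trans (ltW s0) st) td dT; lra.
  move=> s t s0 sd t0 td; have [st|/ltW ts] := lerP s t; last exact: G.
  by rewrite cabsC; exact: G.
have [|l Hl] := @complex_cauchy R (fun n => sigma (T / n.+1%:R)).
  move=> e e0; have [d d0 Hd] := close e e0.
  have [N HN] := exists_fine T0 d0; exists N => m n mN nN.
  have [_ h1] := HN m.+1 (leqW mN); have [_ h2] := HN n.+1 (leqW nN).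
  by apply: Hd; rewrite ?(ltW h1) ?(ltW h2) ?divr_gt0.
have lim_l (e : R) : 0 < e -> exists2 d : R, 0 < d & forall s : R, 0 < s -> s <= d ->
    cabs (sigma s - l) <= e.
  move=> e0; have e20 : 0 < e / 2 by rewrite divr_gt0.
  have [d d0 Hd] := close _ e20; exists d => // s s0 sd.
  have [N HN] := exists_fine T0 d0; have [N' HN'] := Hl _ e20.
  have [_ h1] := HN (maxn N N').+1 (leqW (leq_maxl _ _)); have h2 := HN' _ (leq_maxr N N').
  have -> : sigma s - l = (sigma s - sigma (T / (maxn N N').+1%:R)) +
    (sigma (T / (maxn N N').+1%:R) - l) by ring.
  apply: (le_trans (cabsD _ _)); rewrite (splitr e) lerD //.
  by apply: Hd; rewrite ?(ltW h1) ?divr_gt0.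
have -> : jump0 (sigma : R -> Cx R) = l - sigma 0.
  rewrite /jump0; congr (_ - _); apply: cvg_lim; first exact: (@norm_hausdorff (R[i]) (Cx R)).
  apply/cvgrPdist_le => /= e e0.
  have eE : e = (complex.Re e)%:C by case: e e0 => a b; rewrite ltcE /= => /andP[/eqP -> _].
  have {}e0 : 0 < complex.Re e by move: e0; rewrite eE ltcR.
  have [d d0 Hd] := lim_l _ e0.
  near=> x; rewrite eE cabsE lecR cabsC; apply: Hd.
    by near: x; exact: nbhs_right_gt.
  by near: x; exact: nbhs_right_le.
move=> e /lim_l[d d0 Hd]; exists d => // s s0 sd.
have -> : sigma s - sigma 0 - (l - sigma 0) = sigma s - l by ring.
exact: Hd.
Unshelve. all: by end_near. Qed.

Lemma rsint_is_RS (T : R) sigma y I : rsint T sigma y I ->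
  is_RS_integral T (y : R -> Cx R) (sigma : R -> Cx R) I.
Proof.
move=> H e e0; have [d d0 Hd] := H (e / 2) ltac:(by rewrite divr_gt0).
exists d => // s xi [ps /eqP ls] hs.
have P : tagged T d (size s) (nth 0 (0 :: s)) xi.
  split => //; first by rewrite -ls -nth_last; case: (s).
  move=> i i_s; have [h1 /andP[h2 h3]] := hs i i_s; split => //.
  by apply: ltW; move/(pathP 0): ps; apply.
have := Hd _ _ _ P; rewrite cabsE ltcR => h.
apply: le_lt_trans (_ : e / 2 < e); last by lra.
exact: h.
Qed.

Lemma is_RS_test (T d : R) : 0 < T -> 0 < d -> exists n, [/\ (0 < n)%N,
  itv_partition 0 T [seq unif T n i.+1 | i <- iota 0 n] &
  forall i, (i < n)%N -> unif T n i.+1 - unif T n i < d].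
Proof.
move=> T0 d0; have [N /(_ N (leqnn N)) [n0 HN]] := exists_fine T0 d0.
have [x0 xn Hx] := unif_tagged T0 n0 HN.
exists N; split => //; last by move=> i /Hx [].
have nth_i i : (i < N)%N -> nth 0 [seq unif T N i.+1 | i <- iota 0 N] i = unif T N i.+1.
  by move=> iN; rewrite (nth_map 0%N) ?size_iota // nth_iota.
split.
  apply/(pathP 0) => i; rewrite size_map size_iota => iN; rewrite nth_i //.
  have -> : nth 0 (0 :: [seq unif T N i.+1 | i <- iota 0 N]) i = unif T N i.
    by case: i iN => [|i] iN /=; rewrite ?x0 // nth_i // ltnW.
  rewrite /unif ltr_pM2l // ltr_pM2r ?invr_gt0 ?ltr0n // ltr_nat //.
have := nth_i N.-1; rewrite prednK // => E.
by rewrite -nth_last size_map size_iota E // xn.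
Qed.

(** Fine partitions exist, so integrals are unique and the chosen one is the limit of the tagged
sums. *)
Lemma U1_rsint (T : R) sigma v y : 0 < T ->
  (forall s t : R, 0 <= s -> s <= t -> t <= T -> cabs (sigma t - sigma s) <= v t - v s) ->
  contI T y -> rsint T sigma y (U1 T (sigma : R -> Cx R) y).
Proof.
move=> T0 sv yc; have [I HI] := rsint_exists T0 sv yc.
suff -> : U1 T (sigma : R -> Cx R) y = I by [].
have K1 := rsint_is_RS HI.
have K2 : is_RS_integral T (y : R -> Cx R) (sigma : R -> Cx R) (U1 T (sigma : R -> Cx R) y).
  by rewrite /U1 /RS_integral; apply: xgetPex; exists I.
apply/eqP; rewrite -subr_eq0; apply/eqP/cabs_le_small => e e0.
have e20 : 0 < e / 2 by rewrite divr_gt0.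
have [d1 d10 H1] := K1 _ e20; have [d2 d20 H2] := K2 _ e20.
have dd : 0 < Num.min d1 d2 by rewrite lt_min d10.
have [n [n0 ps Hn]] := is_RS_test T0 dd.
set s := [seq _ | _ <- _] in ps.
have ss : size s = n by rewrite /s size_map size_iota.
have nth_i i : (i < n)%N -> nth 0 s i = unif T n i.+1.
  by move=> iN; rewrite /s (nth_map 0%N) ?size_iota // nth_iota.
have tags i : (i < size s)%N -> [/\ nth 0 s i - nth 0 (0 :: s) i < Num.min d1 d2,
    nth 0 (0 :: s) i <= nth 0 s i & nth 0 s i <= nth 0 s i].
  rewrite ss => i_n; have := ps => -[/(pathP 0) h _].
  split => //; last by apply: ltW; apply: h; rewrite ss.
  rewrite nth_i //; have -> : nth 0 (0 :: s) i = unif T n i; last exact: Hn.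
  case: i i_n => [|i] i_n /=; last by rewrite nth_i // ltnW.
  by rewrite /unif mul0r mulr0.
have := H1 s (fun i => nth 0 s i) ps; rewrite cabsE ltcR => h1.
have := H2 s (fun i => nth 0 s i) ps; rewrite cabsE ltcR => h2.
have m1 : Num.min d1 d2 <= d1 by rewrite ge_min lexx.
have m2 : Num.min d1 d2 <= d2 by rewrite ge_min lexx orbT.
have {}h1 := h1 (fun i i_s => let: And3 a b c := tags i i_s in
  conj (lt_le_trans a m1) (introT andP (conj b c))).
have {}h2 := h2 (fun i i_s => let: And3 a b c := tags i i_s in
  conj (lt_le_trans a m2) (introT andP (conj b c))).
set S := RS_sum _ _ _ _ in h1 h2.
have -> : U1 T (sigma : R -> Cx R) y - I = (S - I) - (S - U1 T (sigma : R -> Cx R) y) by ring.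
apply: (le_trans (cabsB _ _)); lra.
Qed.

(** What point evaluations and integrals against a function of bounded variation have in common.
Only values on [0, T] count. *)
Record bounded_form (T : R) (U : (R -> C) -> C) (V : R) := BoundedForm {
  form_V : 0 <= V;
  form_lin : forall (c : C) y1 y2, contI T y1 -> contI T y2 ->
    U (fun t => c * y1 t + y2 t) = c * U y1 + U y2;
  form_ext : forall y1 y2, contI T y1 -> (forall t : R, 0 <= t -> t <= T -> y1 t = y2 t) ->
    U y1 = U y2;
  form_bound : forall y (M : R), contI T y -> 0 <= M ->
    (forall t : R, 0 <= t -> t <= T -> cabs (y t) <= M) -> cabs (U y) <= M * V }.

(** The only property of the integral, beyond boundedness, that enters the asymptotics: up to an
arbitrarily small multiple of the supremum norm, only [H * y 0] and the values of [y] away from 0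
count. *)
Record mass_functional (T : R) (U : (R -> C) -> C) (H : C) (V : R) := MassFunctional {
  mass_form : bounded_form T U V;
  mass_tail : forall eta : R, 0 < eta -> exists2 delta : R, 0 < delta &
    forall y (M m : R), contI T y -> 0 <= M -> 0 <= m ->
    (forall t : R, 0 <= t -> t <= T -> cabs (y t) <= M) ->
    (forall t : R, delta <= t -> t <= T -> cabs (y t) <= m) ->
    cabs (U y - H * y 0) <= M * eta + m * V }.

Lemma eval_form (T x : R) : 0 <= x -> x <= T -> bounded_form T (fun y => y x) 1.
Proof.
move=> x0 xT; split => //; first by move=> y1 y2 _; apply.
by move=> y M _ _ yM; rewrite mulr1; exact: yM.
Qed.

Lemma U1_mass (T : R) sigma : 0 < T -> complex_BV T sigma ->
  exists V, mass_functional T (U1 T (sigma : R -> Cx R)) (jump0 (sigma : R -> Cx R)) V.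
Proof.
move=> T0 /bv_majorant[v sv]; exists (v T - v 0).
have RI y (yc : contI T y) := U1_rsint T0 sv yc.
split; first split.
- exact: v_total sv.
- move=> c y1 y2 c1 c2; apply: (rsint_uniq T0 sv).
    by apply: RI; apply: contID => //; apply: contIZ => //; exact: ltW.
  by apply: rsintD; exact: RI.
- move=> y1 y2 c1 e; apply: (rsint_uniq T0 sv (RI _ c1)).
  by apply: rsint_ext (RI y2 (contI_ext e c1)) => t t0 tT; rewrite e.
- by move=> y M yc M0 yM; exact: (rsint_bound T0 sv M0 yM (RI y yc)).
move=> eta eta0; have [delta [d0 dT H]] := small_variation T0 eta0 sv.
exists delta => // y M m yc M0 m0 yM ym.
exact: (rsint_tail T0 sv M0 m0 d0 dT yM ym H (jump0_limit T0 sv) (RI y yc)).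
Qed.

Lemma contI_min (T a : R) y : 0 <= a -> a <= T -> contI T y -> contI T (fun t => y (Num.min t a)).
Proof.
move=> a0 aT yc x x0 xT e e0.
have [||d d0 Hd] := yc (Num.min x a) _ _ e e0.
- by rewrite le_min x0 a0.
- by rewrite ge_min xT.
exists d => // t t0 tT td; apply: Hd; rewrite ?le_min ?ge_min ?t0 ?tT ?a0 //.
apply: le_trans td; rewrite !ler_norml.
have := ler_norm (t - x); have := ler_norm (x - t); rewrite distrC.
by case: (lerP t a) => h1; case: (lerP x a) => h2 h3 h4; apply/andP; split; lra.
Qed.

(** Freezing the argument beyond [a] changes nothing near 0, so the frozen form has the same mass
and the same asymptotics apply to it. *)
Lemma mass_cut (T a : R) U (H : C) (V : R) : 0 < a -> a <= T -> mass_functional T U H V ->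
  mass_functional T (fun y => U (fun t => y (Num.min t a))) H V.
Proof.
move=> a0 aT mf; have a0' := ltW a0; have bf := mass_form mf; split; first split.
- exact: form_V bf.
- by move=> c y1 y2 c1 c2; rewrite -(form_lin bf) //; exact: contI_min.
- move=> y1 y2 c1 e; apply: (form_ext bf); first exact: contI_min.
  by move=> t t0 tT; rewrite e // ?le_min ?ge_min ?t0 ?tT ?a0'.
- move=> y M yc M0 yM; apply: (form_bound bf) => //; first exact: contI_min.
  by move=> t t0 tT; apply: yM; rewrite ?le_min ?ge_min ?t0 ?tT ?a0'.
move=> eta eta0; have [delta d0 Hd] := mass_tail mf eta0.
exists (Num.min delta a); first by rewrite lt_min d0.
move=> y M m yc M0 m0 yM ym.
rewrite -[y 0](_ : y (Num.min 0 a) = y 0); last by rewrite min_l.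
apply: (Hd (fun t => y (Num.min t a))) => //; first exact: contI_min.
  by move=> t t0 tT; apply: yM; rewrite ?le_min ?ge_min ?t0 ?tT ?a0'.
move=> t dt tT; apply: ym; last by rewrite ge_min tT.
by rewrite le_min !ge_min dt lexx !orbT.
Qed.

End MassFunctional.

(** * Solutions of the differential equation *)

Section Solutions.
Variable R : realType.
Local Notation C := (R[i]).
Local Notation mu := (@lebesgue_measure R).
Implicit Types (y z dy dz w : R -> C) (q : R -> C) (lam kappa : C) (T : R).

(** Second-order differentiability in the sense of Caratheodory. The second derivative is a
parameter, since Lagrange's identity is applied to pairs solving different equations. *)
Definition twice_ac T y dy (ddy : R -> C) := [/\ forall x, 0 <= x -> x <= T -> isd T y x (dy x),
  ac T dy & exists2 E, mu.-negligible E & forall x, ~ E x -> 0 < x -> x < T -> isd T dy x (ddy x)].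

Definition solves T q lam y dy := twice_ac T y dy (fun x => (q x - lam) * y x).

(** The limit that defines the derivative is the chosen one because the punctured point is an
accumulation point of [0, T]. *)
Lemma derivable_isd T y x : 0 < T -> 0 <= x -> x <= T ->
  derivable_in T (y : R -> Cx R) x -> isd T y x (deriv_in T (y : R -> Cx R) x).
Proof.
move=> T0 x0 xT; rewrite /derivable_in /deriv_in => /cvg_ex[/= l hl].
have H : isd T y x l.
  move=> e e0.
  move/cvgrPdist_le: hl => /(_ e%:C); rewrite ltcR => /(_ e0).
  move=> /nbhs_ballP[d /= d0 Hd].
  exists (d / 2); first by rewrite divr_gt0.
  move=> t t0 tT td; have [->|tx] := eqVneq t x.
    by rewrite !subrr mul0r subr0 cabs0 normr0 mulr0.
  have tx0 : 0 < `|t - x| by rewrite normr_gt0 subr_eq0.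
  have := Hd t; rewrite /ball /= distrC => /(_ ltac:(lra) tx).
  rewrite in_itv /= t0 tT => /(_ isT); rewrite cabsE lecR => h.
  apply: le_trans (ler_wpM2r (normr_ge0 (t - x)) h).
  rewrite -(cabs_real (t - x)) -cabsM /quotient_at.
  have txn : (t - x)%:C != 0 :> C by rewrite -cabs_gt0 cabs_real.
  have -> : ((t - x)^-1)%:C = ((t - x)%:C)^-1 :> C by rewrite fmorphV.
  move: (t - x)%:C txn => k kn.
  have -> : y t - y x - k * l = - ((l - k^-1 * (y t - y x)) * k) by field.
  by rewrite cabsN.
have FF : ProperFilter (within `[0, T] x^').
  apply: Build_ProperFilter_ex => P /nbhs_ballP[d /= d0 Hd].
  pose r := Num.min (d / 2) (T / 2).
  have r0 : 0 < r by rewrite lt_min !divr_gt0.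
  have [rd rT] : r <= d / 2 /\ r <= T / 2 by rewrite /r !ge_min !lexx orbT.
  have [t [t0 tT tx]] : exists t, [/\ 0 <= t, t <= T & `|t - x| = r].
    have [h|h] := lerP x (T / 2).
      by exists (x + r); rewrite (_ : x + r - x = r) ?gtr0_norm; first split; lra.
    by exists (x - r); rewrite (_ : x - r - x = - r) ?normrN ?gtr0_norm; first split; lra.
  exists t; apply: (Hd t); rewrite ?in_itv /= ?t0 ?tT //.
    by rewrite /ball /= distrC tx; lra.
  by rewrite -subr_eq0 -normr_gt0 tx.
suff -> : lim (quotient_at (y : R -> Cx R) x t @[t --> within `[0, T] x^']) = l by [].
by apply: cvg_lim hl; exact: (@norm_hausdorff (R[i]) (Cx R)).
Qed.

Lemma negligible_U1 (E : set R) (a : R) : mu.-negligible E -> mu.-negligible (E `|` [set a]).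
Proof.
move=> nE; apply: negligibleU => //; exists [set a]; split => //.
exact: lebesgue_measure_set1.
Qed.

Lemma solution_solves T q lam (y : R -> Cx R) : 0 < T -> is_solution T q lam y ->
  solves T q lam y (deriv_in T y).
Proof.
move=> T0 [y1 y2 [E [mE E0 HE]]]; split.
- by move=> x x0 xT; apply: derivable_isd => //; apply: y1; rewrite in_itv /= x0.
- exact: abs_continuousP.
exists E; first by exists E; split.
move=> x nE x0 xT; apply: contrapT => H; apply: nE; apply: HE => /= K; apply: H.
have xI : x \in `]0, T[ by rewrite in_itv /= x0.
have [K1 K2] := K xI.
have -> : (q x - lam) * y x = deriv_in T (deriv_in T y) x.
  by rewrite mulrBl -K2; ring.
by apply: derivable_isd => //; exact: ltW.
Qed.

Lemma twice_ac_lin T (c : C) y dy ddy z dz ddz : 0 < T -> twice_ac T y dy ddy -> twice_ac T z dz ddz ->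
  twice_ac T (fun t => c * y t + z t) (fun t => c * dy t + dz t) (fun t => c * ddy t + ddz t).
Proof.
move=> T0 [y1 y2 [E nE y3]] [z1 z2 [F nF z3]]; split.
- by move=> x x0 xT; apply: isdD; [apply: isdZ; exact: y1|exact: z1].
- apply: acD => //; apply: acM => //; first exact: ltW.
  by apply: (@ac_lip _ _ _ 0) => a b _ _ _; rewrite subrr cabs0 mul0r.
exists (E `|` F); first exact: negligibleU.
move=> x nEF x0 xT; apply: isdD.
  by apply: isdZ; apply: y3 => //; apply: contra_not nEF; left.
by apply: z3 => //; apply: contra_not nEF; right.
Qed.

Lemma twice_ac_ext T y dy ddy ddy' : (forall x, ddy x = ddy' x) -> twice_ac T y dy ddy -> twice_ac T y dy ddy'.
Proof.
move=> e [y1 y2 [E nE y3]]; split => //; exists E => // x nx x0 xT.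
by rewrite -e; exact: y3.
Qed.

Lemma solves_lin T q lam (c : C) y dy z dz : 0 < T -> solves T q lam y dy -> solves T q lam z dz ->
  solves T q lam (fun t => c * y t + z t) (fun t => c * dy t + dz t).
Proof.
move=> T0 H1 H2; apply: twice_ac_ext (twice_ac_lin c T0 H1 H2) => x; ring.
Qed.

Lemma solves0 T q lam : solves T q lam (fun=> 0) (fun=> 0).
Proof.
split; first by move=> x _ _; exact: isd_cst.
  by apply: (@ac_lip _ _ _ 0) => a b _ _ _; rewrite subrr cabs0 mul0r.
exists set0; first exact: negligible_set0.
by move=> x _ _ _; rewrite mulr0; exact: isd_cst.
Qed.

Lemma solves_comb T q lam (c d : C) y dy z dz : 0 < T -> solves T q lam y dy ->
  solves T q lam z dz ->
  solves T q lam (fun t => c * y t + d * z t) (fun t => c * dy t + d * dz t).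
Proof.
move=> T0 Y Z; apply: solves_lin => //.
have H := solves_lin d T0 Z (solves0 T q lam).
have E (f : R -> C) : (fun t => d * f t) = (fun t => d * f t + 0).
  by apply/funext => t; rewrite addr0.
by rewrite !E.
Qed.

Lemma solves_cont T q lam y dy : solves T q lam y dy -> contI T y.
Proof. by move=> [y1 _ _]; exact: isd_cont y1. Qed.

Lemma twice_ac_wronskian T y dy ddy z dz ddz : 0 < T -> twice_ac T y dy ddy -> twice_ac T z dz ddz ->
  ac T (fun t => dy t * z t - y t * dz t) /\
  exists2 E, mu.-negligible E & forall x, ~ E x -> 0 < x -> x < T ->
    isd T (fun t => dy t * z t - y t * dz t) x (ddy x * z x - y x * ddz x).
Proof.
move=> T0 [y1 y2 [E nE y3]] [z1 z2 [F nF z3]]; have T0' := ltW T0.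
have ya : ac T y by apply: ac_isd y1 (ac_cont y2).
have za : ac T z by apply: ac_isd z1 (ac_cont z2).
split; first by apply: acB; exact: acM.
exists (E `|` F); first exact: negligibleU.
move=> x nEF x0 xT.
have Y := y3 x ltac:(by apply: contra_not nEF; left) x0 xT.
have Z := z3 x ltac:(by apply: contra_not nEF; right) x0 xT.
have -> : ddy x * z x - y x * ddz x = (ddy x * z x + dy x * dz x) - (dy x * dz x + y x * ddz x) by ring.
by apply: isdB; apply: isdM => //; [apply: z1|apply: y1]; exact: ltW.
Qed.

(** The bad points are those where [w] lacks the derivative [l], those where [Q] fails to
majorize, and the end points. *)
Lemma ac_bound T w (l : R -> C) (q : R -> C) (Q : R -> R) (E F : set R) (K a b : R) :
  0 < T -> 0 <= K -> ac T w -> mu.-negligible E -> mu.-negligible F ->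
  (forall x, ~ E x -> 0 < x -> x < T -> isd T w x (l x)) ->
  (forall u v : R, u <= v -> Q u <= Q v) ->
  (forall x, ~ F x -> 0 < x -> x < T -> forall e : R, 0 < e -> exists2 d : R, 0 < d &
    forall t, `|t - x| <= d -> cabs (q x) * `|t - x| <= `|Q t - Q x| + e * `|t - x|) ->
  0 <= a -> a <= b -> b <= T ->
  (forall x, a <= x -> x <= b -> cabs (l x) <= K * cabs (q x)) ->
  cabs (w b - w a) <= K * (Q b - Q a).
Proof.
move=> T0 K0 wa nE nF HE Qm HF a0 ab bT lK; rewrite mulrBr.
apply: (@gauge_bound R T w (fun t => K * Q t) (((E `|` F) `|` [set 0]) `|` [set T]) a b) => //.
- by do 2 apply: negligible_U1; exact: negligibleU.
- by move=> u v _ uv _; apply: ler_wpM2l => //; exact: Qm.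
move=> x ax xb nx e e0.
have nE' : ~ E x by apply: contra_not nx => ?; do 3 left.
have nF' : ~ F x by apply: contra_not nx => ?; do 2 left; right.
have x0 : 0 < x.
  rewrite lt_neqAle (le_trans a0 ax) andbT; apply/eqP => h; apply: nx; left; right.
  by rewrite /= h.
have xT : x < T.
  by rewrite lt_neqAle (le_trans xb bT) andbT; apply/eqP => h; apply: nx; right.
have e1 : 0 < e / (K + 1) by rewrite divr_gt0 //; lra.
have e2 : 0 < e / (K + 1) by [].
have [d d0 Hd] := HE x nE' x0 xT _ e1.
have [d' d'0 Hd'] := HF x nF' x0 xT _ e2.
exists (Num.min d d'); first by rewrite lt_min d0.
move=> t t0 tT; rewrite le_min => /andP[td td'].
have -> : w t - w x = (w t - w x - (t - x)%:C * l x) + (t - x)%:C * l x by ring.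
apply: (le_trans (cabsD _ _)).
rewrite cabsM cabs_real -mulrBr normrM (ger0_norm K0).
have h1 := Hd t t0 tT td.
have h2 := ler_wpM2l K0 (Hd' t td').
have h3 : `|t - x| * cabs (l x) <= K * (cabs (q x) * `|t - x|).
  rewrite mulrC mulrA; apply: ler_wpM2r => //; exact: lK.
have E3 : e = e / (K + 1) + K * (e / (K + 1)) by field; rewrite gt_eqF //; lra.
rewrite {1}E3; lra.
Qed.

Lemma ac_const T w (E : set R) (a b : R) : 0 < T -> ac T w -> mu.-negligible E ->
  (forall x, ~ E x -> 0 < x -> x < T -> isd T w x 0) -> 0 <= a -> a <= b -> b <= T -> w b = w a.
Proof.
move=> T0 wa nE HE a0 ab bT; apply/eqP; rewrite -subr_eq0 -cabs_eq0 eq_le cabs_ge0 andbT.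
have := @ac_bound T w (fun=> 0) (fun=> 0) (fun=> 0) E set0 0 a b T0 (lexx 0) wa nE (negligible_set0 _) HE.
rewrite subrr mulr0; apply => //.
- move=> x _ _ _ e e0; exists 1 => // t _; rewrite (cabs0 R : cabs ((fun=> 0 : C) x) = 0) mul0r addr_ge0 //.
  by rewrite mulr_ge0 // ltW.
- by move=> x _ _; rewrite cabs0 mul0r.
Qed.

Lemma wronskian_const T q lam y dy z dz : 0 < T -> solves T q lam y dy -> solves T q lam z dz ->
  forall x, 0 <= x -> x <= T -> dy x * z x - y x * dz x = dy 0 * z 0 - y 0 * dz 0.
Proof.
move=> T0 Y Z x x0 xT; have [wa [E nE HE]] := twice_ac_wronskian T0 Y Z.
apply: (@ac_const T _ E 0 x T0 wa nE) => // t nt t0 tT.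
by rewrite (_ : 0 = (q t - lam) * y t * z t - y t * ((q t - lam) * z t)); [exact: HE|ring].
Qed.

Lemma wronskian_constT T q lam y dy z dz : 0 < T -> solves T q lam y dy -> solves T q lam z dz ->
  forall x, 0 <= x -> x <= T -> dy x * z x - y x * dz x = dy T * z T - y T * dz T.
Proof.
move=> T0 Y Z x x0 xT; rewrite (wronskian_const T0 Y Z x0 xT).
by rewrite (wronskian_const T0 Y Z (ltW T0)).
Qed.

Definition ch kappa (t : R) : C := (cexp (t%:C * kappa) + cexp (t%:C * - kappa)) / 2.
Definition sh kappa (t : R) : C := (cexp (t%:C * kappa) - cexp (t%:C * - kappa)) / 2.

Lemma ch0 kappa : ch kappa 0 = 1.
Proof. by rewrite /ch !mul0r cexp0; field. Qed.

Lemma sh0 kappa : sh kappa 0 = 0.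
Proof. by rewrite /sh !mul0r cexp0 subrr mul0r. Qed.

Lemma cabs_cexp_le kappa (t : R) : 0 <= complex.Re kappa ->
  cabs (cexp (t%:C * kappa)) <= expR (complex.Re kappa * `|t|) /\
  cabs (cexp (t%:C * - kappa)) <= expR (complex.Re kappa * `|t|).
Proof.
rewrite !cabs_cexp; case: kappa => a b /= a0; rewrite !mul0r !subr0 !ler_expR ?mulrN.
have := ler_norm t; have := ler_norm (- t); rewrite normrN => h1 h2.
have := ler_wpM2l a0 h1; have := ler_wpM2l a0 h2; lra.
Qed.

Lemma cabs2 (z : C) : cabs (z / 2) = cabs z / 2.
Proof.
have -> : (2 : C) = (2 : R)%:C by rewrite rmorph_nat.
by rewrite cabsM cabsV cabs_real ger0_norm.
Qed.

Lemma ch_bound kappa t : 0 <= complex.Re kappa -> cabs (ch kappa t) <= expR (complex.Re kappa * `|t|).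
Proof.
move=> k0; have [h1 h2] := cabs_cexp_le t k0; rewrite /ch cabs2.
have := cabsD (cexp (t%:C * kappa)) (cexp (t%:C * - kappa)); lra.
Qed.

Lemma sh_bound kappa t : 0 <= complex.Re kappa -> cabs (sh kappa t) <= expR (complex.Re kappa * `|t|).
Proof.
move=> k0; have [h1 h2] := cabs_cexp_le t k0; rewrite /sh cabs2.
have := cabsB (cexp (t%:C * kappa)) (cexp (t%:C * - kappa)); lra.
Qed.

Lemma isd_cexp_affine T kappa (s x : R) :
  isd T (fun t => cexp ((s - t)%:C * kappa)) x (- kappa * cexp ((s - x)%:C * kappa)).
Proof.
have H := isdZ (cexp (s%:C * kappa)) (isd_cexp T (- kappa) x).
have E t : cexp (s%:C * kappa) * cexp (t%:C * - kappa) = cexp ((s - t)%:C * kappa).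
  by rewrite -cexpD; congr cexp; rewrite rmorphB; ring.
rewrite mulrCA E in H => e e0; have [d d0 Hd] := H e e0.
by exists d => // t t0 tT td; have := Hd t t0 tT td; rewrite !E.
Qed.

Lemma isd_sh T kappa (s x : R) : isd T (fun t => sh kappa (s - t)) x (- kappa * ch kappa (s - x)).
Proof.
have := isdZ (2^-1) (isdB (isd_cexp_affine T kappa s x) (isd_cexp_affine T (- kappa) s x)).
rewrite (_ : 2^-1 * _ = - kappa * ch kappa (s - x)); last by rewrite /ch; ring.
move=> H e e0; have [d d0 Hd] := H e e0; exists d => // t t0 tT td; have := Hd t t0 tT td.
by rewrite /sh ![2^-1 * _]mulrC.
Qed.

Lemma isd_ch T kappa (s x : R) : isd T (fun t => ch kappa (s - t)) x (- kappa * sh kappa (s - x)).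
Proof.
have := isdZ (2^-1) (isdD (isd_cexp_affine T kappa s x) (isd_cexp_affine T (- kappa) s x)).
rewrite (_ : 2^-1 * _ = - kappa * sh kappa (s - x)); last by rewrite /sh; ring.
move=> H e e0; have [d d0 Hd] := H e e0; exists d => // t t0 tT td; have := Hd t t0 tT td.
by rewrite /ch ![2^-1 * _]mulrC.
Qed.

(** The kernel of Lagrange's identity for the equation with potential zero. *)
Lemma sh_twice_ac T kappa (s : R) : 0 < T -> twice_ac T (fun t => sh kappa (s - t))
  (fun t => - kappa * ch kappa (s - t)) (fun t => kappa ^+ 2 * sh kappa (s - t)).
Proof.
move=> T0; have T0' := ltW T0.
have D x : isd T (fun t => - kappa * ch kappa (s - t)) x (kappa ^+ 2 * sh kappa (s - x)).
  have := isdZ (- kappa) (isd_ch T kappa s x).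
  by rewrite (_ : - kappa * (- kappa * _) = kappa ^+ 2 * sh kappa (s - x)); last by ring.
split.
- by move=> x _ _; exact: isd_sh.
- apply: (@ac_isd R T _ (fun x => kappa ^+ 2 * sh kappa (s - x))) => // x.
  apply: contIZ => //; apply: isd_cont => y _ _; exact: isd_sh.
exists set0; first exact: negligible_set0.
by move=> x _ _ _.
Qed.

(** Apply the improvement to the supremum, which is finite by the a priori bound [M], and solve
for it. *)
Lemma absorb_half (T : R) (g : R -> R) (b M : R) : 0 <= T ->
  (forall t, 0 <= t -> t <= T -> g t <= M) ->
  (forall m, (forall t, 0 <= t -> t <= T -> g t <= m) ->
     forall t, 0 <= t -> t <= T -> g t <= b + m / 2) ->
  forall t, 0 <= t -> t <= T -> g t <= 2 * b.
Proof.
move=> T0 gM step.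
pose S := [set g t | t in [set t | 0 <= t /\ t <= T]].
have hS : has_sup S.
  split; first by exists (g 0), 0.
  by exists M => _ [t [t0 tT] <-]; exact: gM.
have [S0 Sb] := hS.
have gs t : 0 <= t -> t <= T -> g t <= sup S.
  by move=> t0 tT; apply: (ub_le_sup Sb); exists t.
have h := step _ gs.
have s2 : sup S <= b + sup S / 2 by apply: ge_sup => // _ [t [t0 tT] <-]; exact: h.
by move=> t t0 tT; have := gs t t0 tT; lra.
Qed.

Lemma between_dist (T r x t : R) : 0 <= r -> r <= T -> 0 <= x -> x <= T ->
  Num.min r x <= t -> t <= Num.max r x ->
  [/\ 0 <= t, t <= T & `|t - x| + `|r - t| = `|r - x| ].
Proof.
move=> r0 rT x0 xT; case: (lerP r x) => h t1 t2.
  by split; [lra|lra|rewrite [`|t - x|]ler0_norm ?[`|r - t|]ler0_norm; lra].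
by split; [lra|lra|rewrite [`|t - x|]ger0_norm ?[`|r - t|]ger0_norm; lra].
Qed.

(** Every solution stays close to the solution with potential zero and the same data at [x0].
Lagrange's identity with the kernel [sh kappa (s - t)] expresses the difference by the integral of
[q] times the solution times the kernel, whose exponentials multiply to that of the distance [|s -
x0|]; the factor [1 / kappa] makes this a contraction for large [kappa]. *)
Lemma solution_estimate T q : 0 < T -> L1_potential T q -> exists2 N : R, 0 < N &
  forall kappa y dy x0, 0 <= complex.Re kappa -> 2 * N <= cabs kappa ->
    0 <= x0 -> x0 <= T -> solves T q (- kappa ^+ 2) y dy ->
    forall s, 0 <= s -> s <= T ->
    let m0 := cabs (y x0) + cabs (dy x0) / cabs kappa in
    cabs (y s) <= 2 * m0 * expR (complex.Re kappa * `|s - x0|) /\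
    cabs (y s - (ch kappa (s - x0) * y x0 + sh kappa (s - x0) * dy x0 / kappa)) <=
      2 * m0 * (N / cabs kappa) * expR (complex.Re kappa * `|s - x0|).
Proof.
move=> T0 /(L1_majorant T0)[Q [F [nF Qm HF]]].
have QT : Q 0 <= Q T by apply: Qm; exact: ltW.
exists (Q T - Q 0 + 1); first lra.
set N := Q T - Q 0 + 1 => kappa y dy x0 k0 kN x00 x0T Y s s0 sT m0.
have N0 : 1 <= N by rewrite /N; lra.
have K0 : 0 < cabs kappa by lra.
have kn : kappa != 0 by rewrite -cabs_gt0.
pose tau := complex.Re kappa; rewrite -/tau.
pose y0 s := ch kappa (s - x0) * y x0 + sh kappa (s - x0) * dy x0 / kappa.
have y0b r : cabs (y0 r) <= m0 * expR (tau * `|r - x0|).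
  rewrite /y0 /m0 mulrDl; apply: (le_trans (cabsD _ _)).
  rewrite (cabsM (ch kappa _)) (cabsM (sh kappa _ * _)) (cabsM (sh kappa _)) cabsV.
  have h1 := ch_bound (r - x0) k0; have h2 := sh_bound (r - x0) k0.
  apply: lerD; first by rewrite mulrC; apply: ler_wpM2l; [exact: cabs_ge0|exact: h1].
  rewrite -mulrA mulrC; apply: ler_wpM2l; last exact: h2.
  by rewrite divr_ge0 ?cabs_ge0.
have main (m : R) : 0 <= m -> (forall t, 0 <= t -> t <= T -> cabs (y t) <= m * expR (tau * `|t - x0|)) ->
  forall r, 0 <= r -> r <= T -> cabs (y r - y0 r) <= m * (N / cabs kappa) * expR (tau * `|r - x0|).
  move=> mm Hm r r0 rT.
  have [wa [E nE HE]] := twice_ac_wronskian T0 Y (@sh_twice_ac T kappa r T0).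
  pose w t := dy t * sh kappa (r - t) - y t * (- kappa * ch kappa (r - t)).
  have w1 : w r = kappa * y r by rewrite /w subrr sh0 ch0; ring.
  have w2 : w x0 = kappa * y0 r.
    rewrite /w /y0; field; exact: kn.
  pose K := m * expR (tau * `|r - x0|).
  have K0' : 0 <= K by rewrite mulr_ge0 ?expR_ge0.
  have lK t : Num.min r x0 <= t -> t <= Num.max r x0 ->
      cabs ((q t - - kappa ^+ 2) * y t * sh kappa (r - t) - y t * (kappa ^+ 2 * sh kappa (r - t)))
       <= K * cabs (q t).
    move=> t1 t2; have [t0 tT tE] := between_dist r0 rT x00 x0T t1 t2.
    have -> : (q t - - kappa ^+ 2) * y t * sh kappa (r - t) - y t * (kappa ^+ 2 * sh kappa (r - t))
      = q t * (y t * sh kappa (r - t)) by ring.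
    rewrite (cabsM (q t)) (cabsM (y t)) mulrC ler_wpM2r ?cabs_ge0 //.
    apply: (@le_trans _ _ (m * expR (tau * `|t - x0|) * expR (tau * `|r - t|))).
      by apply: ler_pM; rewrite ?cabs_ge0 ?Hm //; exact: sh_bound.
    by rewrite -mulrA -expRD /K -mulrDr tE.
  have wb : cabs (w r - w x0) <= K * N.
    have QN a b : 0 <= a -> b <= T -> K * (Q b - Q a) <= K * N.
      move=> a0 bT; apply: ler_wpM2l => //.
      have := Qm _ _ a0; have := Qm _ _ bT; rewrite /N; lra.
    have [h|h] := lerP r x0.
      rewrite cabsC; apply: le_trans (QN r x0 r0 x0T).
      apply: (@ac_bound T w _ q Q E F K r x0 T0 K0' wa nE nF HE Qm HF) => // t t1 t2.
      by apply: lK; rewrite ?ge_min ?le_max ?t1 ?t2 ?orbT.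
    apply: le_trans (QN x0 r x00 rT).
    apply: (@ac_bound T w _ q Q E F K x0 r T0 K0' wa nE nF HE Qm HF) => // [|t t1 t2]; first exact: ltW.
    by apply: lK; rewrite ?ge_min ?le_max ?t1 ?t2 ?orbT.
  rewrite w1 w2 -mulrBr cabsM mulrC -ler_pdivlMr // in wb.
  by apply: (le_trans wb); rewrite /K le_eqVlt; apply/orP; left; apply/eqP; field; rewrite gt_eqF.
have m00 : 0 <= m0 by rewrite addr_ge0 ?divr_ge0 ?cabs_ge0.
have yb : forall t, 0 <= t -> t <= T -> cabs (y t) <= (2 * m0) * expR (tau * `|t - x0|).
  have [M M0 HM] := contI_bounded (ltW T0) (solves_cont Y).
  have n2 : N / cabs kappa <= 1 / 2 by rewrite ler_pdivrMr //; lra.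
  have ex0 t : 0 < expR (tau * `|t - x0|) by exact: expR_gt0.
  have ex1 t : 1 <= expR (tau * `|t - x0|) by rewrite -expR0 ler_expR mulr_ge0.
  suff H : forall t, 0 <= t -> t <= T -> cabs (y t) / expR (tau * `|t - x0|) <= 2 * m0.
    by move=> t t0 tT; rewrite -ler_pdivrMr //; exact: H.
  apply: (@absorb_half T _ m0 M (ltW T0)) => [t t0 tT|m Hm t t0 tT].
    by rewrite ler_pdivrMr //; have := HM t t0 tT; have := ler_wpM2l M0 (ex1 t); lra.
  have mm : 0 <= m by apply: le_trans (Hm 0 (lexx _) (ltW T0)); rewrite divr_ge0 ?cabs_ge0 // ltW.
  have Hm' r : 0 <= r -> r <= T -> cabs (y r) <= m * expR (tau * `|r - x0|).
    by move=> r0 rT; rewrite -ler_pdivrMr //; exact: Hm.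
  have h2 := main m mm Hm' t t0 tT; have h1 := y0b t.
  have tri : cabs (y t) <= cabs (y t - y0 t) + cabs (y0 t).
    by rewrite -{1}(subrK (y0 t) (y t)) cabsD.
  have e0 := ltW (ex0 t); rewrite ler_pdivrMr //; set ex := expR _ in h1 h2 e0 *.
  have h3 : m * (N / cabs kappa) * ex <= m * (1 / 2) * ex by rewrite ler_wpM2r // ler_wpM2l.
  lra.
by split; [exact: yb|apply: main => //; rewrite mulr_ge0].
Qed.

End Solutions.

(** * Dependence on the spectral parameter *)

Section SpectralParameter.
Variable R : realType.
Local Notation C := (R[i]).
Implicit Types (f g y z : R -> C) (q : R -> C) (lam kappa mu : C) (T : R).

(** The primitive vanishing at [T]. *)
Definition prim T f : R -> C := xget (fun=> 0)
  [set F | (forall x, 0 <= x -> x <= T -> isd T F x (f x)) /\ F T = 0].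

Lemma primP T f : 0 < T -> contI T f ->
  (forall x, 0 <= x -> x <= T -> isd T (prim T f) x (f x)) /\ prim T f T = 0.
Proof.
move=> T0 fc; have [F HF] := primitive T0 fc.
apply: (@xgetPex _ (fun=> 0 : C) [set F | (forall x, 0 <= x -> x <= T -> isd T F x (f x)) /\ F T = 0]).
exists (fun x => F x - F T); split; last by rewrite subrr.
move=> x x0 xT; rewrite -[f x]subr0; apply: isdB; [exact: HF|exact: isd_cst].
Qed.

Lemma prim_lin T (c : C) f g h : 0 < T -> contI T f -> contI T g ->
  (forall x, 0 <= x -> x <= T -> h x = c * f x + g x) ->
  forall x, 0 <= x -> x <= T -> prim T h x = c * prim T f x + prim T g x.
Proof.
move=> T0 fc gc hE x x0 xT; have T0' := ltW T0.
have hc : contI T h.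
  apply: (@contI_ext _ T (fun x => c * f x + g x)); first by move=> t t0 tT; rewrite hE.
  by apply: contID => //; exact: contIZ.
have [f1 f2] := primP T0 fc; have [g1 g2] := primP T0 gc; have [h1 h2] := primP T0 hc.
pose k t := prim T h t - (c * prim T f t + prim T g t).
suff : k x = 0 by rewrite /k => /eqP; rewrite subr_eq0 => /eqP.
have kT : k T = 0 by rewrite /k f2 g2 h2; ring.
rewrite -kT; apply/esym; apply: (@isd0_cst R T k x T x0 xT (lexx T)) => t xt tT.
have t0 : 0 <= t by exact: le_trans xt.
have -> : 0 = h t - (c * f t + g t) by rewrite hE // subrr.
by apply: isdB; [exact: h1|apply: isdD; [apply: isdZ; exact: f1|exact: g1]].
Qed.

Lemma prim_bound T f (M : R) : 0 < T -> contI T f ->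
  (forall x, 0 <= x -> x <= T -> cabs (f x) <= M) ->
  forall x, 0 <= x -> x <= T -> cabs (prim T f x) <= M * T.
Proof.
move=> T0 fc fM x x0 xT; have [f1 f2] := primP T0 fc.
have M0 : 0 <= M by apply: le_trans (fM x x0 xT); exact: cabs_ge0.
rewrite -[prim T f x]subr0 -f2 cabsC.
apply: (@le_trans _ _ (M * (T - x))); last by rewrite ler_wpM2l // lerBlDr lerDl.
apply: (@mvt_isd R T (prim T f) f) => // t xt tT; [apply: f1|apply: fM] => //; exact: le_trans xt.
Qed.

Lemma prim_cont T f : 0 < T -> contI T f -> contI T (prim T f).
Proof. by move=> T0 fc; have [f1 _] := primP T0 fc; exact: isd_cont f1. Qed.

(** The Green operator at [T] of the equation with fundamental system [y1], [y2]. *)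
Definition green T (y1 y2 : R -> C) f x : C :=
  y1 x * prim T (fun t => f t * y2 t) x - y2 x * prim T (fun t => f t * y1 t) x.

Section Green.
Variables (T : R) (y1 y2 : R -> C).
Hypothesis T0 : 0 < T.
Hypothesis y1c : contI T y1.
Hypothesis y2c : contI T y2.
Let T0' := ltW T0.

Lemma green_cont f : contI T f -> contI T (green T y1 y2 f).
Proof.
move=> fc; apply: contID.
  by apply: contIM => //; apply: prim_cont => //; exact: contIM.
by apply: contIN => //; apply: contIM => //; apply: prim_cont => //; exact: contIM.
Qed.

Lemma green_lin (c : C) f g h : contI T f -> contI T g ->
  (forall x, 0 <= x -> x <= T -> h x = c * f x + g x) ->
  forall x, 0 <= x -> x <= T -> green T y1 y2 h x = c * green T y1 y2 f x + green T y1 y2 g x.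
Proof.
move=> fc gc hE x x0 xT; rewrite /green.
have E (k : R -> C) (kc : contI T k) : prim T (fun t => h t * k t) x =
    c * prim T (fun t => f t * k t) x + prim T (fun t => g t * k t) x.
  apply: prim_lin => //; try exact: contIM.
  by move=> t t0 tT; rewrite hE //; ring.
rewrite !E //; ring.
Qed.

Lemma green_bound : exists2 K : R, 0 <= K & forall f (M : R), contI T f -> 0 <= M ->
  (forall x, 0 <= x -> x <= T -> cabs (f x) <= M) ->
  forall x, 0 <= x -> x <= T -> cabs (green T y1 y2 f x) <= K * M.
Proof.
have [M1 M10 H1] := contI_bounded T0' y1c; have [M2 M20 H2] := contI_bounded T0' y2c.
exists (2 * (M1 * M2 * T)); first by rewrite !mulr_ge0.
move=> f M fc M0 fM x x0 xT; rewrite /green; apply: (le_trans (cabsB _ _)); rewrite !cabsM.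
have P (k : R -> C) (N : R) : contI T k -> 0 <= N -> (forall t, 0 <= t -> t <= T -> cabs (k t) <= N) ->
    cabs (prim T (fun t => f t * k t) x) <= M * N * T.
  move=> kc N0 kN; apply: prim_bound => //; first exact: contIM.
  by move=> t t0 tT; rewrite cabsM; apply: ler_pM; rewrite ?cabs_ge0 ?fM ?kN.
have a1 : cabs (y1 x) * cabs (prim T (fun t => f t * y2 t) x) <= M1 * (M * M2 * T).
  by apply: ler_pM; rewrite ?cabs_ge0 ?H1 // P.
have a2 : cabs (y2 x) * cabs (prim T (fun t => f t * y1 t) x) <= M2 * (M * M1 * T).
  by apply: ler_pM; rewrite ?cabs_ge0 ?H2 // P.
lra.
Qed.

Lemma iter_green_cont n f : contI T f -> contI T (iter n (green T y1 y2) f).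
Proof. by move=> fc; elim: n => //= n; exact: green_cont. Qed.

Lemma iter_green_lin n (c : C) f g h : contI T f -> contI T g ->
  (forall x, 0 <= x -> x <= T -> h x = c * f x + g x) ->
  forall x, 0 <= x -> x <= T -> iter n (green T y1 y2) h x =
     c * iter n (green T y1 y2) f x + iter n (green T y1 y2) g x.
Proof.
move=> fc gc hE; elim: n => [|n IH]; first exact: hE.
by move=> x x0 xT /=; apply: green_lin => //; exact: iter_green_cont.
Qed.

End Green.

(** Lagrange's identity against [y1] and [y2] gives two linear equations for the value and the
derivative of [y] at [x], with determinant the Wronskian. *)
Lemma variation_of_parameters T q lam lam0 y dy y1 dy1 y2 dy2 : 0 < T ->
  solves T q lam0 y1 dy1 -> solves T q lam0 y2 dy2 ->
  y1 T = 1 -> dy1 T = 0 -> y2 T = 0 -> dy2 T = 1 -> solves T q lam y dy ->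
  forall x, 0 <= x -> x <= T ->
    y x = (y T * y1 x + dy T * y2 x) + (lam - lam0) * green T y1 y2 y x.
Proof.
move=> T0 S1 S2 y1T dy1T y2T dy2T S x x0 xT; have T0' := ltW T0.
have yc := solves_cont S.
have wr z dz : solves T q lam0 z dz ->
    dy x * z x - y x * dz x = dy T * z T - y T * dz T - (lam - lam0) * prim T (fun t => y t * z t) x.
  move=> Sz; have zc := solves_cont Sz.
  have [wa [E nE HE]] := twice_ac_wronskian T0 S Sz.
  have [p1 p2] := primP T0 (contIM T0' yc zc).
  pose k t := (dy t * z t - y t * dz t) + (lam - lam0) * prim T (fun t => y t * z t) t.
  suff : k T = k x.
    by rewrite /k p2 mulr0 addr0 => ->; ring.
  apply: (@ac_const R T k E x T T0) => //.
    apply: acD => //; apply: (@ac_isd R T _ (fun t => (lam - lam0) * (y t * z t))) => //.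
      by move=> t t0 tT; apply: isdZ; exact: p1.
    by apply: contIZ => //; exact: contIM.
  move=> t nt t0 tT.
  have -> : 0 = ((q t - lam) * y t * z t - y t * ((q t - lam0) * z t)) + (lam - lam0) * (y t * z t).
    by ring.
  by apply: isdD; [exact: HE|apply: isdZ; apply: p1; exact: ltW].
have w1 := wr _ _ S1; have w2 := wr _ _ S2.
have W := wronskian_constT T0 S1 S2 x0 xT; rewrite y1T dy1T y2T dy2T in W w1 w2.
have W' : y1 x * dy2 x - dy1 x * y2 x = 1 by rewrite -[LHS]opprK opprB W; ring.
rewrite -[LHS]mulr1 -W'.
have -> : y x * (y1 x * dy2 x - dy1 x * y2 x) =
  (dy x * y1 x - y x * dy1 x) * y2 x - (dy x * y2 x - y x * dy2 x) * y1 x by ring.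
rewrite w1 w2 /green; ring.
Qed.

(** Iterating the variation of parameters [n] times gives a polynomial of degree less than [n] in
the increment of the spectral parameter, with a remainder of order [n]. *)
Lemma ana_form T q (U : (R -> C) -> C) (V : R) (y dy y1 dy1 y2 dy2 : R -> C -> C) : 0 < T ->
  bounded_form T U V ->
  (forall lam, solves T q lam (y1 ^~ lam) (dy1 ^~ lam)) ->
  (forall lam, solves T q lam (y2 ^~ lam) (dy2 ^~ lam)) ->
  (forall lam, solves T q lam (y ^~ lam) (dy ^~ lam)) ->
  (forall lam, [/\ y1 T lam = 1, dy1 T lam = 0, y2 T lam = 0 & dy2 T lam = 1]) ->
  (forall lam lam', y T lam = y T lam' /\ dy T lam = dy T lam') ->
  forall lam, ana (fun l => U (y ^~ l)) lam.
Proof.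
move=> T0 bU S1 S2 S data ydata lam0 n; have T0' := ltW T0.
have c1 := solves_cont (S1 lam0); have c2 := solves_cont (S2 lam0).
pose D := green T (y1 ^~ lam0) (y2 ^~ lam0).
pose f x := y T lam0 * y1 x lam0 + dy T lam0 * y2 x lam0.
have fc : contI T f by apply: contID; exact: contIZ.
have yc l : contI T (y ^~ l) by exact: solves_cont (S l).
have [a1 a2 a3 a4] := data lam0.
have yE h x : 0 <= x -> x <= T -> y x (lam0 + h) = h * D (y ^~ (lam0 + h)) x + f x.
  move=> x0 xT; have [e1 e2] := ydata (lam0 + h) lam0.
  rewrite (variation_of_parameters T0 (S1 lam0) (S2 lam0) a1 a2 a3 a4 (S (lam0 + h)) x0 xT).
  rewrite /= e1 e2 /f /D (_ : lam0 + h - lam0 = h); last by ring.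
  by rewrite addrC.
have [K K0 HK] := green_bound T0 c1 c2.
have [B B0 HB] := contI_bounded T0' fc.
have yb h : cabs h * K <= 1 / 2 -> forall x, 0 <= x -> x <= T -> cabs (y x (lam0 + h)) <= 2 * B.
  move=> hK; have [M M0 HM] := contI_bounded T0' (yc (lam0 + h)).
  apply: (@absorb_half R T (fun x => cabs (y x (lam0 + h))) B M T0' HM) => m Hm x x0 xT.
  have m0 : 0 <= m by apply: le_trans (Hm 0 (lexx _) T0'); exact: cabs_ge0.
  rewrite yE //; apply: (le_trans (cabsD _ _)); rewrite addrC cabsM lerD ?HB //.
  have := ler_wpM2l (cabs_ge0 h) (HK _ m (yc (lam0 + h)) m0 Hm x x0 xT).
  have := ler_wpM2r m0 hK; lra.
have itb k g (M : R) : contI T g -> 0 <= M -> (forall x, 0 <= x -> x <= T -> cabs (g x) <= M) ->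
    forall x, 0 <= x -> x <= T -> cabs (iter k D g x) <= K ^+ k * M.
  move=> gc M0 gM; elim: k => [|k IH]; first by rewrite expr0 mul1r.
  move=> x x0 xT; rewrite exprS -mulrA; apply: HK => //; first exact: iter_green_cont.
  by rewrite mulr_ge0 // exprn_ge0.
have UE h k : U (y ^~ (lam0 + h)) =
    (\poly_(i < k) U (iter i D f)).[h] + h ^+ k * U (iter k D (y ^~ (lam0 + h))).
  elim: k => [|k IH].
    by rewrite poly_def big_ord0 horner0 expr0 mul1r add0r.
  rewrite {1}IH.
  have -> : U (iter k D (y ^~ (lam0 + h))) = h * U (iter k.+1 D (y ^~ (lam0 + h))) + U (iter k D f).
    have ck := iter_green_cont T0 c1 c2 k.
    rewrite -(form_lin bU); [|exact: (iter_green_cont T0 c1 c2 k.+1)|exact: ck].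
    apply: (form_ext bU); first exact: ck.
    move=> x x0 xT; rewrite iterSr.
    apply: (iter_green_lin T0 c1 c2 k) => //; first exact: green_cont.
    by move=> t t0 tT; rewrite yE.
  rewrite !poly_def big_ord_recr /= hornerD hornerZ hornerXn exprSr; ring.
exists (\poly_(i < n) U (iter i D f)).
have KK : 0 < 2 * K + 2 by lra.
apply: (@taylorI _ _ _ _ _ (K ^+ n * (2 * B) * V) (1 / (2 * K + 2))); first by rewrite divr_gt0.
move=> h; rewrite ler_pdivlMr // => hK.
have hK' : cabs h * K <= 1 / 2 by have := cabs_ge0 h; lra.
rewrite (UE h n) addrAC subrr add0r cabsM cabsX mulrC ler_wpM2r ?exprn_ge0 ?cabs_ge0 //.
apply: (form_bound bU); first exact: iter_green_cont.
  by rewrite mulr_ge0 ?exprn_ge0 // mulr_ge0.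
by apply: itb => //; [rewrite mulr_ge0|exact: yb].
Qed.

Lemma kappa_exists lam : exists kappa, lam = - kappa ^+ 2 /\ 0 <= complex.Re kappa.
Proof.
have e : - (sqrtc (- lam)) ^+ 2 = lam by rewrite sqr_sqrtc opprK.
have [h|h] := lerP 0 (complex.Re (sqrtc (- lam))).
  by exists (sqrtc (- lam)).
by exists (- sqrtc (- lam)); rewrite sqrrN e raddfN /= oppr_ge0 ltW.
Qed.

Lemma cabs_kappa kappa : Num.sqrt (cabs (- kappa ^+ 2)) = cabs kappa.
Proof. by rewrite cabsN cabsX sqrtr_sqr ger0_norm // cabs_ge0. Qed.

(** Off the sector [kappa] stays away from the imaginary axis, which is where [exp kappa] would
fail to be large. *)
Lemma off_sector_kappa kappa : 0 <= complex.Re kappa -> off_sector (- kappa ^+ 2) ->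
  cabs kappa <= 6 * complex.Re kappa.
Proof.
rewrite /off_sector => a0 h.
rewrite -(@ler_pXn2r _ 2) ?nnegrE ?cabs_ge0 ?mulr_ge0 // cabs_sqr.
move: a0 h; case: kappa => a b /= a0.
have -> : - (a * b + b * a) = (-1) * (2 * a) * b by ring.
rewrite normrM (_ : `|-1 * (2 * a)| = 2 * a); last by rewrite mulN1r normrN ger0_norm // mulr_ge0.
rewrite -[b ^+ 2]real_normK ?num_real //.
have -> : - (a * a - b * b) = `|b| ^+ 2 - a ^+ 2 by rewrite real_normK ?num_real //; ring.
move: (`|b|) (normr_ge0 b) => c c0 h.
rewrite leNgt; apply/negP => h2.
have : 5 * a < c by nra.
nra.
Qed.

Lemma expRN_le_inv (u : R) : 0 < u -> expR (- u) <= 1 / u.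
Proof.
move=> u0; rewrite expRN div1r lef_pV2 ?posrE ?expR_gt0 //.
by have := expR_ge1Dx u; lra.
Qed.

(** By the solution estimate [y] at 0 is the free solution up to [1 / kappa], whose growing
exponential gives the leading term, and away from 0 it is exponentially smaller than the bound at
0, so that only the mass at 0 counts. *)
Lemma form_asymptotics T q (U : (R -> C) -> C) (H : C) (V : R) : 0 < T -> L1_potential T q ->
  mass_functional T U H V -> forall e : R, 0 < e -> exists2 R0 : R, 0 < R0 &
  forall kappa y dy, R0 <= cabs kappa -> cabs kappa <= 6 * complex.Re kappa ->
    solves T q (- kappa ^+ 2) y dy ->
    cabs (U y - H * ((y T - dy T / kappa) * cexp (T%:C * kappa) / 2)) <=
      e * (cabs (y T) + cabs (dy T) / cabs kappa) * expR (complex.Re kappa * T).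
Proof.
move=> T0 hq mf e e0; have T0' := ltW T0.
have [N N0 HN] := solution_estimate T0 hq.
have V0 := form_V (mass_form mf).
have e16 : 0 < e / 8 by rewrite divr_gt0.
have [delta d0 Hd] := mass_tail mf e16.
pose G := cabs H + 1; have G0 : 0 < G by rewrite /G; have := cabs_ge0 H; lra.
(* The lower bounds for [kappa] give, in this order, the solution estimate, smallness of [y]
beyond [delta], smallness of the distance to the free solution, and smallness of its decaying
exponential. *)
pose R0 := Num.max (2 * N) (Num.max (48 * (V + 1) / (e * delta)) (Num.max (8 * G * N / e) (12 * G / (e * T)))).
have ed : 0 < e * delta by rewrite mulr_gt0.
have eT : 0 < e * T by rewrite mulr_gt0.
exists R0; first by rewrite /R0 lt_max mulr_gt0.
move=> kappa y dy; rewrite /R0 !ge_max => /andP[k1 /andP[k2 /andP[k3 k4]]] k6 S.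
have K0 : 0 < cabs kappa by lra.
have kn : kappa != 0 by rewrite -cabs_gt0.
set tau := complex.Re kappa in k6 *.
have tau0 : 0 < tau by lra.
set m0 := cabs (y T) + cabs (dy T) / cabs kappa.
have m00 : 0 <= m0 by rewrite addr_ge0 ?divr_ge0 ?cabs_ge0.
have est s (s0 : 0 <= s) (sT : s <= T) := HN kappa y dy T (ltW tau0) k1 T0' (lexx T) S s s0 sT.
set X := expR (tau * T).
have X0 : 0 < X by exact: expR_gt0.
have yc := solves_cont S.
have yb t : 0 <= t -> t <= T -> cabs (y t) <= 2 * m0 * X.
  move=> t0 tT; have [h _] := est t t0 tT; apply: (le_trans h).
  rewrite ler_wpM2l ?mulr_ge0 // ler_expR ler_wpM2l ?(ltW tau0) //.
  by rewrite distrC ger0_norm ?subr_ge0 // lerBlDr lerDl.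
have ybd t : delta <= t -> t <= T -> cabs (y t) <= 2 * m0 * (X * expR (- (tau * delta))).
  move=> t0 tT; have [h _] := est t (le_trans (ltW d0) t0) tT; apply: (le_trans h).
  rewrite ler_wpM2l ?mulr_ge0 // -expRD ler_expR -mulrBr ler_wpM2l ?(ltW tau0) //.
  by rewrite distrC ger0_norm ?subr_ge0 // lerD2l lerN2.
have tail := Hd y (2 * m0 * X) (2 * m0 * (X * expR (- (tau * delta)))) yc
  ltac:(by rewrite !mulr_ge0 // ltW) ltac:(by rewrite !mulr_ge0 ?expR_ge0 // ltW) yb ybd.
have t1 : V * expR (- (tau * delta)) <= e / 8.
  have td : 0 < tau * delta by rewrite mulr_gt0.
  apply: (@le_trans _ _ ((V + 1) * (1 / (tau * delta)))).
    by apply: ler_pM; rewrite ?expR_ge0 ?expRN_le_inv //; lra.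
  rewrite mulrA mulr1 ler_pdivrMr //.
  rewrite ler_pdivrMr // in k2; nra.
have [_ ] := est 0 (lexx _) T0'.
rewrite sub0r normrN (ger0_norm T0') -/tau -/X -/m0.
set Y0 := ch kappa (- T) * y T + sh kappa (- T) * dy T / kappa => near0.
have t2 : cabs H * cabs (y 0 - Y0) <= e / 4 * m0 * X.
  have h1 : cabs H * cabs (y 0 - Y0) <= G * (2 * m0 * (N / cabs kappa) * X).
    by apply: ler_pM; rewrite ?cabs_ge0 //; rewrite /G; lra.
  apply: (le_trans h1).
  have -> : G * (2 * m0 * (N / cabs kappa) * X) = 2 * (G * N / cabs kappa) * m0 * X by ring.
  rewrite ler_wpM2r ?(ltW X0) // ler_wpM2r //.
  have : G * N / cabs kappa <= e / 8.
    rewrite ler_pdivrMr //; rewrite ler_pdivrMr // in k3; lra.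
  lra.
have Y0E : Y0 - (y T - dy T / kappa) * cexp (T%:C * kappa) / 2 =
    (y T + dy T / kappa) * cexp (T%:C * - kappa) / 2.
  rewrite /Y0 /ch /sh rmorphN !mulNr mulrN opprK -mulrN; field; exact: kn.
have t3 : cabs H * cabs (Y0 - (y T - dy T / kappa) * cexp (T%:C * kappa) / 2) <= e / 4 * m0 * X.
  have h2 : cabs (cexp (T%:C * - kappa)) <= 1 / (tau * T).
    apply: le_trans (expRN_le_inv (mulr_gt0 tau0 T0)).
    rewrite cabs_cexp ler_expR /tau; case: (kappa) => u v /=; rewrite mul0r subr0; lra.
  have h3 : cabs (y T + dy T / kappa) <= m0.
    by apply: (le_trans (cabsD _ _)); rewrite cabsM cabsV.
  rewrite Y0E cabs2 cabsM.
  have h4 : cabs H * (cabs (y T + dy T / kappa) * cabs (cexp (T%:C * - kappa)) / 2) <=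
      G * (m0 * (1 / (tau * T)) / 2).
    apply: ler_pM; rewrite ?divr_ge0 ?mulr_ge0 ?cabs_ge0 //; first by rewrite /G; lra.
    by rewrite ler_wpM2r ?invr_ge0 //; apply: ler_pM; rewrite ?cabs_ge0.
  apply: (le_trans h4).
  have -> : G * (m0 * (1 / (tau * T)) / 2) = (G / (tau * T) / 2) * m0 by ring.
  have h5 : G / (tau * T) <= e / 2.
    rewrite ler_pdivrMr ?mulr_gt0 //; rewrite ler_pdivrMr // in k4; nra.
  have X1 : 1 <= X by rewrite /X -expR0 ler_expR mulr_ge0 // ltW.
  have h6 : m0 <= m0 * X by rewrite ler_peMr.
  have : (G / (tau * T) / 2) * m0 <= (e / 4) * m0 by rewrite ler_wpM2r //; lra.
  have := ler_wpM2l (ltW e0) h6; lra.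
set L := (y T - dy T / kappa) * cexp (T%:C * kappa) / 2 in t3 *.
have -> : U y - H * L = (U y - H * y 0) + H * (y 0 - Y0) + H * (Y0 - L) by ring.
have := cabsD ((U y - H * y 0) + H * (y 0 - Y0)) (H * (Y0 - L)).
have := cabsD (U y - H * y 0) (H * (y 0 - Y0)).
rewrite !cabsM.
have := ler_wpM2l (mulr_ge0 m00 (ltW X0)) t1.
lra.
Qed.

Lemma form_growth T q (U : (R -> C) -> C) (V : R) : 0 < T -> L1_potential T q ->
  bounded_form T U V -> exists2 R0 : R, 0 < R0 & forall kappa y dy, R0 <= cabs kappa ->
    0 <= complex.Re kappa -> solves T q (- kappa ^+ 2) y dy ->
    cabs (U y) <= 2 * (cabs (y T) + cabs (dy T) / cabs kappa) * expR (complex.Re kappa * T) * V.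
Proof.
move=> T0 hq bU; have T0' := ltW T0; have [N N0 HN] := solution_estimate T0 hq.
exists (2 * N); first by rewrite mulr_gt0.
move=> kappa y dy kN k0 S.
have m00 : 0 <= cabs (y T) + cabs (dy T) / cabs kappa by rewrite addr_ge0 ?divr_ge0 ?cabs_ge0.
apply: (form_bound bU); first exact: solves_cont S.
  by rewrite !mulr_ge0 ?expR_ge0.
move=> t t0 tT; have [h _] := HN kappa y dy T k0 kN T0' (lexx T) S t t0 tT.
apply: (le_trans h); rewrite ler_wpM2l ?mulr_ge0 // ler_expR ler_wpM2l //.
by rewrite distrC ger0_norm ?subr_ge0 // lerBlDr lerDl.
Qed.

(** On the remaining disk the function is bounded by compactness. *)
Lemma global_growth (F : C -> C) (T B R0 : R) : (forall z : C, ana F z) -> 0 <= T -> 0 <= B ->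
  (forall kappa, R0 <= cabs kappa -> 0 <= complex.Re kappa ->
     cabs (F (- kappa ^+ 2)) <= B * expR (complex.Re kappa * T)) ->
  exists2 A : R, 0 <= A & forall z : C, cabs (F z) <= expR (A * (1 + Num.sqrt (cabs z))).
Proof.
move=> Fa T0 B0 FB.
have bd (z : C) : cabs (z - 0) <= R0 ^+ 2 -> cabs z <= R0 ^+ 2 by rewrite subr0.
have [B2 HB2] := @ana_bounded R (fun z : C => cabs (z - 0) <= R0 ^+ 2) F (R0 ^+ 2)
  (@closedC_disk R 0 (R0 ^+ 2)) bd (fun (z : C) _ => Fa z).
exists (B + `|B2| + T); first by rewrite !addr_ge0.
move=> z; set s := Num.sqrt _; have s0 : 0 <= s by exact: sqrtr_ge0.
have b2 := normr_ge0 B2.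
have [h|h] := lerP (cabs z) (R0 ^+ 2).
  apply: (le_trans (HB2 z _)); first by rewrite subr0.
  apply: (le_trans (ler_norm _)).
  have := expR_ge1Dx ((B + `|B2| + T) * (1 + s)) => h2.
  have : `|B2| <= (B + `|B2| + T) * (1 + s).
    have := mulr_ge0 B0 s0; have := mulr_ge0 b2 s0; have := mulr_ge0 T0 s0; lra.
  lra.
have [kappa [zE k0]] := kappa_exists z.
have sk : s = cabs kappa by rewrite /s zE cabs_kappa.
have kR : R0 <= cabs kappa.
  rewrite leNgt; apply/negP => h2; move: h; rewrite zE cabsN cabsX ltNge => /negP; apply.
  by rewrite lerXn2r ?nnegrE ?cabs_ge0 //; [apply: le_trans (ltW h2); exact: cabs_ge0|exact: ltW].
rewrite zE; apply: (le_trans (FB kappa kR k0)).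
apply: (@le_trans _ _ (expR B * expR (complex.Re kappa * T))).
  by rewrite ler_wpM2r ?expR_ge0 //; have := expR_ge1Dx B; lra.
rewrite -expRD ler_expR sk.
have rk : complex.Re kappa <= cabs kappa by apply: le_trans (cabs_Re _); exact: ler_norm.
have := ler_wpM2r T0 rk; have := mulr_ge0 B0 (cabs_ge0 kappa).
have := mulr_ge0 b2 (cabs_ge0 kappa); lra.
Qed.

End SpectralParameter.

(** * Solutions normalized at the right end point *)

Section Uniqueness.
Variable R : realType.
Local Notation C := (R[i]).
Implicit Types (q : R -> C) (lam kappa : C) (T : R) (U : (R -> C) -> C).

(** The boundary conditions at [T] select these two solutions, so that each characteristic
function is, up to sign, the form [U] of one of them. *)
Record terminal_system T q (phi dphi psi dpsi : R -> C -> C) := TerminalSystem {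
  phi_solves : forall lam, solves T q lam (phi ^~ lam) (dphi ^~ lam);
  psi_solves : forall lam, solves T q lam (psi ^~ lam) (dpsi ^~ lam);
  phi_T : forall lam, phi T lam = 1;
  dphi_T : forall lam, dphi T lam = 0;
  psi_T : forall lam, psi T lam = 0;
  dpsi_T : forall lam, dpsi T lam = 1 }.

Lemma form_comb T U (V : R) (c d : C) (y1 y2 : R -> C) : 0 < T -> bounded_form T U V ->
  contI T y1 -> contI T y2 -> U (fun t => c * y1 t + d * y2 t) = c * U y1 + d * U y2.
Proof.
move=> T0 bU c1 c2; have T0' := ltW T0.
rewrite (form_lin bU) //; last exact: contIZ.
congr (_ + _).
have U0 : U (fun=> 0) = 0.
  apply/eqP; rewrite -cabs_eq0 eq_le cabs_ge0 andbT -(mul0r V).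
  by apply: (form_bound bU); [exact: contI_cst| |move=> t _ _; rewrite cabs0].
rewrite -[RHS]addr0 -U0 -(form_lin bU) //; last exact: contI_cst.
by apply: (form_ext bU); [exact: contIZ|move=> t _ _; rewrite addr0].
Qed.

(** The multiplicities are the cardinalities of the fibres of the sequences of zeros. *)
Lemma common_order (F G : C -> C) (ev evt : nat -> C) :
  zeros_with_multiplicity (F : Cx R -> Cx R) ev -> zeros_with_multiplicity (G : Cx R -> Cx R) evt ->
  (forall n, (0 < n)%N -> ev n = evt n) ->
  exists ord : C -> nat, (forall z, zero_order (F : Cx R -> Cx R) z (ord z)) /\
    (forall z, zero_order (G : Cx R -> Cx R) z (ord z)).
Proof.
move=> HF HG e.
have H z : exists m, zero_order (F : Cx R -> Cx R) z m /\ zero_order (G : Cx R -> Cx R) z m.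
  have [m Fm cm] := HF z; have [k Gk ck] := HG z.
  exists m; split => //; suff -> : m = k by [].
  have E : [set n : nat | (0 < n)%N /\ ev n = z] = [set n : nat | (0 < n)%N /\ evt n = z].
    by apply/seteqP; split => n [n0 <-]; split => //; rewrite e.
  rewrite E in cm; apply/card_eq_II.
  by apply: card_eq_trans ck; rewrite card_eq_sym.
pose ord z := sval (cid (H z)).
by exists ord; split => z; have [] := svalP (cid (H z)).
Qed.

(** Both characteristic functions have order 1/2 and the same zeros, and off the sector they have
the same leading term, which depends on the data at [T] and on the mass at 0 only. The hypothesis
on [alpha] and [beta] says that this leading term does not degenerate; it holds when one of them
is 0. *)
Lemma form_eq_of_zeros T q qt U (H : C) (V : R) (phi dphi psi dpsi : R -> C -> C)
  (phit dphit psit dpsit : R -> C -> C) (y dy yt dyt : R -> C -> C) (alpha beta s : C)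
  (F Ft : C -> C) (ord : C -> nat) :
  0 < T -> L1_potential T q -> L1_potential T qt -> mass_functional T U H V -> H != 0 ->
  terminal_system T q phi dphi psi dpsi -> terminal_system T qt phit dphit psit dpsit ->
  (forall lam, solves T q lam (y ^~ lam) (dy ^~ lam)) ->
  (forall lam, solves T qt lam (yt ^~ lam) (dyt ^~ lam)) ->
  (forall lam, y T lam = alpha /\ dy T lam = beta) ->
  (forall lam, yt T lam = alpha /\ dyt T lam = beta) ->
  (forall kappa, kappa != 0 -> 0 < cabs alpha + cabs beta / cabs kappa /\
     cabs (alpha - beta / kappa) = cabs alpha + cabs beta / cabs kappa) ->
  cabs s = 1 -> (forall z, F z = s * U (y ^~ z)) -> (forall z, Ft z = s * U (yt ^~ z)) ->
  (forall z, zero_order F z (ord z)) -> (forall z, zero_order Ft z (ord z)) ->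
  forall z, U (y ^~ z) = U (yt ^~ z).
Proof.
move=> T0 hq hqt mf H0 S St Sy Syt dat datt ab s1 FE FtE Fo Fto; have T0' := ltW T0.
have bU := mass_form mf.
have an : forall z, ana F z.
  move=> z; apply: (@ana_ext _ (fun z => s * U (y ^~ z))); first by move=> w; rewrite FE.
  apply: anaM; first exact: ana_cst.
  apply: (@ana_form R T q U V y dy phi dphi psi dpsi T0 bU (phi_solves S) (psi_solves S) Sy) => //.
    by move=> lam; split; [exact: phi_T S _|exact: dphi_T S _|exact: psi_T S _|exact: dpsi_T S _].
  by move=> l l'; have [-> ->] := dat l; have [-> ->] := dat l'.
have ant : forall z, ana Ft z.
  move=> z; apply: (@ana_ext _ (fun z => s * U (yt ^~ z))); first by move=> w; rewrite FtE.
  apply: anaM; first exact: ana_cst.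
  apply: (@ana_form R T qt U V yt dyt phit dphit psit dpsit T0 bU (phi_solves St) (psi_solves St) Syt) => //.
    by move=> lam; split; [exact: phi_T St _|exact: dphi_T St _|exact: psi_T St _|exact: dpsi_T St _].
  by move=> l l'; have [-> ->] := datt l; have [-> ->] := datt l'.
have V0 := form_V bU.
pose B := 2 * (cabs alpha + cabs beta) * V.
have B0 : 0 <= B by rewrite !mulr_ge0 // addr_ge0 ?cabs_ge0.
have growth q' (z : R -> C -> C) (dz : R -> C -> C) (G : C -> C) : L1_potential T q' -> (forall z, ana G z) ->
    (forall lam, solves T q' lam (z ^~ lam) (dz ^~ lam)) ->
    (forall lam, z T lam = alpha /\ dz T lam = beta) -> (forall w, G w = s * U (z ^~ w)) ->
    exists2 A : R, 0 <= A & forall w : C, cabs (G w) <= expR (A * (1 + Num.sqrt (cabs w))).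
  move=> hq' Ga Sz dz' GE; have [R0 R00 HR] := form_growth T0 hq' bU.
  apply: (@global_growth R G T B (Num.max R0 1) Ga T0' B0) => kappa.
  rewrite ge_max => /andP[kR k1] k0; rewrite GE cabsM s1 mul1r.
  apply: (le_trans (HR kappa _ _ kR k0 (Sz _))).
  have [-> ->] := dz' (- kappa ^+ 2).
  rewrite mulrAC; apply: ler_wpM2r; first exact: expR_ge0.
  rewrite /B; apply: ler_wpM2r => //; rewrite ler_pM2l // lerD2l.
  by rewrite ler_pdivrMr ?ler_peMr ?cabs_ge0 //; lra.
have [A1 A10 F1] := growth q y dy F hq an Sy dat FE.
have [A2 A20 F2] := growth qt yt dyt Ft hqt ant Syt datt FtE.
have sqp (w : C) : 0 <= 1 + Num.sqrt (cabs w) by rewrite addr_ge0 // sqrtr_ge0.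
suff FF : forall z, F z = Ft z.
  move=> z; have := FF z; rewrite FE FtE => /mulfI; apply.
  by rewrite -cabs_gt0 s1.
apply: (@eq_of_zeros R F Ft (A1 + A2) ord) => //; first by rewrite addr_ge0.
- move=> z; apply: (le_trans (F1 z)); rewrite ler_expR ler_wpM2r //; lra.
- move=> z; apply: (le_trans (F2 z)); rewrite ler_expR ler_wpM2r //; lra.
move=> e e0; have cH : 0 < cabs H by rewrite cabs_gt0.
pose ep := Num.min (cabs H / 4) (e * cabs H / 8).
have ep0 : 0 < ep by rewrite lt_min !divr_gt0 // mulr_gt0.
have [ep1 ep2] : ep <= cabs H / 4 /\ ep <= e * cabs H / 8 by rewrite /ep !ge_min !lexx orbT.
have [R1 R10 H1] := form_asymptotics T0 hq mf ep0.
have [R2 R20 H2] := form_asymptotics T0 hqt mf ep0.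
exists ((R1 + R2) ^+ 2) => z zoff zR.
have [kappa [zE k0]] := kappa_exists z.
rewrite zE in zoff zR *; have k6 := off_sector_kappa k0 zoff.
have kR : R1 + R2 <= cabs kappa.
  by rewrite cabsN cabsX ler_pXn2r ?nnegrE ?cabs_ge0 // in zR; lra.
have K0 : 0 < cabs kappa by lra.
have kn : kappa != 0 by rewrite -cabs_gt0.
have {H1} := H1 kappa _ _ ltac:(lra) k6 (Sy _).
have {H2} := H2 kappa _ _ ltac:(lra) k6 (Syt _).
have [-> ->] := dat (- kappa ^+ 2); have [-> ->] := datt (- kappa ^+ 2).
have [m0 mE] := ab _ kn.
set m := cabs alpha + _ in m0 mE *; set L := H * _; set X := expR _.
have X0 : 0 < X by exact: expR_gt0.
have LE : cabs L = cabs H * (m * X) / 2.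
  rewrite /L cabsM cabs2 cabsM mE cabs_cexp mulrA; congr (_ * (_ * expR _) / 2).
  by case: (kappa) => a b /=; rewrite mul0r subr0 mulrC.
rewrite FE FtE -mulrBr !cabsM !s1 !mul1r mulf_eq0 negb_or -!cabs_gt0 s1 ltr01 /=.
set u := U (y ^~ _); set ut := U (yt ^~ _) => h2 h1.
have mX : 0 < m * X by rewrite mulr_gt0.
have g1 := ler_wpM2r (ltW mX) ep1; have g2 := ler_wpM2r (ltW mX) ep2.
have low : cabs H * (m * X) / 4 <= cabs ut.
  have := cabs_tri L (L - ut); rewrite (_ : L - (L - ut) = ut); last by ring.
  rewrite (cabsC L) LE; lra.
split; first by apply: lt_le_trans low; rewrite divr_gt0 // mulr_gt0.
have -> : u - ut = (u - L) - (ut - L) by ring.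
apply: (le_trans (cabsB _ _)).
have := ler_wpM2l (ltW e0) low; lra.
Qed.

(** Values to the right determine the derivative, so identities on [x, T] may be differentiated at
[x] itself. *)
Lemma isd_right_zero T (f : R -> C) (x : R) (l : C) : 0 <= x -> x < T ->
  (forall t, x <= t -> t <= T -> f t = 0) -> isd T f x l -> l = 0.
Proof.
move=> x0 xT f0 H; apply: cabs_le_small => e e0; have [d d0 Hd] := H e e0.
pose r := Num.min d (T - x).
have r0 : 0 < r by rewrite lt_min d0 subr_gt0.
have [rd rT] : r <= d /\ r <= T - x by rewrite /r !ge_min !lexx orbT.
have rr : `|x + r - x| = r by rewrite (_ : x + r - x = r) ?gtr0_norm //; ring.
have := Hd (x + r) ltac:(lra) ltac:(lra); rewrite rr => /(_ rd).
rewrite !f0 //; try lra.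
rewrite subrr sub0r cabsN cabsM cabs_real rr mulrC ler_pM2r //.
Qed.

Lemma sq1_cst T (c : R -> C) (x0 : R) : 0 <= x0 -> x0 <= T -> contI T c ->
  (forall x, x0 <= x -> x <= T -> c x ^+ 2 = 1) -> c T = 1 -> c x0 = 1.
Proof.
move=> x00 x0T cc c2 cT; rewrite -cT.
apply: (@cousin R x0 T (fun u v => c u = c v)) => //.
  by move=> u v w _ _ _ _ -> .
move=> x xx xT; have x1 : 0 <= x by exact: le_trans xx.
have [d d0 Hd] := cc x x1 xT 1 ltr01; exists d => // u v xu ux xv vT du dv.
have E t : x0 <= t -> t <= T -> `|t - x| <= d -> c t = c x.
  move=> t0 tT td; have h := Hd t (le_trans x00 t0) tT td.
  have /eqP := c2 t t0 tT; have /eqP := c2 x xx xT.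
  rewrite !sqrf_eq1 => /orP[|] /eqP cx /orP[|] /eqP ct; rewrite ?cx ?ct //; exfalso; move: h; rewrite cx ct.
    rewrite (_ : -1 - 1 = (- 2 : R)%:C); last by rewrite rmorphN rmorph_nat; ring.
    by rewrite cabs_real normrN ger0_norm //; lra.
  rewrite (_ : 1 - -1 = (2 : R)%:C); last by rewrite rmorph_nat; ring.
  by rewrite cabs_real ger0_norm //; lra.
have -> : c u = c x by apply: E; [lra|lra|rewrite ler0_norm; lra].
by apply/esym; apply: E; [lra|lra|rewrite ger0_norm; lra].
Qed.

(** The hypothesis makes [phit] and [psit] the same multiple [c] of [phi] and [psi], where [c] is
found from the Wronskian. Differentiating the hypothesis and comparing Wronskians gives [c^2 = 1],
and [c] is continuous with [c T = 1]. *)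
Lemma terminal_eq T q qt lam (phi dphi psi dpsi phit dphit psit dpsit : R -> C -> C) (x0 : R) :
  0 < T -> terminal_system T q phi dphi psi dpsi -> terminal_system T qt phit dphit psit dpsit ->
  0 <= x0 -> x0 <= T ->
  (forall x, x0 <= x -> x <= T -> phi x lam * psit x lam - psi x lam * phit x lam = 0) ->
  phit x0 lam = phi x0 lam /\ psit x0 lam = psi x0 lam.
Proof.
move=> T0 S St x00 x0T A0; have T0' := ltW T0.
have [f1 f2 _] := phi_solves S lam; have [p1 p2 _] := psi_solves S lam.
have [g1 g2 _] := phi_solves St lam; have [r1 r2 _] := psi_solves St lam.
have W x : 0 <= x -> x <= T -> phi x lam * dpsi x lam - dphi x lam * psi x lam = 1.
  move=> xx xT; have := wronskian_constT T0 (phi_solves S lam) (psi_solves S lam) xx xT.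
  rewrite (phi_T S) (dphi_T S) (psi_T S) (dpsi_T S) => h.
  by rewrite -[LHS]opprK opprB h; ring.
have Wt x : 0 <= x -> x <= T -> phit x lam * dpsit x lam - dphit x lam * psit x lam = 1.
  move=> xx xT; have := wronskian_constT T0 (phi_solves St lam) (psi_solves St lam) xx xT.
  rewrite (phi_T St) (dphi_T St) (psi_T St) (dpsi_T St) => h.
  by rewrite -[LHS]opprK opprB h; ring.
pose c x := phit x lam * dpsi x lam - psit x lam * dphi x lam.
have cphi x : x0 <= x -> x <= T -> c x * phi x lam = phit x lam.
  move=> xx xT; have xx0 : 0 <= x by exact: le_trans xx.
  have /eqP := A0 x xx xT; rewrite subr_eq0 => /eqP E.
  rewrite -[RHS]mulr1 -(W x xx0 xT) /c.
  have -> : (phit x lam * dpsi x lam - psit x lam * dphi x lam) * phi x lam =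
    phit x lam * dpsi x lam * phi x lam - (phi x lam * psit x lam) * dphi x lam by ring.
  rewrite E; ring.
have cpsi x : x0 <= x -> x <= T -> c x * psi x lam = psit x lam.
  move=> xx xT; have xx0 : 0 <= x by exact: le_trans xx.
  have /eqP := A0 x xx xT; rewrite subr_eq0 => /eqP E.
  rewrite -[RHS]mulr1 -(W x xx0 xT) /c.
  have -> : (phit x lam * dpsi x lam - psit x lam * dphi x lam) * psi x lam =
    (psi x lam * phit x lam) * dpsi x lam - psit x lam * dphi x lam * psi x lam by ring.
  rewrite -E; ring.
have cT : c T = 1 by rewrite /c (phi_T St) (dpsi_T S) (psi_T St); ring.
have c2 x : x0 <= x -> x <= T -> c x ^+ 2 = 1.
  move=> xx; rewrite le_eqVlt => /orP[/eqP -> |xT]; first by rewrite cT expr1n.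
  have xT' := ltW xT; have xx0 : 0 <= x by exact: le_trans xx.
  have D : dphi x lam * psit x lam + phi x lam * dpsit x lam -
      (dpsi x lam * phit x lam + psi x lam * dphit x lam) = 0.
    apply: (@isd_right_zero T (fun x => phi x lam * psit x lam - psi x lam * phit x lam) x) => //.
      by move=> t xt tT; apply: A0 => //; exact: le_trans xt.
    by apply: isdB; apply: isdM; [exact: f1|exact: r1|exact: p1|exact: g1].
  have E1 := cphi x xx xT'; have E2 := cpsi x xx xT'.
  have := Wt x xx0 xT'; rewrite -{1}E1 -{1}E2 => <-.
  have D' : phi x lam * dpsit x lam - psi x lam * dphit x lam = c x.
    rewrite /c -[LHS]subr0 -D; ring.
  have -> : c x * phi x lam * dpsit x lam - dphit x lam * (c x * psi x lam) =
    c x * (phi x lam * dpsit x lam - psi x lam * dphit x lam) by ring.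
  by rewrite D' expr2.
have cc : contI T c.
  have pc := solves_cont (phi_solves St lam); have sc := solves_cont (psi_solves St lam).
  apply: contID; first by apply: contIM => //; exact: ac_cont p2.
  by apply: contIN => //; apply: contIM => //; exact: ac_cont f2.
have c1 := sq1_cst x00 x0T cc c2 cT.
by rewrite -(cphi x0) // -(cpsi x0) // c1 !mul1r.
Qed.

(** The part of the solution estimate that the terminal system needs. *)
Definition exp_bounded T q (N : R) := forall kappa y dy x0 s, 0 <= complex.Re kappa ->
  2 * N <= cabs kappa -> 0 <= x0 -> x0 <= T -> solves T q (- kappa ^+ 2) y dy -> 0 <= s -> s <= T ->
  cabs (y s) <= 2 * (cabs (y x0) + cabs (dy x0) / cabs kappa) * expR (complex.Re kappa * `|s - x0|).

Lemma exp_bounded_exists T q : 0 < T -> L1_potential T q -> exists2 N : R, 0 < N & exp_bounded T q N.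
Proof.
move=> T0 hq; have [N N0 HN] := solution_estimate T0 hq; exists N => //.
by move=> kappa y dy x0 s k0 kN x00 x0T S s0 sT; have [] := HN kappa y dy x0 k0 kN x00 x0T S s s0 sT.
Qed.

Section TerminalBounds.
Variables (T : R) (q : R -> C) (phi dphi psi dpsi : R -> C -> C).
Hypothesis T0 : 0 < T.
Hypothesis S : terminal_system T q phi dphi psi dpsi.
Let T0' := ltW T0.

Lemma terminal_ana x : 0 <= x -> x <= T -> forall w, ana (phi x) w /\ ana (psi x) w.
Proof.
move=> x0 xT w; have bx := eval_form x0 xT.
have dat lam : [/\ phi T lam = 1, dphi T lam = 0, psi T lam = 0 & dpsi T lam = 1].
  by split; [exact: phi_T S _|exact: dphi_T S _|exact: psi_T S _|exact: dpsi_T S _].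
split.
  apply: (@ana_form R T q (fun y => y x) 1 phi dphi phi dphi psi dpsi T0 bx (phi_solves S) (psi_solves S) (phi_solves S) dat).
  by move=> l l'; rewrite !(phi_T S) !(dphi_T S).
apply: (@ana_form R T q (fun y => y x) 1 psi dpsi phi dphi psi dpsi T0 bx (phi_solves S) (psi_solves S) (psi_solves S) dat).
by move=> l l'; rewrite !(psi_T S) !(dpsi_T S).
Qed.

Lemma terminal_bound (N x : R) kappa : exp_bounded T q N -> 0 <= x -> x <= T ->
  0 <= complex.Re kappa -> 2 * N <= cabs kappa ->
  cabs (phi x (- kappa ^+ 2)) <= 2 * expR (complex.Re kappa * (T - x)) /\
  cabs (psi x (- kappa ^+ 2)) <= 2 / cabs kappa * expR (complex.Re kappa * (T - x)).
Proof.
move=> HN x0 xT k0 kN.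
have xTE : `|x - T| = T - x by rewrite distrC ger0_norm // subr_ge0.
have := HN kappa _ _ T x k0 kN T0' (lexx T) (phi_solves S _) x0 xT.
have := HN kappa _ _ T x k0 kN T0' (lexx T) (psi_solves S _) x0 xT.
rewrite (phi_T S) (dphi_T S) (psi_T S) (dpsi_T S) cabs0 cabs1 xTE mul0r addr0 mulr1 add0r mul1r.
by split.
Qed.

(** The combination of [phi] and [psi] in the form vanishes at [x] and has derivative 1 there, so
it is bounded by the exponential of the distance to [x] instead of the distance to [T]. On [0, a]
with [a <= 2 x] that distance is at most [x]. *)
Lemma cross_form_bound U (V N x a : R) kappa : bounded_form T U V -> exp_bounded T q N ->
  0 <= complex.Re kappa -> 2 * N <= cabs kappa -> 0 <= x -> x <= T -> 0 <= a -> a <= T -> a <= 2 * x ->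
  let Ua y := U (fun t => y (Num.min t a)) in let lam := - kappa ^+ 2 in
  bounded_form T Ua V ->
  cabs (phi x lam * Ua (psi ^~ lam) - psi x lam * Ua (phi ^~ lam)) <=
    2 / cabs kappa * expR (complex.Re kappa * x) * V.
Proof.
move=> bU HN k0 kN x0 xT a0 aT ax Ua lam bUa.
have pc := solves_cont (phi_solves S lam); have sc := solves_cont (psi_solves S lam).
have -> : phi x lam * Ua (psi ^~ lam) - psi x lam * Ua (phi ^~ lam) =
    Ua (fun t => phi x lam * psi t lam + (- psi x lam) * phi t lam).
  by rewrite (form_comb _ _ T0 bUa sc pc) mulNr.
have D := solves_comb (phi x lam) (- psi x lam) T0 (psi_solves S lam) (phi_solves S lam).
have Dx : phi x lam * dpsi x lam + - psi x lam * dphi x lam = 1.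
  have := wronskian_constT T0 (phi_solves S lam) (psi_solves S lam) x0 xT.
  rewrite (phi_T S) (dphi_T S) (psi_T S) (dpsi_T S) => h.
  have -> : phi x lam * dpsi x lam + - psi x lam * dphi x lam =
    - (dphi x lam * psi x lam - phi x lam * dpsi x lam) by ring.
  by rewrite h; ring.
have Dc : contI T (fun t => phi x lam * psi t lam + (- psi x lam) * phi t lam).
  by apply: contID; exact: contIZ.
apply: (form_bound bU); first exact: (contI_min a0 aT Dc).
  by rewrite mulr_ge0 ?expR_ge0 // divr_ge0 ?cabs_ge0.
move=> t t0 tT.
have [m0 mT] : 0 <= Num.min t a /\ Num.min t a <= T by rewrite le_min ge_min t0 tT a0.
have ma : Num.min t a <= a by rewrite ge_min lexx orbT.
have := HN kappa _ _ x _ k0 kN x0 xT D m0 mT.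
rewrite Dx (_ : phi x lam * psi x lam + - psi x lam * phi x lam = 0); last by ring.
rewrite cabs0 cabs1 add0r mul1r => h; apply: (le_trans h).
rewrite ler_wpM2l ?divr_ge0 ?cabs_ge0 // ler_expR ler_wpM2l //.
by rewrite ler_norml; apply/andP; split; lra.
Qed.

(** The leading term dominates the error of the asymptotics by a factor of 2. *)
Lemma form_psi_lower U (H : C) (V : R) : L1_potential T q -> mass_functional T U H V -> H != 0 ->
  exists2 R0 : R, 0 < R0 & forall kappa, R0 <= cabs kappa -> cabs kappa <= 6 * complex.Re kappa ->
    cabs H / (4 * cabs kappa) * expR (complex.Re kappa * T) <= cabs (U (psi ^~ (- kappa ^+ 2))).
Proof.
move=> hq mf H0; have cH : 0 < cabs H by rewrite cabs_gt0.
have H4 : 0 < cabs H / 4 by rewrite divr_gt0.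
have [R0 R00 H1] := form_asymptotics T0 hq mf H4.
exists R0 => // kappa kR k6.
have := H1 kappa _ _ kR k6 (psi_solves S _).
rewrite (psi_T S) (dpsi_T S) cabs0 cabs1 !add0r mul1r.
set L := H * _ => h; set u := U _ in h *.
have LE : cabs L = cabs H * ((cabs kappa)^-1 * expR (complex.Re kappa * T)) / 2.
  rewrite /L cabsM cabs2 cabsM cabsN cabsV cabs_cexp mulrA; congr (_ * (_ * expR _) / 2).
  by case: (kappa) => a' b' /=; rewrite mul0r subr0 mulrC.
have := cabs_tri L (L - u); rewrite (_ : L - (L - u) = u); last by ring.
rewrite (cabsC L) LE => h'.
have -> : cabs H / (4 * cabs kappa) = cabs H / 4 * (cabs kappa)^-1 by rewrite invfM mulrA.
by lra.
Qed.

End TerminalBounds.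

Section Halving.
Variables (T : R) (q qt : R -> C) (phi dphi psi dpsi phit dphit psit dpsit : R -> C -> C).
Hypothesis T0 : 0 < T.
Hypothesis S : terminal_system T q phi dphi psi dpsi.
Hypothesis St : terminal_system T qt phit dphit psit dpsit.
Let T0' := ltW T0.

(** The form of the difference is 0, and the difference vanishes beyond [a], where freezing acts.
*)
Lemma frozen_form_eq U (V a : R) (y yt : R -> C) : bounded_form T U V -> 0 <= a -> a <= T ->
  bounded_form T (fun y => U (fun t => y (Num.min t a))) V -> contI T y -> contI T yt -> U y = U yt ->
  (forall x, a <= x -> x <= T -> yt x = y x) ->
  U (fun t => y (Num.min t a)) = U (fun t => yt (Num.min t a)).
Proof.
move=> bU a0 aT bUa yc ytc UE e; apply/eqP; rewrite -subr_eq0.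
have D1 : U y - U yt = U (fun t => 1 * y t + (-1) * yt t).
  by rewrite (form_comb 1 (-1) T0 bU yc ytc); ring.
have D2 := form_comb 1 (-1) T0 bUa yc ytc; rewrite mul1r mulN1r in D2.
have yyc : contI T (fun t => 1 * y t + (-1) * yt t) by apply: contID; exact: contIZ.
rewrite -D2; apply/eqP; transitivity (U y - U yt); last by rewrite UE subrr.
rewrite D1; apply: (form_ext bU); first exact: (contI_min a0 aT yyc).
move=> t t0 tT; case: (lerP t a) => // ta.
by rewrite (e a) // (e t) ?(ltW ta) //; ring.
Qed.

Lemma cross_growth (x : R) : L1_potential T q -> L1_potential T qt -> 0 <= x -> x <= T ->
  forall R1 : R, exists2 r : R, R1 <= r & forall w : C, cabs w = r ->
    cabs (phi x w * psit x w - psi x w * phit x w) <= expR ((8 + 2 * T) * (r * Num.sqrt r)).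
Proof.
move=> hq hqt x0 xT R1.
have [N N0 HN] := exp_bounded_exists T0 hq; have [Nt Nt0 HNt] := exp_bounded_exists T0 hqt.
pose r := Num.max (Num.max R1 1) ((2 * N + 2 * Nt) ^+ 2).
have [r1 r2 r3] : [/\ R1 <= r, 1 <= r & (2 * N + 2 * Nt) ^+ 2 <= r].
  by rewrite /r !le_max !lexx !orbT.
exists r => // w wr; have [kappa [wE k0]] := kappa_exists w.
have sk : Num.sqrt r = cabs kappa by rewrite -wr wE cabs_kappa.
have kN : 2 * N + 2 * Nt <= cabs kappa.
  have NN : 0 <= 2 * N + 2 * Nt by lra.
  have r0 : 0 <= r by exact: le_trans r2.
  by rewrite -sk -(@ler_pXn2r _ 2) ?nnegrE ?sqrtr_ge0 ?sqr_sqrtr.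
have k1 : 1 <= cabs kappa by rewrite -sk -[X in X <= _]sqrtr1 ler_wsqrtr.
have kN1 : 2 * N <= cabs kappa by lra.
have kN2 : 2 * Nt <= cabs kappa by lra.
have [b1 b2] := terminal_bound T0 S HN x0 xT k0 kN1.
have [b3 b4] := terminal_bound T0 St HNt x0 xT k0 kN2.
rewrite wE; set X := expR (complex.Re kappa * (T - x)) in b1 b2 b3 b4.
have X0 : 0 < X by exact: expR_gt0.
have i2 : 2 / cabs kappa * X <= 2 * X.
  by rewrite ler_pM2r // ler_pdivrMr ?ler_peMr // (lt_le_trans ltr01).
apply: (le_trans (cabsB _ _)); rewrite !cabsM.
have j1 := ler_pM (cabs_ge0 _) (cabs_ge0 _) b1 (le_trans b4 i2).
have j2 := ler_pM (cabs_ge0 _) (cabs_ge0 _) (le_trans b2 i2) b3.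
apply: (@le_trans _ _ (8 * (X * X))).
  by apply: (le_trans (lerD j1 j2)); rewrite le_eqVlt; apply/orP; left; apply/eqP; ring.
have XX : X * X <= expR (2 * T * (r * Num.sqrt r)).
  have rk : complex.Re kappa <= cabs kappa by apply: le_trans (cabs_Re _); exact: ler_norm.
  have e1 : complex.Re kappa * (T - x) <= cabs kappa * T.
    by apply: ler_pM => //; rewrite ?subr_ge0 // lerBlDr lerDl.
  have e2 : cabs kappa * T <= T * (r * cabs kappa).
    by rewrite mulrC ler_wpM2l // ler_peMl // cabs_ge0.
  rewrite /X -expRD ler_expR sk -[2 * T * _]mulrA mulr_natl mulr2n.
  by have e3 := le_trans e1 e2; exact: lerD.
apply: (@le_trans _ _ (expR 8 * expR (2 * T * (r * Num.sqrt r)))).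
  apply: ler_pM; rewrite ?mulr_ge0 ?(ltW X0) //.
  by apply: le_trans (expR_ge1Dx _); rewrite lerDr.
rewrite -expRD ler_expR [leRHS]mulrDl lerD2r ler_peMr // -[1]mulr1 sk.
by apply: ler_pM.
Qed.

(** Multiplied by the form of [psi] frozen at [a], the difference is a combination of the two
cross forms, with coefficients that grow like the exponential of [T - x]; together the
exponentials cancel the lower bound of the frozen form, and a factor [1 / kappa] is left over. *)
Lemma cross_decay U (H : C) (V a x : R) : L1_potential T q -> L1_potential T qt ->
  mass_functional T U H V -> H != 0 -> 0 < a -> a <= T ->
  let Ua y := U (fun t => y (Num.min t a)) in
  (forall z, Ua (phi ^~ z) = Ua (phit ^~ z)) -> (forall z, Ua (psi ^~ z) = Ua (psit ^~ z)) ->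
  0 <= x -> x <= T -> a <= 2 * x ->
  forall e : R, 0 < e -> exists R0 : R, forall w : C, off_sector w -> R0 <= cabs w ->
    cabs (phi x w * psit x w - psi x w * phit x w) <= e.
Proof.
move=> hq hqt mf H0 a0 aT Ua Uaphi Uapsi x0 xT ax e e0; have a0' := ltW a0.
have bU := mass_form mf; have V0 := form_V bU.
have mfa : mass_functional T Ua H V by exact: mass_cut.
have bUa := mass_form mfa.
have [N N0 HN] := exp_bounded_exists T0 hq; have [Nt Nt0 HNt] := exp_bounded_exists T0 hqt.
have [R1 R10 low] := form_psi_lower T0 S hq mfa H0.
have cH : 0 < cabs H by rewrite cabs_gt0.
have He : 0 < cabs H * e by rewrite mulr_gt0.
(* The constant is 8 from two products of two bounds with constant 2, times 4 from the lower bound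
for the form of [psi]. *)
pose R2 := 32 * V / (cabs H * e).
pose R0 := Num.max (Num.max (2 * N) (2 * Nt)) (Num.max R1 R2).
exists (R0 ^+ 2) => w woff wR.
have [kappa [wE k0]] := kappa_exists w.
rewrite wE in woff wR *; have k6 := off_sector_kappa k0 woff.
have R00 : 0 <= R0 by rewrite /R0 !le_max (ltW R10) orbT.
have kR : R0 <= cabs kappa.
  by rewrite cabsN cabsX ler_pXn2r ?nnegrE ?cabs_ge0 // in wR.
move: kR; rewrite /R0 !ge_max => /andP[/andP[kN1 kN2] /andP[kR1 kV]].
have K0 : 0 < cabs kappa by exact: lt_le_trans kR1.
have {low} := low kappa kR1 k6.
have [b1 b2] := terminal_bound T0 S HN x0 xT k0 kN1.
have [b3 b4] := terminal_bound T0 St HNt x0 xT k0 kN2.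
have w1 : cabs (phi x (- kappa ^+ 2) * Ua (psi ^~ (- kappa ^+ 2)) - psi x (- kappa ^+ 2) *
    Ua (phi ^~ (- kappa ^+ 2))) <= 2 / cabs kappa * expR (complex.Re kappa * x) * V.
  exact: (cross_form_bound T0 S bU HN k0 kN1 x0 xT a0' aT ax bUa).
have w2 : cabs (phit x (- kappa ^+ 2) * Ua (psi ^~ (- kappa ^+ 2)) - psit x (- kappa ^+ 2) *
    Ua (phi ^~ (- kappa ^+ 2))) <= 2 / cabs kappa * expR (complex.Re kappa * x) * V.
  rewrite Uaphi Uapsi; exact: (cross_form_bound T0 St bU HNt k0 kN2 x0 xT a0' aT ax bUa).
have XX : expR (complex.Re kappa * x) * expR (complex.Re kappa * (T - x)) = expR (complex.Re kappa * T).
  by rewrite -expRD -mulrDr addrC subrK.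
set lam := - kappa ^+ 2 in b2 b4 w1 w2 *.
rewrite -XX; set X := expR _ in w1 w2 *; set X' := expR _ in b2 b4 *.
set Up := Ua (psi ^~ lam) in w1 w2 *; set A := phi x lam * _ - _ => low.
have E : A * Up = (phi x lam * Up - psi x lam * Ua (phi ^~ lam)) * psit x lam -
   psi x lam * (phit x lam * Up - psit x lam * Ua (phi ^~ lam)) by rewrite /A; ring.
have XX0 : 0 < X * X' by rewrite mulr_gt0 // expR_gt0.
have up : cabs A * cabs Up <= 8 * V * (X * X') / cabs kappa ^+ 2.
  rewrite -cabsM E; apply: (le_trans (cabsB _ _)); rewrite !cabsM.
  have u1 := ler_pM (cabs_ge0 _) (cabs_ge0 _) w1 b4.
  have u2 := ler_pM (cabs_ge0 _) (cabs_ge0 _) b2 w2.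
  apply: (le_trans (lerD u1 u2)); rewrite le_eqVlt; apply/orP; left; apply/eqP.
  by field; rewrite gt_eqF.
have c0 : 0 < cabs H / (4 * cabs kappa) * (X * X') by rewrite mulr_gt0 // divr_gt0 // mulr_gt0.
have up2 := le_trans (ler_wpM2l (cabs_ge0 A) low) up.
rewrite -(ler_pM2r c0); apply: (le_trans up2).
have -> : 8 * V * (X * X') / cabs kappa ^+ 2 = 32 * V / cabs kappa * (X * X' / (4 * cabs kappa)).
  by field; rewrite gt_eqF.
have -> : e * (cabs H / (4 * cabs kappa) * (X * X')) = (cabs H * e) * (X * X' / (4 * cabs kappa)) by ring.
rewrite ler_pM2r; last by rewrite divr_gt0 // mulr_gt0.
by rewrite ler_pdivrMr // [leRHS]mulrC -ler_pdivrMr.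
Qed.

(** Freezing the argument at [a] turns the values of [U] into data that the agreement on [a, T]
makes equal, so that the difference [phi psit - psi phit] at [x] decays off the sector and hence
vanishes identically. *)
Lemma halving_step U (H : C) (V a : R) :
  L1_potential T q -> L1_potential T qt -> mass_functional T U H V -> H != 0 ->
  (forall z, U (phi ^~ z) = U (phit ^~ z)) -> (forall z, U (psi ^~ z) = U (psit ^~ z)) ->
  0 < a -> a <= T ->
  (forall x z, a <= x -> x <= T -> phit x z = phi x z /\ psit x z = psi x z) ->
  forall x z, a / 2 <= x -> x <= T -> phit x z = phi x z /\ psit x z = psi x z.
Proof.
move=> hq hqt mf H0 Uphi Upsi a0 aT eqa; have a0' := ltW a0.
have bU := mass_form mf; have bUa := mass_form (mass_cut a0 aT mf).
suff A0 x z : a / 2 <= x -> x <= T -> phi x z * psit x z - psi x z * phit x z = 0.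
  move=> x z ax xT; apply: (terminal_eq (lam := z) T0 S St) => //.
    by apply: le_trans ax; rewrite divr_ge0.
  by move=> t xt tT; apply: A0 => //; exact: le_trans xt.
move=> ax xT; have x0 : 0 <= x by apply: le_trans ax; rewrite divr_ge0.
rewrite ler_pdivrMr // mulrC in ax.
have [aS sS] : (forall w, ana (phi x) w) /\ (forall w, ana (psi x) w).
  by split => w; have [] := terminal_ana T0 S x0 xT w.
have [aSt sSt] : (forall w, ana (phit x) w) /\ (forall w, ana (psit x) w).
  by split => w; have [] := terminal_ana T0 St x0 xT w.
apply: (@sector_liouville R (fun z => phi x z * psit x z - psi x z * phit x z) 0 (8 + 2 * T)).
- by move=> w; apply: anaB; exact: anaM.
- exact: cross_growth.
move=> e e0.
have [R0 HR0] := @cross_decay U H V a x hq hqt mf H0 a0 aT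
  (fun w => frozen_form_eq bU a0' aT bUa (solves_cont (phi_solves S w)) (solves_cont (phi_solves St w))
     (Uphi w) (fun t at_ tT => (eqa t w at_ tT).1))
  (fun w => frozen_form_eq bU a0' aT bUa (solves_cont (psi_solves S w)) (solves_cont (psi_solves St w))
     (Upsi w) (fun t at_ tT => (eqa t w at_ tT).2)) x0 xT ax e e0.
by exists R0 => w w1 w2; rewrite subr0; exact: HR0.
Qed.

End Halving.

End Uniqueness.

(** * The inverse problem *)

Section FromDefinitions.
Variable R : realType.
Local Notation C := (R[i]).

(** The inverse of the transfer matrix over [0, T], whose determinant is the Wronskian. *)
Lemma terminal_of_fundamental (T : R) (q : R -> C) (X1 X2 : R -> C -> C) : 0 < T ->
  fundamental_solutions T q (X1 : R -> Cx R -> Cx R) (X2 : R -> Cx R -> Cx R) ->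
  let d1 := fun x lam => deriv_in T (X1 ^~ lam : R -> Cx R) x : C in
  let d2 := fun x lam => deriv_in T (X2 ^~ lam : R -> Cx R) x : C in
  terminal_system T q
   (fun x lam => d2 T lam * X1 x lam + (- d1 T lam) * X2 x lam)
   (fun x lam => d2 T lam * d1 x lam + (- d1 T lam) * d2 x lam)
   (fun x lam => X1 T lam * X2 x lam + (- X2 T lam) * X1 x lam)
   (fun x lam => X1 T lam * d2 x lam + (- X2 T lam) * d1 x lam).
Proof.
move=> T0 hX d1 d2; have T0' := ltW T0.
have S1 lam : solves T q lam (X1 ^~ lam) (d1 ^~ lam).
  by have [[H _ _] _] := hX lam; exact: (solution_solves T0 H).
have S2 lam : solves T q lam (X2 ^~ lam) (d2 ^~ lam).
  by have [_ [H _ _]] := hX lam; exact: (solution_solves T0 H).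
have W lam : X1 T lam * d2 T lam - d1 T lam * X2 T lam = 1.
  have := wronskian_const T0 (S1 lam) (S2 lam) T0' (lexx T).
  have [[_ e1 e2] [_ e3 e4]] := hX lam.
  rewrite /d1 /d2 in e2 e4 *; rewrite /= in e1 e2 e3 e4; rewrite e1 e2 e3 e4 => h.
  by rewrite -[LHS]opprK opprB h; ring.
split => lam.
- exact: (solves_comb _ _ T0 (S1 lam) (S2 lam)).
- exact: (solves_comb _ _ T0 (S2 lam) (S1 lam)).
- by rewrite -(W lam); ring.
- by ring.
- by ring.
- by rewrite -(W lam); ring.
Qed.

Lemma characteristic_forms (T : R) (q sigma : R -> C) (V : R) (X1 X2 : R -> C -> C) : 0 < T ->
  bounded_form T (U1 T (sigma : R -> Cx R)) V ->
  fundamental_solutions T q (X1 : R -> Cx R -> Cx R) (X2 : R -> Cx R -> Cx R) ->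
  exists phi dphi psi dpsi, [/\ terminal_system T q phi dphi psi dpsi,
    forall z, Delta1 T (sigma : R -> Cx R) X1 X2 z = (-1) * U1 T (sigma : R -> Cx R) (psi ^~ z) &
    forall z, Delta11 T (sigma : R -> Cx R) X1 X2 z = 1 * U1 T (sigma : R -> Cx R) (phi ^~ z)].
Proof.
move=> T0 bU hX; have S := terminal_of_fundamental T0 hX.
do 4 eexists; split; first exact: S.
  move=> z; have [[H1 _ _] [H2 _ _]] := hX z.
  have c1 := solves_cont (solution_solves T0 H1); have c2 := solves_cont (solution_solves T0 H2).
  rewrite (form_comb (X1 T z) (- X2 T z) T0 bU c2 c1) /Delta1 /V1; ring.
move=> z; have [[H1 _ _] [H2 _ _]] := hX z.
have c1 := solves_cont (solution_solves T0 H1); have c2 := solves_cont (solution_solves T0 H2).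
rewrite (form_comb (deriv_in T (X2 ^~ z) T) (- deriv_in T (X1 ^~ z) T) T0 bU c1 c2) /Delta11 /V2; ring.
Qed.

(** Agreement of the normalized solutions on (0, T] forces the potentials to agree where both
equations hold: there [(q - qt) phi = (q - qt) psi = 0], and the Wronskian is 1. *)
Lemma potential_eq (T : R) (q qt : R -> C) (phi dphi psi dpsi phit dphit psit dpsit : R -> C -> C) (lam : C) :
  0 < T -> terminal_system T q phi dphi psi dpsi -> terminal_system T qt phit dphit psit dpsit ->
  (forall x, 0 < x -> x <= T -> phit x lam = phi x lam /\ psit x lam = psi x lam) ->
  {ae @lebesgue_measure R, forall x, x \in `]0, T[ -> q x = qt x}.
Proof.
move=> T0 S St e.
have [f1 f2 [E1 n1 f3]] := phi_solves S lam; have [p1 p2 [E2 n2 p3]] := psi_solves S lam.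
have [g1 g2 [E3 n3 g3]] := phi_solves St lam; have [r1 r2 [E4 n4 r3]] := psi_solves St lam.
have deq (y dy yt dyt : R -> C) : (forall x, 0 <= x -> x <= T -> isd T y x (dy x)) ->
    (forall x, 0 <= x -> x <= T -> isd T yt x (dyt x)) -> dy T = dyt T ->
    (forall x, 0 < x -> x <= T -> yt x = y x) -> forall x, 0 < x -> x <= T -> dy x - dyt x = 0.
  move=> hy hyt eT ee x x0; rewrite le_eqVlt => /orP[/eqP ->|xT]; first by rewrite eT subrr.
  apply: (@isd_right_zero R T (fun t => y t - yt t) x) => //; first exact: ltW.
    by move=> t xt tT; rewrite ee ?subrr //; exact: lt_le_trans xt.
  by apply: isdB; [apply: hy|apply: hyt]; exact: ltW.
have dphiE := deq _ _ _ _ f1 g1 _ (fun x x0 xT => (e x x0 xT).1).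
have dpsiE := deq _ _ _ _ p1 r1 _ (fun x x0 xT => (e x x0 xT).2).
have {}dphiE := dphiE ltac:(by rewrite (dphi_T S) (dphi_T St)).
have {}dpsiE := dpsiE ltac:(by rewrite (dpsi_T S) (dpsi_T St)).
have nE := negligibleU (negligibleU n1 n2) (negligibleU n3 n4).
apply: negligibleS nE => x nP; apply: contrapT => nx; apply: nP => /=.
rewrite in_itv /= => /andP[x0 xT]; have x0' := ltW x0; have xT' := ltW xT.
have eqf : (q x - lam) * phi x lam - (qt x - lam) * phit x lam = 0.
  apply: (@isd_right_zero R T (fun t => dphi t lam - dphit t lam) x) => //.
    by move=> t xt tT; apply: dphiE => //; exact: lt_le_trans xt.
  apply: isdB; [apply: f3|apply: g3] => //; apply: contra_not nx => h; first by left; left.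
  by right; left.
have eqp : (q x - lam) * psi x lam - (qt x - lam) * psit x lam = 0.
  apply: (@isd_right_zero R T (fun t => dpsi t lam - dpsit t lam) x) => //.
    by move=> t xt tT; apply: dpsiE => //; exact: lt_le_trans xt.
  apply: isdB; [apply: p3|apply: r3] => //; apply: contra_not nx => h; first by left; right.
  by right; right.
have [ef ep] := e x x0 xT'.
rewrite ef in eqf; rewrite ep in eqp.
apply/eqP; rewrite -subr_eq0; apply/eqP.
have := wronskian_constT T0 (phi_solves S lam) (psi_solves S lam) x0' xT'.
rewrite (phi_T S) (dphi_T S) (psi_T S) (dpsi_T S) => W.
rewrite -[LHS]mulr1 (_ : 1 = phi x lam * dpsi x lam - dphi x lam * psi x lam); last first.
  by rewrite -[RHS]opprK opprB W; ring.
have -> : (q x - qt x) * (phi x lam * dpsi x lam - dphi x lam * psi x lam) =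
  ((q x - lam) * phi x lam - (qt x - lam) * phi x lam) * dpsi x lam -
  ((q x - lam) * psi x lam - (qt x - lam) * psi x lam) * dphi x lam by ring.
by rewrite eqf eqp !mul0r subrr.
Qed.

End FromDefinitions.

Theorem theorem2 (R : realType) (T : R) (hT : 0 < T)
    (sigma1 : R -> Cx R)
    (hBV : complex_BV T sigma1)
    (hrc : right_continuous_in T sigma1)
    (hH1 : jump0 sigma1 <> 0)
    (q qt : R -> Cx R) (hq : L1_potential T q) (hqt : L1_potential T qt)
    (X1 X2 Xt1 Xt2 : R -> Cx R -> Cx R)
    (hX : fundamental_solutions T q X1 X2)
    (hXt : fundamental_solutions T qt Xt1 Xt2)
    (ev1 ev11 evt1 evt11 : nat -> Cx R)
    (hev1 : zeros_with_multiplicity (Delta1 T sigma1 X1 X2) ev1)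
    (hev11 : zeros_with_multiplicity (Delta11 T sigma1 X1 X2) ev11)
    (hevt1 : zeros_with_multiplicity (Delta1 T sigma1 Xt1 Xt2) evt1)
    (hevt11 : zeros_with_multiplicity (Delta11 T sigma1 Xt1 Xt2) evt11)
    (h1 : forall n : nat, (0 < n)%N -> ev1 n = evt1 n)
    (h11 : forall n : nat, (0 < n)%N -> ev11 n = evt11 n) :
  {ae @lebesgue_measure R, forall x, x \in `]0, T[ -> q x = qt x}.
Proof.
have [V mf] := U1_mass hT hBV; have bU := mass_form mf.
have H0 : jump0 sigma1 != 0 by apply/eqP.
have [phi [dphi [psi [dpsi [S D1 D11]]]]] := characteristic_forms hT bU hX.
have [phit [dphit [psit [dpsit [St Dt1 Dt11]]]]] := characteristic_forms hT bU hXt.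
have [ord1 [k1 kt1]] := common_order hev1 hevt1 h1.
have [ord11 [k11 kt11]] := common_order hev11 hevt11 h11.
have Upsi z : U1 T sigma1 (psi ^~ z) = U1 T sigma1 (psit ^~ z).
  apply: (form_eq_of_zeros (alpha := 0) (beta := 1) hT hq hqt mf H0 S St (psi_solves S)
    (psi_solves St) _ _ _ _ D1 Dt1 k1 kt1).
  - by move=> lam; rewrite (psi_T S) (dpsi_T S).
  - by move=> lam; rewrite (psi_T St) (dpsi_T St).
  - move=> kappa kn; rewrite cabs0 cabs1 !add0r !mul1r cabsN cabsV; split => //.
    by rewrite invr_gt0 cabs_gt0.
  - by rewrite cabsN cabs1.
have Uphi z : U1 T sigma1 (phi ^~ z) = U1 T sigma1 (phit ^~ z).
  apply: (form_eq_of_zeros (alpha := 1) (beta := 0) hT hq hqt mf H0 S St (phi_solves S)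
    (phi_solves St) _ _ _ _ D11 Dt11 k11 kt11).
  - by move=> lam; rewrite (phi_T S) (dphi_T S).
  - by move=> lam; rewrite (phi_T St) (dphi_T St).
  - by move=> kappa _; rewrite !mul0r subr0 cabs0 cabs1 mul0r addr0.
  - exact: cabs1.
have step n : forall x z, T / 2 ^+ n <= x -> x <= T ->
    phit x z = phi x z /\ psit x z = psi x z.
  elim: n => [|n IH] x z.
    rewrite expr0 divr1 => Tx xT; have -> : x = T by apply/eqP; rewrite eq_le xT.
    by rewrite (phi_T S) (phi_T St) (psi_T S) (psi_T St).
  have p2 : 0 < 2 ^+ n :> R by rewrite exprn_gt0.
  have -> : T / 2 ^+ n.+1 = T / 2 ^+ n / 2 by rewrite exprSr invfM mulrA.
  apply: (halving_step hT S St hq hqt mf H0 Uphi Upsi _ _ IH).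
    by rewrite divr_gt0.
  by rewrite ler_pdivrMr // ler_peMr ?(ltW hT) // exprn_ege1 // ler1n.
apply: (potential_eq (lam := 0) hT S St) => x x0 xT.
apply: (step (Num.truncn (T / x)).+1) => //.
have Tx : 0 <= T / x by rewrite divr_ge0 // ltW.
have /andP[_ h] := truncn_itv Tx.
rewrite ler_pdivrMr ?exprn_gt0 // mulrC -ler_pdivrMr //; apply: (le_trans (ltW h)).
by rewrite -natrX ler_nat ltnW // ltn_expl.
Qed.
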